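(* Let $q\equiv2\pmod3$ be a prime power, $m=(q+1)/3$, let $P=P_{(a,b)}\in\mathcal X_3(\overline{\mathbb F}_{q^2})\setminus\mathcal X_3(\mathbb F_{q^2})$ and let $i$ be the $\mathcal P$-order of $\alpha(P)$. Suppose $i\le m-2$. Put $L=\lfloor (m-2-i)/(i+1)\rfloor$, $S=\{(m-2-i-\ell(i+1))q+(\ell+1)(3i+3)\mid \ell=0,\dots,L\}$ and $S+1=\{s+1: s\in S\}$. Then $$G(P)=(G_{gen}\setminus S)\cup (S+1),\qquad H(P)=(H_{gen}\setminus (S+1))\cup S,$$ where $G_{gen}=\{jq+k\mid j=0,\dots,m-2,\ k=1,\dots,q-3j-2\}\cup\{(m-1)q+1\}$ and $H_{gen}=\{0\}\cup\{(j+1)(q-3)+2+k\mid j=0,\dots,m-2,\ k=0,\dots,3j+1\}\cup\{n\ge(m-1)q+2\}$.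
   Context: Let $\mathcal X_3$ be the nonsingular projective model (defined over $\mathbb F_{q^2}$) of the plane curve $y^{q+1}+x^{2m}+x^m=0$. Points not centered at $(0,0)$ and not over the point at infinity have affine coordinates $(a,b)$, $a\neq0$, denoted $P_{(a,b)}$; for such a point with $a^m\ne-1$ put $\alpha(P_{(a,b)})=a^m/(1+a^m)$. Fix a primitive cube root of unity $\zeta_3\in\mathbb F_{q^2}$ and let $\mathcal P_i(s)=\frac{(s+\zeta_3)^{3i}-(s+\zeta_3^2)^{3i}}{3(\zeta_3-\zeta_3^2)s(s-1)}$ for $i\in\mathbb Z$. For $\alpha\in\overline{\mathbb F}_{q^2}\setminus\{0,1,-\zeta_3,-\zeta_3^2\}$ the $\mathcal P$-order of $\alpha$ is the smallest positive integer $i$ with $\mathcal P_{i+1}(\alpha)=0$ (for non-$\mathbb F_{q^2}$-rational $P$, $\alpha(P)$ lies in this set). $H(P)$ is the Weierstrass semigroup at $P$ (integers $n\geq0$ such that some function has pole divisor exactly $nP$), and $G(P)$ is its set of gaps (positive integers not in $H(P)$). *)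

(* Defs.v *)
(* Function field F/K of the curve X_3 given abstractly:
   F is generated over K (via iota) by x, y with x transcendental and
   y^(q+1) + x^(2m) + x^m = 0; places of F/K are normalized discrete
   valuations of F trivial on K. *)
From HB Require Import structures.
From mathcomp Require Import all_boot all_order all_algebra.
Set Implicit Arguments. Unset Strict Implicit. Unset Printing Implicit Defensive.
Import Order.TTheory GRing.Theory Num.Theory.
Local Open Scope ring_scope.

Definition eval2 (K F : fieldType) (iota : {rmorphism K -> F})
  (P : {poly {poly K}}) (x y : F) : F :=
  \sum_(i < size P) (map_poly iota P`_i).[x] * y ^+ i.

(* v is a (normalized discrete) valuation of F/K, i.e. a place of F/K;
   only its values on nonzero elements matter *)
Definition is_place (K F : fieldType) (iota : {rmorphism K -> F}) (v : F -> int) : Prop :=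
  [/\ (forall a b, a != 0 -> b != 0 -> v (a * b) = v a + v b),
      (forall a b, a != 0 -> b != 0 -> a + b != 0 ->
          v a <= v (a + b) \/ v b <= v (a + b)),
      (forall c, c != 0 -> v (iota c) = 0) &
      (exists t, t != 0 /\ v t = 1)].

Definition same_place (F : fieldType) (v w : F -> int) : Prop :=
  forall f, f != 0 -> v f = w f.

Definition regular_at (F : fieldType) (v : F -> int) (f : F) : Prop :=
  f = 0 \/ 0 <= v f.

Definition in_weierstrass (K F : fieldType) (iota : {rmorphism K -> F})
  (vP : F -> int) (n : nat) : Prop :=
  exists f : F, f != 0 /\ vP f = - (n%:Z) /\
    forall Q : F -> int, is_place iota Q -> ~ same_place Q vP -> regular_at Q f.

Definition is_gap (K F : fieldType) (iota : {rmorphism K -> F})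
  (vP : F -> int) (n : nat) : Prop :=
  (0 < n)%N /\ ~ in_weierstrass iota vP n.

Definition calP (K : fieldType) (zeta : K) (i : nat) (s : K) : K :=
  ((s + zeta) ^+ (3 * i) - (s + zeta ^+ 2) ^+ (3 * i)) /
  (3%:R * (zeta - zeta ^+ 2) * s * (s - 1)).

Definition P_order (K : fieldType) (zeta alpha : K) (i : nat) : Prop :=
  [/\ (0 < i)%N, calP zeta i.+1 alpha = 0 &
      forall j, (0 < j < i)%N -> calP zeta j.+1 alpha != 0].

Definition alphaP (K : fieldType) (m : nat) (a : K) : K := a ^+ m / (1 + a ^+ m).

Definition Sset (q m i n : nat) : Prop :=
  exists l, (l <= (m - 2 - i) %/ (i + 1))%N /\
    n = ((m - 2 - i - l * (i + 1)) * q + (l + 1) * (3 * i + 3))%N.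

Definition Ggen (q m n : nat) : Prop :=
  (exists j k, [/\ (j <= m - 2)%N, (1 <= k <= q - 3 * j - 2)%N & n = (j * q + k)%N])
  \/ n = ((m - 1) * q + 1)%N.

Definition Hgen (q m n : nat) : Prop :=
  n = 0%N
  \/ (exists j k, [/\ (j <= m - 2)%N, (k <= 3 * j + 1)%N &
                      n = ((j + 1) * (q - 3) + 2 + k)%N])
  \/ ((m - 1) * q + 2 <= n)%N.

(* Main.v *)
(* With z = y^3/x the curve is the smooth complete intersection of the cubic
   surface y^3 = xz and of x^m + z^m + 1 = 0 in projective 3-space, and the
   functions with poles bounded by k times the plane at infinity are the forms of
   degree k in x, z, y.  Put l = a^q x + c^q z + 1 - 3 b^q y with c = b^3/a: its
   divisor is qP + Fr(P) minus the plane at infinity, and l = 0 cuts the cubic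
   surface in a nodal plane cubic with parameter r, on which P is r0 = a^m and
   Fr(P) is r0^q.  Modulo t^q, t a uniformizer at P, a form of degree d is a
   polynomial in r of degree at most 3d taking the same value at the two branches
   r = zeta, zeta^2 of the node.  Hence, for d < m, the orders at P of forms of degree
   d not divisible by l are 0, ..., 3d - 1, except that 3d replaces 3d - 1 when
   (r - r0)^(3d) takes equal values at the branches, that is, when i + 1 divides d.
   The forms of degree m - 1 are the regular differentials, so their orders
   increased by one are gaps; they are as many as the genus, and a dimension count
   shows that there are no others. *)

(* Places are abstract valuations, so a place over Fr(P), the uniqueness of places over a point, and
   the polynomial nature of functions regular off infinity must all come from the equations. They
   rest on the uniqueness of a normal form, which makes evaluation at a point well defined. No
   residue theorem is used to see that an order raised by one is a gap. If [f] has its only pole at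
   P, of order [n + 1], and [h] is a form of degree [m - 1] with order [n], then [f * h * l] is a
   form of degree [m] with order [q - 1] at P and a zero at Fr(P). On the nodal cubic it becomes
   [u * k] with [k] of degree at most one, whereas the equation of the curve restricts to a constant
   times [u * (r - r0)]. Both take equal values at the two branches of the node, which makes [k]
   proportional to [r - r0]: one order too many. Non-gaps come from [g / l ^ k], where [g] has
   degree [k] and vanishes [k] times at Fr(P). That P is not rational enters through [r0] alone: it
   keeps [r0] away from [-1] and from the node, and makes [r0] and [r0 ^ q] distinct. *)
Require Import Defs.
From HB Require Import structures.
From mathcomp Require Import all_boot all_order all_algebra.
From mathcomp Require Import zify ring.
From Stdlib Require Import Classical ClassicalEpsilon.
Set Implicit Arguments. Unset Strict Implicit. Unset Printing Implicit Defensive.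
Import Order.TTheory GRing.Theory Num.Theory.
Local Open Scope ring_scope.

(* [v 0] is a junk value, hence the first disjunct. *)
Definition vge (F : fieldType) (v : F -> int) (n : int) (f : F) : Prop :=
  f = 0 \/ n <= v f.

(** * Valuations *)

Section Place.
Variables (K F : fieldType) (iota : {rmorphism K -> F}) (v : F -> int).
Hypothesis pv : is_place iota v.

Lemma placeM a b : a != 0 -> b != 0 -> v (a * b) = v a + v b.
Proof. by case: pv => h _ _ _; apply: h. Qed.

Lemma place_const c : c != 0 -> v (iota c) = 0.
Proof. by case: pv => _ _ h _; apply: h. Qed.

Lemma place1 : v 1 = 0.
Proof. by rewrite -(rmorph1 iota) place_const ?oner_neq0. Qed.

Lemma placeN a : v (- a) = v a.
Proof.
have [->|a0] := eqVneq a 0; first by rewrite oppr0.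
by rewrite -mulN1r placeM ?oppr_eq0 ?oner_eq0 // -(rmorph1 iota) -rmorphN
  place_const ?add0r // oppr_eq0 oner_eq0.
Qed.

Lemma placeV a : a != 0 -> v a^-1 = - v a.
Proof.
move=> a0; have := placeM a0 (invr_neq0 a0).
by rewrite divff // place1 => /esym/eqP; rewrite addr_eq0 => /eqP ->; rewrite opprK.
Qed.

Lemma placeX a n : a != 0 -> v (a ^+ n) = v a *+ n.
Proof.
move=> a0; elim: n => [|n IH]; first by rewrite expr0 place1 mulr0n.
by rewrite exprS placeM ?expf_neq0 // IH mulrS.
Qed.

Lemma placeXz a (k : int) : a != 0 -> v (a ^ k) = k * v a.
Proof.
move=> a0; case: k => n; first by rewrite -exprnP placeX // -mulr_natl natz.
by rewrite NegzE -exprnN placeV ?expf_neq0 // placeX // -mulr_natl natz mulNr.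
Qed.

Lemma vgeP n f : f != 0 -> vge v n f -> n <= v f.
Proof. by move=> f0 [e|//]; rewrite e eqxx in f0. Qed.

Lemma vge_le n k f : k <= n -> vge v n f -> vge v k f.
Proof. by move=> kn [->|h]; [left|right; apply: le_trans h]. Qed.

Lemma vgeN n f : vge v n f -> vge v n (- f).
Proof. by move=> [->|h]; [left; rewrite oppr0|right; rewrite placeN]. Qed.

Lemma vgeD n f g : vge v n f -> vge v n g -> vge v n (f + g).
Proof.
have [->|f0] := eqVneq f 0; first by rewrite add0r.
have [->|g0] := eqVneq g 0; first by rewrite addr0.
move=> /(vgeP f0) hf /(vgeP g0) hg; have [e|fg0] := eqVneq (f + g) 0; first by left.
right; case: pv => _ h _ _.
by case: (h _ _ f0 g0 fg0) => h1; apply: le_trans h1.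
Qed.

Lemma vgeB n f g : vge v n f -> vge v n g -> vge v n (f - g).
Proof. by move=> hf hg; apply: vgeD => //; apply: vgeN. Qed.

Lemma vgeM n k f g : vge v n f -> vge v k g -> vge v (n + k) (f * g).
Proof.
have [->|f0] := eqVneq f 0; first by rewrite mul0r; left.
have [->|g0] := eqVneq g 0; first by rewrite mulr0; left.
move=> /(vgeP f0) hf /(vgeP g0) hg; right; rewrite placeM //; exact: lerD.
Qed.

Lemma vgeMl n f g : vge v 0 f -> vge v n g -> vge v n (f * g).
Proof. by move=> hf hg; rewrite -[n]add0r; apply: vgeM. Qed.

Lemma vgeMr n f g : vge v n f -> vge v 0 g -> vge v n (f * g).
Proof. by move=> hf hg; rewrite -[n]addr0; apply: vgeM. Qed.

Lemma vge_const c : vge v 0 (iota c).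
Proof.
have [->|c0] := eqVneq c 0; first by left; rewrite rmorph0.
by right; rewrite place_const.
Qed.

Lemma vge1 : vge v 0 1. Proof. by right; rewrite place1. Qed.

Lemma vgeX n f k : vge v n f -> vge v (n *+ k) (f ^+ k).
Proof.
move=> h; elim: k => [|k IH]; first by rewrite expr0 mulr0n; exact: vge1.
by rewrite exprS mulrS; apply: vgeM.
Qed.

Lemma vge0X f k : vge v 0 f -> vge v 0 (f ^+ k).
Proof. by move/(@vgeX _ _ k); rewrite mul0rn. Qed.

Lemma vge_sum (I : Type) (r : seq I) (P : pred I) n (E : I -> F) :
  (forall i, P i -> vge v n (E i)) -> vge v n (\sum_(i <- r | P i) E i).
Proof. by move=> h; elim/big_ind: _ => //; [left|move=> *; apply: vgeD]. Qed.

Lemma vge_poly (p : {poly K}) f : vge v 0 f -> vge v 0 (map_poly iota p).[f].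
Proof.
move=> hf; rewrite horner_coef; apply: vge_sum => j _.
by rewrite coef_map; apply: vgeMl; [exact: vge_const|apply: vge0X].
Qed.

Lemma vgeMr_unit n f u : u != 0 -> v u = 0 -> vge v n (f * u) -> vge v n f.
Proof.
move=> u0 vu; have [->|f0] := eqVneq f 0; first by left.
move=> /(vgeP (mulf_neq0 f0 u0)); rewrite placeM // vu addr0; by right.
Qed.

Lemma placeD_lt f g : f != 0 -> vge v (v f + 1) g -> f + g != 0 /\ v (f + g) = v f.
Proof.
move=> f0 hg.
have fg0 : f + g != 0.
  apply/eqP => /eqP; rewrite addr_eq0 => /eqP e; move: hg; rewrite e in f0 *.
  move: f0; rewrite oppr_eq0 => g0 /(vgeP g0); rewrite placeN; lia.
split=> //; apply/eqP; rewrite eq_le; apply/andP; split; last first.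
  by apply: (vgeP fg0); apply: vgeD; [right|apply: vge_le hg; lia].
rewrite leNgt; apply/negP => lt.
have : vge v (v f + 1) f.
  have {2}-> : f = f + g - g by rewrite addrK.
  by apply: vgeB => //; right; lia.
by move/(vgeP f0); lia.
Qed.

Lemma vge1_constP c : vge v 1 (iota c) -> c = 0.
Proof.
have [->//|c0] := eqVneq c 0.
have i0 : iota c != 0 by rewrite fmorph_eq0.
by move/(vgeP i0); rewrite place_const.
Qed.

Lemma place_unit f c : c != 0 -> vge v 1 (f - iota c) -> f != 0 /\ v f = 0.
Proof.
move=> c0 h; have i0 : iota c != 0 by rewrite fmorph_eq0.
have [] := @placeD_lt (iota c) (f - iota c) i0; first by rewrite place_const.
by rewrite addrCA subrr addr0 place_const.
Qed.

(** The valuation ideal is prime. With a split polynomial in [f] as the product, this exhibits the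
    residue of [f] as one of the roots. *)
Lemma vge_prod1 (r : seq K) f : vge v 0 f ->
  vge v 1 (\prod_(c <- r) (f - iota c)) -> exists2 c, c \in r & vge v 1 (f - iota c).
Proof.
move=> hf; elim: r => [|c r IH].
  by rewrite big_nil => /(vgeP (oner_neq0 F)); rewrite place1.
rewrite big_cons; have [fc0 _|fc0] := eqVneq (f - iota c) 0.
  by exists c; [rewrite mem_head|rewrite fc0; left].
have := vgeP fc0 (vgeB hf (vge_const c)); rewrite le_eqVlt => /orP[/eqP e|gt].
  rewrite mulrC => /(vgeMr_unit fc0 (esym e))/IH[d dr hd].
  by exists d => //; rewrite inE dr orbT.
by exists c; [rewrite mem_head|right; lia].
Qed.
End Place.

(** * Finite-dimensional spaces of functions and their orders at a place *)

Section Echelon.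
Variables (K F : fieldType) (iota : {rmorphism K -> F}).

Fixpoint lspan (s : seq F) (f : F) : Prop :=
  if s is g :: s' then exists c, lspan s' (f - iota c * g) else f = 0.

Fixpoint indep (s : seq F) : Prop :=
  if s is g :: s' then ~ lspan s' g /\ indep s' else True.

Lemma lspan0 s : lspan s 0.
Proof. by elim: s => //= g s IH; exists 0; rewrite rmorph0 mul0r subr0. Qed.

Lemma lspanD s f g : lspan s f -> lspan s g -> lspan s (f + g).
Proof.
elim: s f g => [|h s IH] f g /=; first by move=> -> ->; rewrite addr0.
move=> [c hc] [d hd]; exists (c + d); rewrite rmorphD mulrDl opprD addrACA.
exact: IH.
Qed.

Lemma lspanZ s c f : lspan s f -> lspan s (iota c * f).
Proof.
elim: s f => [|h s IH] f /=; first by move=> ->; rewrite mulr0.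
by move=> [d hd]; exists (c * d); rewrite rmorphM -mulrA -mulrBr; apply: IH.
Qed.

Lemma lspan_in s g : g \in s -> lspan s g.
Proof.
elim: s => //= h s IH; rewrite inE => /orP[/eqP ->|/IH hg].
  by exists 1; rewrite rmorph1 mul1r subrr; apply: lspan0.
by exists 0; rewrite rmorph0 mul0r subr0.
Qed.

Lemma lspan_closed (W : F -> Prop) s f :
  W 0 -> (forall f g, W f -> W g -> W (f + g)) -> (forall c f, W f -> W (iota c * f)) ->
  (forall g, g \in s -> W g) -> lspan s f -> W f.
Proof.
move=> W0 WD WZ; elim: s f => [|h s IH] f Ws /=; first by move=> ->.
move=> [c hc]; rewrite -(subrK (iota c * h) f); apply: WD.
  by apply: IH hc => g gs; apply: Ws; rewrite inE gs orbT.
by apply: WZ; apply: Ws; rewrite mem_head.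
Qed.

Lemma lspan_sub s s' f : (forall g, g \in s -> lspan s' g) -> lspan s f -> lspan s' f.
Proof.
by apply: (@lspan_closed (lspan s')); [exact: lspan0|exact: lspanD|move=> *; apply: lspanZ].
Qed.

Variable v : F -> int.
Hypothesis pv : is_place iota v.

(** Says that the residue field is [K]: the ratio of two functions of equal order is constant up to
    positive order. *)
Definition residual := forall f g, f != 0 -> g != 0 -> v f = v g ->
  exists c, vge v (v g + 1) (f - iota c * g).
Hypothesis resv : residual.

(** Elimination by orders: as long as [v f] is attained in [s], a constant multiple of the element
    of that order is subtracted. Each step raises the order, so the process ends at the latest when
    the bound [B] on the orders of [s] is passed. *)
Lemma reduce_span s f : all (fun g => g != 0) s ->
  exists g, lspan s (f - g) /\ (g = 0 \/ v g \notin map v s).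
Proof.
move=> s0.
have [B hB] : exists B : int, forall g, g \in s -> v g <= B.
  elim: s {s0} => [|h s [B hB]]; first by exists 0.
  exists (Num.max (v h) B) => g; rewrite inE => /orP[/eqP ->|/hB h1].
    by rewrite le_max lexx.
  by rewrite le_max h1 orbT.
have [n hn] : exists n : nat, f = 0 \/ B - v f < n%:Z.
  by exists `|B - v f|%N.+1; right; lia.
elim: n f hn => [|n IH] f hn.
  exists f; split; first by rewrite subrr; apply: lspan0.
  case: hn => [->|hn]; [by left|right]; apply/mapP => -[g /hB]; lia.
have [e|f0] := eqVneq f 0.
  by exists 0; rewrite e subrr; split; [exact: lspan0|left].
case: (boolP (v f \in map v s)) => [|nin]; last first.
  by exists f; rewrite subrr; split; [exact: lspan0|right].
move=> /mapP[h hs e].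
have h0 := allP s0 _ hs.
have [c hc] := resv f0 h0 e.
have [|g [sg vg]] := IH (f - iota c * h).
  case: hc => [->|hc]; [by left|right]; case: hn => [e0|]; last first.
    by move: hc; rewrite e; move: (v h) (v (f - _)) => p1 p2; lia.
  by rewrite e0 eqxx in f0.
exists g; split=> //.
rewrite -[f - g](addrK (iota c * h)) addrAC addrC.
have -> : iota c * h + (f - g - iota c * h) = iota c * h + (f - iota c * h - g) by ring.
by apply: lspanD => //; apply/lspanZ/lspan_in.
Qed.

(** Converts a dimension into a number of distinct orders, the shape in which gaps and non-gaps are
    counted in the end. *)
Lemma echelon s : indep s -> exists s', [/\ size s' = size s,
  all (fun g => g != 0) s', uniq (map v s') & forall g, g \in s' -> lspan s g].
Proof.
elim: s => [|f s IH] /=; first by exists [::].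
move=> [fs /IH[s' [sz s0 us ss]]].
have [g [sg vg]] := reduce_span f s0.
have g0 : g != 0.
  apply/eqP => e; apply: fs; rewrite e subr0 in sg; exact: lspan_sub sg.
case: vg => [e|vg]; first by rewrite e eqxx in g0.
exists (g :: s'); split=> /=; rewrite ?sz ?g0 ?vg // => h.
rewrite inE => /orP[/eqP ->|/ss hs].
  exists 1; rewrite rmorph1 mul1r -opprB -mulN1r -(rmorph1 iota) -rmorphN.
  by apply: lspanZ; apply: lspan_sub sg.
by exists 0; rewrite rmorph0 mul0r subr0.
Qed.

(** Leading terms of distinct orders cannot cancel, so the smallest of them survives. *)
Lemma lspan_val s f : all (fun g => g != 0) s -> uniq (map v s) ->
  lspan s f -> f != 0 -> v f \in map v s.
Proof.
elim: s f => [|g s IH] f /=; first by move=> _ _ ->; rewrite eqxx.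
move=> /andP[g0 s0] /andP[gs us] [c sf] f0; rewrite inE.
set h := f - _ in sf; have fE : f = iota c * g + h by rewrite /h addrC subrK.
have [c0|c0] := eqVneq c 0.
  have fh : f = h by rewrite fE c0 rmorph0 mul0r add0r.
  by rewrite fh IH ?orbT // -fh.
have cg0 : iota c * g != 0 by rewrite mulf_neq0 // fmorph_eq0.
have vcg : v (iota c * g) = v g by rewrite (placeM pv) ?fmorph_eq0 // (place_const pv) // add0r.
have [h0|h0] := eqVneq h 0; first by rewrite fE h0 addr0 vcg eqxx.
have vh := IH _ s0 us sf h0.
have [lt|lt|e] := ltgtP (v g) (v h).
- by rewrite fE (placeD_lt pv cg0 _).2 ?vcg ?eqxx //; right; lia.
- by rewrite fE addrC (placeD_lt pv h0 _).2 ?vh ?orbT //; right; rewrite vcg; lia.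
- by rewrite -e (negPf gs) in vh.
Qed.

Lemma indep_vals s : all (fun g => g != 0) s -> uniq (map v s) -> indep s.
Proof.
elim: s => //= g s IH /andP[g0 s0] /andP[gs us]; split; last exact: IH.
by move=> sg; rewrite (lspan_val s0 us sg g0) in gs.
Qed.
End Echelon.

(** * The affine ring of the curve *)

(* One expression is evaluated in the function field, at a point of the curve,
   and along the nodal cubic. *)
Inductive expr (K : Type) :=
  Ec of K | Ex | Ez | Ey | Eadd of expr K & expr K | Emul of expr K & expr K.
Arguments Ex {K}.
Arguments Ey {K}.
Arguments Ez {K}.

Fixpoint edeg (K : Type) (e : expr K) : nat :=
  match e with
  | Ec _ => 0
  | Ex | Ez | Ey => 1
  | Eadd e1 e2 => maxn (edeg e1) (edeg e2)
  | Emul e1 e2 => (edeg e1 + edeg e2)%N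
  end.

Section Eval.
Variables (K R : nzRingType) (j : K -> R) (X Z Y : R).

Fixpoint ev (e : expr K) : R :=
  match e with
  | Ec c => j c
  | Ex => X
  | Ez => Z
  | Ey => Y
  | Eadd e1 e2 => ev e1 + ev e2
  | Emul e1 e2 => ev e1 * ev e2
  end.
End Eval.

Section CoefDegree.
Variable K : fieldType.
Implicit Type s : nat -> nat -> {poly K}.

(** [s w b] is the coefficient of [z ^+ b * y ^+ w], a polynomial in [x]; as [size] is one more than
    the degree, this bounds the total degree by [d]. *)
Definition sz d s := forall w b, s w b != 0 -> (size (s w b) + b + w <= d.+1)%N.

Lemma szM k d (p : {poly K}) s : (size p <= k.+1)%N -> sz d s ->
  sz (k + d) (fun w b => p * s w b).
Proof.
move=> hp hs w b; rewrite mulf_eq0 negb_or => /andP[p0 /[dup] r0 /hs].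
have := size_polyMleq p (s w b); rewrite -size_poly_gt0 in r0.
by move: hp r0; move: (size (p * s w b : {poly K})%R) (size p) (size (s w b)) => n1 n2 n3; lia.
Qed.

Lemma sz_le d d' s : (d <= d')%N -> sz d s -> sz d' s.
Proof. by move=> le h w b /h; lia. Qed.

Lemma szD d s1 s2 : sz d s1 -> sz d s2 -> sz d (fun w b => s1 w b + s2 w b).
Proof.
move=> h1 h2 w b; have := size_polyD (s1 w b) (s2 w b).
have [->|/h1] := eqVneq (s1 w b) 0; have [->|/h2] := eqVneq (s2 w b) 0; rewrite ?addr0 ?add0r.
- by rewrite eqxx.
- by move=> h _ _.
- by move=> h _ _.
- by move: (size (s1 w b)) (size (s2 w b)) (size (s1 w b + s2 w b : {poly K})%R) => n1 n2 n3; lia.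
Qed.

End CoefDegree.

(** * Normal forms modulo the two equations of the curve *)

Section NormalForm.
Variables (K : fieldType) (m : nat).
Hypothesis m_gt0 : (0 < m)%N.
Implicit Types (r : nat -> {poly K}) (s : nat -> nat -> {poly K}).

Section Values.
Variables (R : comNzRingType) (j : {rmorphism K -> R}) (X Z Y : R).

Definition zrow r : R := \sum_(b < m) (map_poly j (r b)).[X] * Z ^+ b.
Definition nfv s : R := \sum_(w < 3) zrow (s w) * Y ^+ w.

Lemma eq_zrow r1 r2 : (forall b, (b < m)%N -> r1 b = r2 b) -> zrow r1 = zrow r2.
Proof. by move=> h; apply: eq_bigr => b _; rewrite h. Qed.

Lemma zrowD r1 r2 : zrow (fun b => r1 b + r2 b) = zrow r1 + zrow r2.
Proof.
by rewrite -big_split; apply: eq_bigr => b _; rewrite rmorphD hornerD mulrDl.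
Qed.

Lemma zrowZ p r : zrow (fun b => p * r b) = (map_poly j p).[X] * zrow r.
Proof.
by rewrite mulr_sumr; apply: eq_bigr => b _; rewrite rmorphM hornerM mulrA.
Qed.

Lemma nfvD s1 s2 : nfv (fun w b => s1 w b + s2 w b) = nfv s1 + nfv s2.
Proof. by rewrite -big_split; apply: eq_bigr => w _; rewrite zrowD mulrDl. Qed.

Lemma nfvZ p s : nfv (fun w b => p * s w b) = (map_poly j p).[X] * nfv s.
Proof. by rewrite mulr_sumr; apply: eq_bigr => w _; rewrite zrowZ mulrA. Qed.

Lemma nfvE s : nfv s = zrow (s 0%N) + zrow (s 1%N) * Y + zrow (s 2%N) * Y ^+ 2.
Proof. by rewrite /nfv !big_ord_recl big_ord0 addr0 expr0 mulr1 addrA. Qed.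

(** Coefficients after multiplication by [Z]: the top one wraps around to the bottom through
    [Z ^+ m = - (X ^+ m + 1)]. Likewise [yshift] wraps [Y ^+ 3] to [X * Z]. *)
Definition zshift r (b : nat) : {poly K} :=
  if b is b'.+1 then r b' else - ('X^m + 1) * r m.-1.

Hypothesis XZ : X ^+ m + Z ^+ m + 1 = 0.
Hypothesis YXZ : Y ^+ 3 = X * Z.

Lemma zrow_shift r : zrow (zshift r) = Z * zrow r.
Proof.
rewrite /zrow; move: XZ; rewrite /zshift; case: m m_gt0 => // m' _ XZ'.
rewrite big_ord_recl big_ord_recr /= mulrDr mulr_sumr addrC; congr (_ + _).
  by apply: eq_bigr => b _; rewrite exprS mulrCA.
have -> : Z * ((map_poly j (r m')).[X] * Z ^+ m') = (map_poly j (r m')).[X] * Z ^+ m'.+1.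
  by rewrite exprS mulrCA.
have -> : Z ^+ m'.+1 = - (X ^+ m'.+1 + 1).
  by apply/eqP; rewrite -addr_eq0 addrA [Z ^+ _ + _]addrC XZ'.
by rewrite rmorphM rmorphN rmorphD /= map_polyXn rmorph1 !hornerE mulrC.
Qed.

Definition yshift s (w : nat) : nat -> {poly K} :=
  match w with
  | 0 => fun b => 'X * zshift (s 2%N) b
  | 1 => s 0%N
  | 2 => s 1%N
  | _ => fun=> 0
  end.

Lemma nfv_zshift s : nfv (fun w => zshift (s w)) = Z * nfv s.
Proof. by rewrite mulr_sumr; apply: eq_bigr => w _; rewrite zrow_shift mulrA. Qed.

Lemma nfv_yshift s : nfv (yshift s) = Y * nfv s.
Proof.
rewrite !nfvE /= zrowZ zrow_shift map_polyX hornerX mulrA -YXZ; ring.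
Qed.
End Values.

Lemma sz_zshift d s : sz d s -> sz d.+1 (fun w => zshift (s w)).
Proof.
move=> hs w [|b] /=; last by move=> /hs h; rewrite addnS addSn ltnS.
rewrite mulf_eq0 negb_or => /andP[_ /[dup] r0 /hs].
have := size_polyMleq (- ('X^m + 1)) (s w m.-1); rewrite -size_poly_gt0 in r0.
rewrite size_polyN; have : (size ('X^m + 1 : {poly K})%R <= m.+1)%N.
  by apply: leq_trans (size_polyD _ _) _; rewrite size_polyXn size_poly1 geq_max leqnn.
move: r0 m_gt0; move: (size (s _ _)) (size ('X^m + 1 : {poly K})%R) (size (_ * _ : {poly K})%R) => n1 n2 n3; lia.
Qed.

Lemma sz_yshift d s : sz d s -> sz d.+1 (yshift s).
Proof.
move=> hs [|[|w]] b /=; [|by move=> /hs h; rewrite addn1 ltnS -[X in (X <= _)%N]addn0|].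
  rewrite mulf_eq0 negb_or => /andP[_ /[dup] r0 /(sz_zshift hs)].
  have := size_polyMleq 'X (zshift (s 2%N) b); rewrite size_polyX -size_poly_gt0 in r0 *.
  by move: r0; move: (size (zshift _ _)) (size ('X * _ : {poly K})%R) => n1 n2; lia.
by case: w => [|w]; [move=> /hs h; rewrite addnS ltnS|rewrite eqxx].
Qed.

(** Letting an expression act on a normal form turns products into compositions, so two normal forms
    never have to be multiplied. The coefficients [s'] are chosen before the ring: a single normal
    form is valid in the function field and at every point. *)
Lemma normal_form_mul (e : expr K) : forall d s, sz d s ->
  exists2 s', sz (edeg e + d) s' &
    forall (R : comNzRingType) (j : {rmorphism K -> R}) (X Z Y : R),
      X ^+ m + Z ^+ m + 1 = 0 -> Y ^+ 3 = X * Z ->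
      ev j X Z Y e * nfv j X Z Y s = nfv j X Z Y s'.
Proof.
elim: e => [c||||e1 IH1 e2 IH2|e1 IH1 e2 IH2] d s hs.
- exists (fun w b => c%:P * s w b) => [|R j X Z Y _ _ /=].
    by apply: (szM (k := 0)) => //; rewrite size_polyC leq_b1.
  by rewrite nfvZ map_polyC hornerC.
- exists (fun w b => 'X * s w b) => [|R j X Z Y _ _ /=].
    by apply: (szM (k := 1)) => //; rewrite size_polyX.
  by rewrite nfvZ map_polyX hornerX.
- exists (fun w => zshift (s w)) => [|R j X Z Y XZ YXZ /=]; last by rewrite nfv_zshift.
  exact: sz_zshift.
- exists (yshift s) => [|R j X Z Y XZ YXZ /=]; last by rewrite nfv_yshift.
  exact: sz_yshift.
- have [s1 hs1 v1] := IH1 _ _ hs; have [s2 hs2 v2] := IH2 _ _ hs.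
  exists (fun w b => s1 w b + s2 w b) => [|R j X Z Y XZ YXZ /=].
    by apply: szD; [apply: sz_le hs1|apply: sz_le hs2]; rewrite leq_add2r ?leq_maxl ?leq_maxr.
  by rewrite nfvD mulrDl v1 // v2.
- have [s1 hs1 v1] := IH2 _ _ hs; have [s2 hs2 v2] := IH1 _ _ hs1.
  exists s2 => [|R j X Z Y XZ YXZ /=]; first by rewrite -addnA.
  by rewrite -mulrA v1 // v2.
Qed.

Lemma normal_form (e : expr K) : exists2 s, sz (edeg e) s &
  forall (R : comNzRingType) (j : {rmorphism K -> R}) (X Z Y : R),
    X ^+ m + Z ^+ m + 1 = 0 -> Y ^+ 3 = X * Z -> ev j X Z Y e = nfv j X Z Y s.
Proof.
pose s w b : {poly K} := if (w + b == 0)%N then 1 else 0.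
have hs : sz 0 s.
  by move=> [|w] [|b]; rewrite /s /= ?eqxx ?size_poly1.
have [s' hs' vs'] := normal_form_mul e hs; exists s'; first by rewrite addn0 in hs'.
move=> R j X Z Y XZ YXZ; rewrite -vs' //.
suff -> : nfv j X Z Y s = 1 by rewrite mulr1.
have z0 r : (forall b, r b = 0) -> zrow j X Z r = 0.
  by move=> h; apply: big1 => b _; rewrite h rmorph0 horner0 mul0r.
rewrite nfvE (z0 (s 1%N)) // !mul0r !addr0.
rewrite /zrow; case: m m_gt0 => // m' _.
rewrite big_ord_recl big1 /= => [|b _].
  by rewrite /s /= rmorph1 !hornerE ?mulr1.
by rewrite /s /= rmorph0 horner0 mul0r.
Qed.
End NormalForm.

(** [edeg] depends on the expression and only bounds the degree of the function, hence the
    existential. These are the dehomogenized forms of degree [d]. *)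
Definition dform (K F : nzRingType) (iota : K -> F) (x z y : F) (d : nat) (f : F) : Prop :=
  exists2 e : expr K, (edeg e <= d)%N & f = ev iota x z y e.

Section Forms.
Variables (K F : fieldType) (iota : {rmorphism K -> F}) (x z y : F).
Local Notation form := (dform iota x z y).

Lemma dform_le d d' f : (d <= d')%N -> form d f -> form d' f.
Proof. by move=> le [e he ->]; exists e => //; apply: leq_trans le. Qed.

Lemma dform_const c d : form d (iota c). Proof. by exists (Ec c). Qed.
Lemma dform0 d : form d 0. Proof. by exists (Ec 0) => //=; rewrite rmorph0. Qed.
Lemma dform1 d : form d 1. Proof. by exists (Ec 1) => //=; rewrite rmorph1. Qed.
Lemma dform_x : form 1 x. Proof. by exists Ex. Qed.
Lemma dform_z : form 1 z. Proof. by exists Ez. Qed.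
Lemma dform_y : form 1 y. Proof. by exists Ey. Qed.

Lemma dformD d f g : form d f -> form d g -> form d (f + g).
Proof.
by move=> [e he ->] [e' he' ->]; exists (Eadd e e') => //=; rewrite geq_max he he'.
Qed.

Lemma dformM d d' f g : form d f -> form d' g -> form (d + d') (f * g).
Proof.
by move=> [e he ->] [e' he' ->]; exists (Emul e e') => //=; apply: leq_add.
Qed.

Lemma dformZ d c f : form d f -> form d (iota c * f).
Proof. by rewrite -[d in form d (_ * _)]add0n; apply: dformM; apply: dform_const. Qed.

Lemma dformN d f : form d f -> form d (- f).
Proof. by move/(dformZ (-1)); rewrite rmorphN rmorph1 mulN1r. Qed.

Lemma dformB d f g : form d f -> form d g -> form d (f - g).
Proof. by move=> hf /dformN; apply: dformD. Qed.

Lemma dformX d f k : form d f -> form (d * k) (f ^+ k).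
Proof.
move=> hf; elim: k => [|k IH]; first by rewrite muln0; apply: dform1.
by rewrite exprS mulnS; apply: dformM.
Qed.

Lemma dform_sum (I : Type) (r : seq I) (P : pred I) d (E : I -> F) :
  (forall i, P i -> form d (E i)) -> form d (\sum_(i <- r | P i) E i).
Proof. by move=> h; elim/big_ind: _ => //; [exact: dform0|move=> *; apply: dformD]. Qed.

Definition affine f := exists d, form d f.

Lemma affine_form d f : form d f -> affine f. Proof. by exists d. Qed.
Lemma affine_const c : affine (iota c). Proof. by exists 0%N; apply: dform_const. Qed.
Lemma affine0 : affine 0. Proof. by exists 0%N; apply: dform0. Qed.
Lemma affine1 : affine 1. Proof. by exists 0%N; apply: dform1. Qed.
Lemma affine_x : affine x. Proof. by exists 1%N; apply: dform_x. Qed.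
Lemma affine_z : affine z. Proof. by exists 1%N; apply: dform_z. Qed.
Lemma affine_y : affine y. Proof. by exists 1%N; apply: dform_y. Qed.

Lemma affineM f g : affine f -> affine g -> affine (f * g).
Proof. by move=> [d hf] [d' hg]; exists (d + d')%N; apply: dformM. Qed.

Lemma affineD f g : affine f -> affine g -> affine (f + g).
Proof.
move=> [d hf] [d' hg]; exists (maxn d d').
by apply: dformD; [apply: dform_le hf; apply: leq_maxl|apply: dform_le hg; apply: leq_maxr].
Qed.

Lemma affineN f : affine f -> affine (- f).
Proof. by move=> [d hf]; exists d; apply: dformN. Qed.

Lemma affineX f k : affine f -> affine (f ^+ k).
Proof. by move=> [d hf]; exists (d * k)%N; apply: dformX. Qed.

Lemma affine_sum (I : Type) (r : seq I) (P : pred I) (E : I -> F) :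
  (forall i, P i -> affine (E i)) -> affine (\sum_(i <- r | P i) E i).
Proof. by move=> h; elim/big_ind: _ => //; [exact: affine0|move=> *; apply: affineD]. Qed.

Lemma affine_poly (p : {poly K}) f : affine f -> affine (map_poly iota p).[f].
Proof.
move=> hf; rewrite horner_coef; apply: affine_sum => j _; rewrite coef_map.
by apply: affineM; [exact: affine_const|apply: affineX].
Qed.

Lemma dform_nfv m (s : nat -> nat -> {poly K}) d :
  (forall w b, (w < 3)%N -> (b < m)%N -> s w b != 0 -> (size (s w b) + b + w <= d.+1)%N) ->
  form d (nfv m iota x z y s).
Proof.
move=> hs; apply: dform_sum => w _; rewrite /zrow mulr_suml; apply: dform_sum => b _.
have [->|s0] := eqVneq (s w b) 0; first by rewrite rmorph0 horner0 !mul0r; apply: dform0.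
have := hs w b (ltn_ord w) (ltn_ord b) s0; rewrite horner_coef size_map_poly !mulr_suml => hd.
apply: dform_sum => k _; rewrite coef_map -!mulrA; apply: dformZ.
apply: (dform_le (d := (1 * k + (1 * b + 1 * w))%N)).
  by have := ltn_ord k; move: hd; lia.
by apply: dformM; [|apply: dformM]; apply: dformX; [apply: dform_x|apply: dform_z|apply: dform_y].
Qed.
End Forms.

(** The conditions are stable under passing to [x^-1], [z / x], [y / x], so whatever is derived from
    them also holds in the chart at infinity. *)
Record curve_model (K : closedFieldType) (F : fieldType) (iota : {rmorphism K -> F})
  (m : nat) (x z y : F) : Prop := CurveModel {
  cm_m : m%:R != 0 :> K;
  cm_3 : 3%:R != 0 :> K;
  cm_transc : forall P : {poly K}, P != 0 -> (map_poly iota P).[x] != 0;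
  cm_fermat : x ^+ m + z ^+ m + 1 = 0;
  cm_y : y ^+ 3 = x * z;
  cm_frac : forall f, exists g h,
    [/\ affine iota x z y g, affine iota x z y h, h != 0 & f = g / h] }.

(** * Integrality over the polynomials in [x] *)

Section Model.
Variables (K : closedFieldType) (F : fieldType) (iota : {rmorphism K -> F}).
Variables (m : nat) (x z y : F).
Hypothesis cm : curve_model iota m x z y.
Local Notation affine := (affine iota x z y).
Local Notation nfF := (nfv m iota x z y).

Let commx : commr_rmorph iota x := fun a => mulrC x (iota a).
Let px : {rmorphism {poly K} -> F} := horner_morph commx.

Let pxE p : px p = (map_poly iota p).[x]. Proof. by []. Qed.

Lemma cm_m_gt0 : (0 < m)%N.
Proof. by rewrite lt0n; apply: contraNneq (cm_m cm) => ->. Qed.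

Lemma px_inj : injective px.
Proof.
move=> p q /eqP; rewrite -subr_eq0 -rmorphB => h; apply/eqP; rewrite -subr_eq0.
by apply: contraTT h => /(cm_transc cm).
Qed.

Lemma cm_zm : z ^+ m = - (x ^+ m + 1).
Proof. by apply/eqP; rewrite -addr_eq0 addrA [z ^+ m + _]addrC (cm_fermat cm). Qed.

Lemma cm_neq0 : [/\ x != 0, z != 0 & y != 0].
Proof.
have x0 : x != 0.
  by have := cm_transc cm (negbT (polyX_eq0 K)); rewrite map_polyX hornerX.
have z0 : z != 0.
  apply/eqP => e; have := cm_fermat cm; rewrite e expr0n gtn_eqF ?cm_m_gt0 // addr0.
  have /(cm_transc cm) : 'X^m + 1%:P != 0 :> {poly K} by rewrite -size_poly_gt0 size_XnaddC ?cm_m_gt0.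
  by rewrite polyC1 rmorphD rmorph1 /= map_polyXn !hornerE => /eqP.
split=> //; apply/eqP => e; have /eqP := cm_y cm.
by rewrite e expr0n eq_sym mulf_eq0 (negPf x0) (negPf z0).
Qed.

Lemma affine_px p : affine (px p). Proof. exact/affine_poly/affine_x. Qed.

Lemma affine_integral f : affine f -> integralOver px f.
Proof.
have ix : integralOver px x.
  by have := integral_id px 'X; rewrite pxE map_polyX hornerX.
have iz : integralOver px z.
  pose p : {poly F} := 'X^m + (x ^+ m + 1)%:P.
  apply: (integral_root_monic (p := p)).
  - by rewrite monicE lead_coefDl ?lead_coefXn // size_polyXn ltnS
      (leq_trans (size_polyC_leq1 _)) // cm_m_gt0.
  - rewrite rootE /p hornerD hornerXn hornerC -(cm_fermat cm); apply/eqP; ring.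
  - apply/integral_poly => i; rewrite coefD coefXn coefC.
    apply: integral_add; first exact: integral_nat.
    case: ifP => _; last exact: integral0.
    apply: integral_add; last exact: integral1.
    by have := integral_id px 'X^m; rewrite pxE map_polyXn hornerXn.
have iy : integralOver px y.
  pose p : {poly F} := 'X^3 - (x * z)%:P.
  apply: (integral_root_monic (p := p)).
  - by rewrite monicE lead_coefDl ?lead_coefXn // size_polyXn size_polyN
      (leq_ltn_trans (size_polyC_leq1 _)).
  - by rewrite rootE /p hornerD hornerN hornerXn hornerC (cm_y cm) subrr.
  - apply/integral_poly => i; rewrite coefB coefXn coefC.
    apply: integral_sub; first exact: integral_nat.
    by case: ifP => _; [apply: integral_mul|exact: integral0].
move=> [d [e _ ->]]; elim: e => //= [c|e1 h1 e2 h2|e1 h1 e2 h2].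
- by have := integral_id px c%:P; rewrite pxE map_polyC hornerC.
- exact: integral_add.
- exact: integral_mul.
Qed.

(** Multiplying the integral equation of [g], of degree [n], by [(x - c) ^+ n] gives an identity
    between polynomials in [x]; at [c] only the leading term [H ^+ n] is left. *)
Lemma integral_root c g H :
  integralOver px g -> (x - iota c) * g = px H -> H.[c] = 0.
Proof.
move=> [p mon_p pg0] e.
have [n sp] : exists n, size p = n.+1.
  by exists (size p).-1; rewrite prednK // size_poly_gt0 monic_neq0.
pose t : {poly K} := 'X - c%:P.
have pt : px t = x - iota c by rewrite pxE rmorphB /= map_polyX map_polyC !hornerE.
pose Q := \sum_(k < n.+1) p`_k * t ^+ (n - k) * H ^+ k.
have Q0 : Q = 0.
  apply: px_inj; rewrite rmorph0 rmorph_sum.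
  move/rootP: pg0; rewrite horner_coef (size_map_poly_id0) ?sp; last first.
    by rewrite (monicP mon_p) rmorph1 oner_neq0.
  move/(congr1 ( *%R (px t ^+ n))); rewrite mulr0 mulr_sumr => h; apply: (etrans _ h).
  apply: eq_bigr => k _.
  have -> : px t ^+ n = px t ^+ (n - k) * px t ^+ k by rewrite -exprD subnK // -ltnS.
  rewrite 2!rmorphM 2!rmorphXn coef_map -e -pt exprMn; ring.
have := congr1 (horner^~ c) Q0; rewrite /= horner0 horner_sum big_ord_recr big1 /=.
  rewrite subnn expr0 mulr1 hornerM horner_exp -[n in p`_n]/(n.+1.-1) -sp -lead_coefE.
  by rewrite (monicP mon_p) hornerC mul1r add0r => /eqP; rewrite expf_eq0 => /andP[_ /eqP].
move=> k _; rewrite !hornerM horner_exp !hornerE subrr expr0n subn_eq0 leqNgt ltn_ord.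
by rewrite mulr0 mul0r.
Qed.

(** In an integral equation of [f] whose constant term is nonzero, that term is a multiple of [f]. A
    zero constant term is removed by cancelling [f]. *)
Lemma affine_divides f : affine f -> f != 0 ->
  exists g p, [/\ affine g, p != 0 & f * g = (map_poly iota p).[x]].
Proof.
move=> af f0; have [p mon_p] := affine_integral af.
have := monic_neq0 mon_p; elim/poly_ind: p {mon_p} => [|p c IH]; first by rewrite eqxx.
have [->|c0 _] := eqVneq c 0.
  rewrite polyC0 addr0 mulf_eq0 polyX_eq0 orbF => p0.
  rewrite rootE rmorphM /= map_polyX hornerMX mulf_eq0 (negPf f0) orbF => h.
  exact: IH.
rewrite rootE rmorphD rmorphM /= map_polyX map_polyC hornerMXaddC => h.
exists (- (map_poly px p).[f]), c; split=> //.
  apply: affineN; rewrite horner_coef; apply: affine_sum => k _.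
  rewrite coef_map_id0 ?rmorph0 //; apply: affineM; last exact: affineX.
  exact: affine_px.
by apply/eqP; rewrite mulrN mulrC -subr_eq0 -opprD oppr_eq0.
Qed.

Lemma affine_root c g H : affine g ->
  (x - iota c) * g = (map_poly iota H).[x] -> H.[c] = 0.
Proof. by move/affine_integral => ig; apply: integral_root. Qed.
End Model.

Ltac affine_closed := repeat first
  [ assumption | exact: affine_x | exact: affine_z | exact: affine_y | exact: affine1
  | exact: affine_const | apply: affineM | apply: affineX | apply: affineN | apply: affineD
  | apply: affine_poly ].

(** * Uniqueness of normal forms *)

Section Independence.
Variables (K : closedFieldType) (F : fieldType) (iota : {rmorphism K -> F}).
Variables (m : nat) (x z y : F).
Hypothesis cm : curve_model iota m x z y.
Local Notation affine := (affine iota x z y).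
Local Notation nfF := (nfv m iota x z y).
Local Notation px p := (map_poly iota p).[x].

(* Eisenstein at a root [c] of [X^m + 1], where [z ^+ b * y ^+ w] has order
   [3 * b + w] and [x - c] has order [3 * m]: let [(b0, w0)] be the first index
   whose coefficient does not vanish at [c]; multiplying the relation by [M]
   sends every other term into [z ^+ m], hence [z] divides [y ^+ 2] times a
   polynomial prime to [x - c]. *)
Lemma nf0_root c s : c ^+ m = -1 -> nfF s = 0 ->
  forall w b, (w < 3)%N -> (b < m)%N -> (s w b).[c] = 0.
Proof.
move=> cE s0; have m0 := cm_m_gt0 cm.
have [x0 z0 y0] := cm_neq0 cm.
have [U UE] : exists U, 'X^m + 1 = U * ('X - c%:P).
  by apply/factor_theorem; rewrite rootE !hornerE cE addNr.
(* [c] is a simple root of ['X^m + 1] because [m] is invertible in [K]. *)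
have U0 : U.[c] != 0.
  have := congr1 (horner^~ c \o deriv) UE; rewrite /= !derivE !hornerE subrr mulr0 add0r.
  move=> e; rewrite -e hornerMn hornerXn -mulr_natl mulf_neq0 ?(cm_m cm) // expf_eq0; apply/nandP; right.
  apply: contraTneq (oner_neq0 K) => c0.
  by rewrite c0 expr0n gtn_eqF // in cE; rewrite -[1]opprK -cE oppr0 eqxx.
have zU : z ^+ m = - px U * (x - iota c).
  have := congr1 (fun p => px p) UE; rewrite rmorphM !rmorphB rmorphD rmorph1 /=.
  rewrite map_polyXn map_polyX map_polyC !hornerE /= => e.
  by rewrite mulNr -e; apply/eqP; rewrite -addr_eq0 addrA [z ^+ m + _]addrC (cm_fermat cm).
pose I f := exists2 g, affine g & f = z ^+ m * g.
have I0 : I 0 by exists 0; [exact: affine0|rewrite mulr0].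
have ID f g : I f -> I g -> I (f + g).
  by move=> [f1 h1 ->] [g1 h2 ->]; exists (f1 + g1); [apply: affineD|rewrite mulrDr].
suff H : forall n w b, (3 * b + w < n)%N -> (w < 3)%N -> (b < m)%N -> (s w b).[c] = 0.
  by move=> w b; apply: H (leqnn _).
elim=> // n IH w0 b0 lt0 lw0 lb0.
pose M := z ^+ (m.-1 - b0) * y ^+ (2 - w0).
have term (w b : nat) : (w < 3)%N -> (b < m)%N -> (w, b) != (w0, b0) ->
    I (px U * (px (s w b) * z ^+ b * y ^+ w) * M).
  move=> lw lb ne.
  have [lt|ge] := ltnP (3 * b + w) (3 * b0 + w0).
    (* Smaller index: the coefficient is divisible by [x - c], and [U] completes this factor to
       [- z ^+ m]. *)
    have [t tE] : exists t, s w b = t * ('X - c%:P).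
      by apply/factor_theorem/rootP/IH => //; move: lt lt0; lia.
    exists (- px t * z ^+ b * y ^+ w * M); first by rewrite /M; affine_closed.
    rewrite tE zU rmorphM rmorphB /= map_polyX map_polyC !hornerE /=; ring.
  have [e|ne2] := eqVneq b b0.
    (* Same [b], larger [w]: [y ^+ 3 = x * z] supplies the missing factor [z]. *)
    have lw2 : (w0 < w)%N.
      move: ge ne; rewrite e xpair_eqE eqxx andbT leq_add2l => le1 ne1.
      by rewrite ltn_neqAle eq_sym ne1.
    exists (px U * px (s w b) * y ^+ (w - w0.+1) * x); first by affine_closed.
    have -> : px U * (px (s w b) * z ^+ b * y ^+ w) * M =
              px U * px (s w b) * (z ^+ b * z ^+ (m.-1 - b0)) * (y ^+ w * y ^+ (2 - w0)).
      by rewrite /M; ring.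
    rewrite -!exprD e subnKC; last by move: lb0; lia.
    have -> : (w + (2 - w0) = 3 + (w - w0.+1))%N by move: lw lw2; lia.
    rewrite exprD (cm_y cm) -(prednK m0) exprS /=; ring.
  (* Larger [b]: the powers of [z] reach [m] by themselves. *)
  exists (px U * px (s w b) * z ^+ (b - b0.+1) * (y ^+ w * y ^+ (2 - w0)));
    first by affine_closed.
  have -> : px U * (px (s w b) * z ^+ b * y ^+ w) * M =
            px U * px (s w b) * (z ^+ b * z ^+ (m.-1 - b0)) * (y ^+ w * y ^+ (2 - w0)).
    by rewrite /M; ring.
  rewrite -(exprD z).
  have -> : (b + (m.-1 - b0) = m + (b - b0.+1))%N by move: ge ne2 lb0 lw lw0; lia.
  by rewrite exprD; ring.
have main : I (px U * (px (s w0 b0) * z ^+ b0 * y ^+ w0) * M).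
  have e : \sum_(p : 'I_3 * 'I_m) px U * (px (s p.1 p.2) * z ^+ p.2 * y ^+ p.1) * M = 0.
    rewrite -mulr_suml -mulr_sumr.
    have -> : \sum_(p : 'I_3 * 'I_m) px (s p.1 p.2) * z ^+ p.2 * y ^+ p.1 = nfF s.
      rewrite -(pair_bigA _ (fun (w : 'I_3) (b : 'I_m) => px (s w b) * z ^+ b * y ^+ w)) /=.
      by apply: eq_bigr => w _; rewrite mulr_suml.
    by rewrite s0 mulr0 mul0r.
  rewrite (bigD1 (Ordinal lw0, Ordinal lb0)) //= in e.
  move/eqP: e; rewrite addr_eq0 => /eqP ->.
  have IN f : I f -> I (- f) by move=> [g hg ->]; exists (- g); [exact: affineN|rewrite mulrN].
  by apply: IN; elim/big_ind: _ => // -[w b] /= ne; apply: term.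
case: main => g ag e1.
have e2 : px U * px (s w0 b0) * y ^+ 2 = z * g.
  apply: (mulfI (expf_neq0 m.-1 z0)).
  rewrite [RHS]mulrA -exprSr (prednK m0) -e1 /M.
  have -> : z ^+ m.-1 = z ^+ b0 * z ^+ (m.-1 - b0) by rewrite -exprD subnKC //; move: lb0; lia.
  have -> : y ^+ 2 = y ^+ w0 * y ^+ (2 - w0) by rewrite -exprD subnKC.
  ring.
(* Cubing removes [y]; an [m]-th power then turns [z] into a multiple of [x - c], so that
   [affine_root] applies. *)
pose W := px U * px (s w0 b0).
have e3 : W ^+ 3 * x ^+ 2 = z * g ^+ 3.
  apply: (mulfI (expf_neq0 2 z0)).
  have -> : z ^+ 2 * (z * g ^+ 3) = (z * g) ^+ 3 by ring.
  rewrite -e2 -/W [in RHS]exprMn.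
  have -> : (y ^+ 2) ^+ 3 = (y ^+ 3) ^+ 2 by rewrite -!exprM.
  rewrite (cm_y cm); ring.
have e4 : (W ^+ 3 * x ^+ 2) ^+ m = (x - iota c) * (- px U * (g ^+ 3) ^+ m).
  by rewrite e3 exprMn zU; ring.
have ag4 : affine (- px U * (g ^+ 3) ^+ m).
  by affine_closed.
have e5 : (W ^+ 3 * x ^+ 2) ^+ m = px (((U * s w0 b0) ^+ 3 * 'X^2) ^+ m).
  by rewrite !(rmorphXn, rmorphM) /= map_polyX !(hornerE, horner_exp).
have /eqP := affine_root cm ag4 (etrans (esym e4) e5).
rewrite !(hornerE, horner_exp).
rewrite !(expf_eq0, mulf_eq0) (negPf U0) m0 -orbA orbb /= => /orP[/eqP //|/eqP c0].
by move: cE; rewrite c0 expr0n gtn_eqF // => /esym/eqP; rewrite oppr_eq0 oner_eq0.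
Qed.

(** Descent on sizes: every coefficient vanishes at a root [c] of ['X^m + 1], so ['X - c%:P] can be
    cancelled from the whole relation. *)
Lemma nf_inj0 s : nfF s = 0 -> forall w b, (w < 3)%N -> (b < m)%N -> s w b = 0.
Proof.
have m0 := cm_m_gt0 cm.
have [c cE] : exists c : K, c ^+ m = -1.
  have [c] := @solve_monicpoly K m (fun i => if i == 0%N then -1 else 0) m0.
  rewrite (bigD1 (Ordinal m0)) //= big1 => [|i /negPf ne]; last first.
    by rewrite -val_eqE /= in ne; rewrite ne mul0r.
  by rewrite addr0 expr0 mulr1; exists c.
suff H n (s' : nat -> nat -> {poly K}) : (forall w b, (w < 3)%N -> (b < m)%N -> (size (s' w b) <= n)%N) ->
    nfF s' = 0 -> forall w b, (w < 3)%N -> (b < m)%N -> s' w b = 0.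
  apply: (H (\sum_(w < 3) \sum_(b < m) size (s w b))%N) => w b lw lb.
  rewrite (bigD1 (Ordinal lw)) //= (bigD1 (Ordinal lb)) //= -addnA; exact: leq_addr.
elim: n s' => [|n IH] s' hs e w b lw lb.
  by apply/eqP; rewrite -size_poly_eq0 -leqn0 hs.
pose t w b : {poly K} := s' w b %/ ('X - c%:P).
have tE w' b' : (w' < 3)%N -> (b' < m)%N -> s' w' b' = ('X - c%:P) * t w' b'.
  move=> lw' lb'; rewrite /t mulrC divpK // dvdp_XsubCl; apply/rootP.
  exact: nf0_root cE e _ _ lw' lb'.
rewrite tE // (IH t) ?mulr0 // => [w' b' lw' lb'|].
  by rewrite size_divp ?polyXsubC_eq0 // size_XsubC /= leq_subLR add1n hs.
have : nfF (fun w b => ('X - c%:P) * t w b) = 0.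
  rewrite -[RHS]e; apply: eq_bigr => w' _; congr (_ * _).
  by apply: eq_zrow => b' lb'; rewrite -tE.
rewrite nfvZ => /eqP; rewrite mulf_eq0 (negPf (cm_transc cm _)) ?polyXsubC_eq0 //.
by move/eqP.
Qed.

Lemma nf_inj s1 s2 : nfF s1 = nfF s2 ->
  forall w b, (w < 3)%N -> (b < m)%N -> s1 w b = s2 w b.
Proof.
move=> e w b lw lb; apply/eqP; rewrite -subr_eq0; apply/eqP.
have e0 : nfF (fun w b => s1 w b + (-1)%:P * s2 w b) = 0.
  by rewrite nfvD nfvZ e map_polyC hornerC /= rmorphN1 mulN1r subrr.
by rewrite -(nf_inj0 e0 lw lb) polyCN polyC1 mulN1r.
Qed.

Lemma affine_nf d f : dform iota x z y d f -> exists2 s, sz d s & f = nfF s.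
Proof.
move=> [e he ->]; have [s hs vs] := normal_form (cm_m_gt0 cm) e.
exists s; first exact: sz_le hs.
exact: (vs F iota x z y (cm_fermat cm) (cm_y cm)).
Qed.
End Independence.

(** * Places centered at a point *)

Section LocalRing.
Variables (K F : fieldType) (iota : {rmorphism K -> F}).
Variables (val : F -> K -> Prop) (t : F).
Hypothesis val_const : forall c, val (iota c) c.
Hypothesis valD : forall f g k l, val f k -> val g l -> val (f + g) (k + l).
Hypothesis valM : forall f g k l, val f k -> val g l -> val (f * g) (k * l).
Hypothesis val_fun : forall f k l, val f k -> val f l -> k = l.
Hypothesis t_neq0 : t != 0.
Hypothesis val_t : val t 0.
Hypothesis chart : forall f, val f 0 ->
  exists u k g l, [/\ val u k, k != 0, val g l & u * f = t * g].
Hypothesis bound : forall f k, val f k -> f != 0 ->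
  exists N, forall n u ku g kg, val u ku -> ku != 0 -> val g kg ->
    u * f = t ^+ n * g -> (n <= N)%N.
Hypothesis frac : forall f, exists g h kg kh,
  [/\ val g kg, val h kh, h != 0 & f = g / h].

Definition local_unit u := exists2 k, k != 0 & val u k.

Lemma local_unit_neq0 u : local_unit u -> u != 0.
Proof.
move=> [k k0 vk]; apply: contraNneq k0 => e; apply/eqP/(val_fun vk).
by rewrite e -(rmorph0 iota); apply: val_const.
Qed.

Lemma local_unitM u w : local_unit u -> local_unit w -> local_unit (u * w).
Proof.
by move=> [k k0 hk] [l l0 hl]; exists (k * l); [rewrite mulf_neq0|apply: valM].
Qed.

Lemma local_unit1 : local_unit 1.
Proof. by exists 1; [exact: oner_neq0|rewrite -(rmorph1 iota); apply: val_const]. Qed.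

Lemma val_exp f k n : val f k -> val (f ^+ n) (k ^+ n).
Proof.
move=> h; elim: n => [|n IH]; first by rewrite !expr0 -(rmorph1 iota); apply: val_const.
by rewrite !exprS; apply: valM.
Qed.

(** [chart] says that locally [t] generates the maximal ideal, [bound] that no nonzero function is
    infinitely divisible by [t]; together they give every nonzero function an order. *)
Definition has_order f (n : int) := exists u w,
  [/\ local_unit u, local_unit w & u * f = t ^ n * w].

Lemma has_order_val f k : val f k -> f != 0 -> exists n : nat, has_order f n.
Proof.
move=> vf f0; have [N hN] := bound vf f0.
have H j : (exists n : nat, has_order f n) \/
    exists u g kg, [/\ local_unit u, val g kg & u * f = t ^+ j * g].
  elim: j => [|j [IH|[u [g [kg [hu hg e]]]]]]; [right|by left|].
    by exists 1, f, k; split; [exact: local_unit1|by []|rewrite expr0].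
  have [kg0|kg0] := eqVneq kg 0.
    rewrite kg0 in hg; have [u' [k' [g' [l [hu' k'0 hg' e']]]]] := chart hg.
    right; exists (u' * u), g', l; split=> //.
      by apply: local_unitM => //; exists k'.
    by rewrite -mulrA e mulrCA e' exprSr mulrA.
  by left; exists j, u, g; split=> //; exists kg.
case: (H N.+1) => // -[u [g [kg [[ku ku0 hu] hg e]]]].
by have := hN _ _ _ _ _ hu ku0 hg e; rewrite ltnn.
Qed.

Lemma has_order_ex f : f != 0 -> exists n, has_order f n.
Proof.
have [g [h [kg [kh [hg hh h0 ->]]]]] := frac f; rewrite mulf_eq0 negb_or => /andP[g0 _].
have [n [u [w [hu hw e]]]] := has_order_val hg g0.
have [n' [u' [w' [hu' hw' e']]]] := has_order_val hh h0.
exists (n%:Z - n'%:Z), (u * w'), (w * u'); split; try exact: local_unitM.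
rewrite expfzDr // -exprnP -exprnN.
have -> : u * w' * (g / h) = (u * g) * (w' / h) by ring.
rewrite e -exprnP.
suff -> : w' / h = u' / t ^+ n' by ring.
apply/eqP; rewrite eqr_div ?expf_neq0 //; apply/eqP.
by rewrite e' -exprnP mulrC.
Qed.

Lemma has_order_uniq f n n' : f != 0 -> has_order f n -> has_order f n' -> n = n'.
Proof.
move=> f0; wlog le : n n' / n <= n' => [H h1 h2|].
  by case/orP: (le_total n n') => le; [apply: H|apply/esym/H].
move=> [u [w [hu [kw kw0 hw] e]]] [u' [w' [[ku' ku'0 hu'] [kw' _ hw'] e']]].
have [k kE] : exists k : nat, n' = n + k by exists `|n' - n|%N; lia.
rewrite kE in e' *; case: k {kE} => [|k] in e' *; first by rewrite addr0.
have e2 : u' * w = u * (t ^+ k.+1 * w').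
  apply: (mulfI (expfz_neq0 n t_neq0)).
  move: e'; rewrite expfzDr // -exprnP => e'.
  have -> : t ^ n * (u' * w) = u' * (t ^ n * w) by ring.
  by rewrite -e mulrCA e'; ring.
case: hu => ku _ hu.
have v1 := valM hu' hw; have v2 := valM hu (valM (val_exp k.+1 val_t) hw').
rewrite -e2 in v2; have := val_fun v1 v2.
by rewrite expr0n /= mul0r mulr0 => /eqP; rewrite mulf_eq0 (negPf ku'0) (negPf kw0).
Qed.

Lemma has_orderM f g n k : has_order f n -> has_order g k -> has_order (f * g) (n + k).
Proof.
move=> [u [w [hu hw e]]] [u' [w' [hu' hw' e']]].
exists (u * u'), (w * w'); split; try exact: local_unitM.
by rewrite mulrACA e e' expfzDr // mulrACA.
Qed.

Lemma has_orderD f g n k : has_order f n -> has_order g k -> n <= k -> f + g != 0 ->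
  exists2 l, n <= l & has_order (f + g) l.
Proof.
move=> [u [w [hu hw e]]] [u' [w' [hu' hw' e']]] le fg0.
have [j kE] : exists j : nat, k = n + j by exists `|k - n|%N; lia.
pose h := w * u' + t ^+ j * (w' * u).
have hE : u * u' * (f + g) = t ^ n * h.
  have -> : u * u' * (f + g) = u' * (u * f) + u * (u' * g) by ring.
  by rewrite e e' kE expfzDr // -exprnP /h; ring.
have [kh vh] : exists kh, val h kh.
  case: hw hu' hw' hu => [? _ hw] [? _ hu'] [? _ hw'] [? _ hu].
  eexists; apply: valD; [exact: valM hw hu'|apply: valM (valM hw' hu)].
  exact: val_exp val_t.
have uu0 : u * u' != 0 by rewrite mulf_neq0 ?local_unit_neq0.
have h0 : h != 0.
  apply: contraTneq (mulf_neq0 uu0 fg0) => e0; by rewrite hE e0 mulr0 eqxx.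
have [l [u2 [w2 [hu2 hw2 e2]]]] := has_order_val vh h0.
exists (n + l); first by lia.
exists (u2 * (u * u')), w2; split=> //; first by do 2?apply: local_unitM.
by rewrite -mulrA hE mulrCA e2 expfzDr // mulrA.
Qed.

(** Orders are only known to exist, hence the choice operator; the value at [0] is arbitrary. *)
Definition local_order f : int := epsilon (inhabits 0) (has_order f).

Lemma local_orderP f : f != 0 -> has_order f (local_order f).
Proof. by move=> f0; apply: epsilon_spec; apply: has_order_ex. Qed.

Lemma local_orderE f n : f != 0 -> has_order f n -> local_order f = n.
Proof. by move=> f0 h; apply: has_order_uniq (local_orderP f0) h. Qed.

Lemma has_order_t : has_order t 1.
Proof.
by exists 1, 1; split; [exact: local_unit1|exact: local_unit1|rewrite mulrC].
Qed.

Lemma has_order_unit u : local_unit u -> has_order u 0.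
Proof.
move=> hu; exists 1, u; split=> //; first exact: local_unit1.
Qed.

Lemma local_order_place : is_place iota local_order.
Proof.
split.
- move=> a b a0 b0; apply: local_orderE; first by rewrite mulf_neq0.
  by apply: has_orderM; apply: local_orderP.
- move=> a b a0 b0 ab0.
  have := local_orderP a0; have := local_orderP b0.
  move: (local_order a) (local_order b) => n k hk hn.
  case/orP: (le_total n k) => le.
    by left; have [l nl /local_orderE ->] := has_orderD hn hk le ab0.
  right; rewrite addrC in ab0 *.
  by have [l nl /local_orderE ->] := has_orderD hk hn le ab0.
- move=> c c0; apply: local_orderE; first by rewrite fmorph_eq0.
  by apply: has_order_unit; exists c.
- by exists t; split=> //; apply: local_orderE => //; apply: has_order_t.
Qed.

Lemma local_order_t : local_order t = 1.
Proof. by apply: local_orderE => //; apply: has_order_t. Qed.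

Lemma local_order_val f k : val f k -> vge local_order 0 f.
Proof.
move=> hf; have [->|f0] := eqVneq f 0; [by left|right].
by have [n /local_orderE ->] := has_order_val hf f0.
Qed.

Lemma local_order_val0 f : val f 0 -> vge local_order 1 f.
Proof.
move=> hf; have [->|f0] := eqVneq f 0; [by left|right].
have [u [k [g [l [hu k0 hg e]]]]] := chart hf.
have u_unit : local_unit u by exists k.
have u0 := local_unit_neq0 u_unit.
have pv := local_order_place.
have : vge local_order 1 (u * f).
  rewrite e -[1]addr0; apply: (vgeM pv); last exact: local_order_val hg.
  by right; rewrite local_order_t.
move/(vgeP (mulf_neq0 u0 f0)); rewrite (placeM pv) //.
by rewrite (local_orderE u0 (has_order_unit u_unit)) add0r.
Qed.

Lemma local_order_regular f : vge local_order 0 f ->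
  exists u ku g kg, [/\ val u ku, ku != 0, val g kg & u * f = g].
Proof.
have [->|f0] := eqVneq f 0.
  move=> _; exists 1, 1, 0, 0; rewrite mulr0 oner_eq0; split=> //.
    by rewrite -(rmorph1 iota).
  by rewrite -(rmorph0 iota).
move/(vgeP f0); have [u [w [[ku ku0 hu] [kw _ hw] e]]] := local_orderP f0.
case: (local_order f) e => n //; rewrite -exprnP => e _.
by exists u, ku, (t ^+ n * w), (0 ^+ n * kw); split=> //; apply: valM => //; apply: val_exp.
Qed.

(** A place positive on the maximal ideal is zero on local units, so it is [v t] times the order;
    being normalized, it has [v t = 1]. *)
Lemma local_order_unique v : is_place iota v ->
  (forall f, val f 0 -> vge v 1 f) -> same_place v local_order.
Proof.
move=> pv h.
have vu u : local_unit u -> v u = 0.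
  move=> [k k0 hk]; apply: (place_unit pv k0 _).2.
  by apply: h; rewrite -(subrr k) -rmorphN; apply: valD.
have vt := vgeP t_neq0 (h _ val_t).
have vE f n : f != 0 -> has_order f n -> v f = n * v t.
  move=> f0 [u [w [hu hw e]]]; have u0 := local_unit_neq0 hu.
  have := congr1 v e; rewrite !(placeM pv) ?expfz_neq0 ?(local_unit_neq0 hw) //.
  by rewrite (vu _ hu) (vu _ hw) add0r addr0 (placeXz pv).
have vt1 : v t = 1.
  case: pv => _ _ _ [f0 [f00 vf0]]; have := vE _ _ f00 (local_orderP f00).
  rewrite vf0; move: (local_order f0) (v t) vt => a b b1 ab.
  have a01 : a <= 0 \/ 1 <= a by lia.
  case: a01 => a01; nia.
by move=> f f0; rewrite (vE _ _ f0 (local_orderP f0)) vt1 mulr1.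
Qed.

Lemma local_order_residual : residual iota local_order.
Proof.
move=> f g f0 g0 e.
have [u [w [hu hw ef]]] := local_orderP f0.
have [u' [w' [hu' hw' eg]]] := local_orderP g0.
rewrite e in ef; move: (local_order g) ef eg => n ef eg.
have [uu ww] := (local_unitM hu hu', local_unitM hu hw').
case: (hu) (hu') (hw) (hw') => [ku ku0 vu] [ku' ku'0 vu'] [kw kw0 vw] [kw' kw'0 vw'].
(* The ratio of the values of the units [w / u] and [w' / u'] that multiply [t ^ n] in [f] and in
   [g]. *)
pose c := kw * ku' / (ku * kw'); exists c.
have pv := local_order_place.
have uu0 := local_unit_neq0 uu.
have vuu : local_order (u * u') = 0 by apply: local_orderE uu0 (has_order_unit uu).
apply: (vgeMr_unit pv uu0 vuu).
have -> : (f - iota c * g) * (u * u') = t ^ n * (w * u' - iota c * (u * w')).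
  have -> : (f - iota c * g) * (u * u') = u' * (u * f) - iota c * u * (u' * g) by ring.
  by rewrite ef eg; ring.
apply: (vgeM pv); first by right; rewrite (placeXz pv) // local_order_t mulr1.
apply: local_order_val0.
have -> : 0 = kw * ku' + - c * (ku * kw').
  by rewrite /c mulNr divfK ?subrr // mulf_neq0.
apply: valD; first exact: valM.
by rewrite -mulNr -rmorphN; apply: valM => //; apply: valM.
Qed.
End LocalRing.

(** * Places over the points of the curve *)

Section Points.
Variables (K : closedFieldType) (F : fieldType) (iota : {rmorphism K -> F}).
Variables (m : nat) (x z y : F).
Hypothesis cm : curve_model iota m x z y.
Local Notation affine := (affine iota x z y).
Local Notation nfF := (nfv m iota x z y).
Local Notation px p := (map_poly iota p).[x].

Definition on_curve (c z0 y0 : K) : Prop := c ^+ m + z0 ^+ m + 1 = 0 /\ y0 ^+ 3 = c * z0.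

Definition value_at (c z0 y0 : K) (f : F) (k : K) : Prop :=
  exists2 e : expr K, f = ev iota x z y e & k = ev idfun c z0 y0 e.

Definition center (v : F -> int) (c z0 y0 : K) : Prop :=
  [/\ is_place iota v, vge v 1 (x - iota c), vge v 1 (z - iota z0) & vge v 1 (y - iota y0)].

Section AtPoint.
Variables (c z0 y0 : K).
Hypothesis onC : on_curve c z0 y0.
Local Notation val := (value_at c z0 y0).

Lemma value_const k : val (iota k) k. Proof. by exists (Ec k). Qed.
Lemma value_x : val x c. Proof. by exists Ex. Qed.
Lemma value_z : val z z0. Proof. by exists Ez. Qed.
Lemma value_y : val y y0. Proof. by exists Ey. Qed.

Lemma valueD f g k l : val f k -> val g l -> val (f + g) (k + l).
Proof. by move=> [e -> ->] [e' -> ->]; exists (Eadd e e'). Qed.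

Lemma valueM f g k l : val f k -> val g l -> val (f * g) (k * l).
Proof. by move=> [e -> ->] [e' -> ->]; exists (Emul e e'). Qed.

Lemma valueN f k : val f k -> val (- f) (- k).
Proof. by move/(valueM (value_const (-1))); rewrite rmorphN1 !mulN1r. Qed.

Lemma valueB f g k l : val f k -> val g l -> val (f - g) (k - l).
Proof. by move=> hf /valueN; apply: valueD. Qed.

Lemma value1 : val 1 1. Proof. by have := value_const 1; rewrite rmorph1. Qed.
Lemma value0 : val 0 0. Proof. by have := value_const 0; rewrite rmorph0. Qed.

Lemma valueX f k n : val f k -> val (f ^+ n) (k ^+ n).
Proof.
move=> h; elim: n => [|n IH]; first exact: value1.
by rewrite !exprS; apply: valueM.
Qed.

Lemma value_poly p f k : val f k -> val (map_poly iota p).[f] p.[k].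
Proof.
move=> h; elim/poly_ind: p => [|p d IH]; first by rewrite rmorph0 !horner0; apply: value0.
rewrite rmorphD rmorphM /= map_polyX map_polyC !hornerMXaddC.
by apply: valueD; [apply: valueM|apply: value_const].
Qed.

Lemma value_affine f : affine f -> exists k, val f k.
Proof. by move=> [d [e _ ->]]; exists (ev idfun c z0 y0 e), e. Qed.

Lemma affine_value f k : val f k -> affine f.
Proof. by move=> [e -> _]; exists (edeg e), e. Qed.

(** Two expressions of one function have the same normal form by [nf_inj], and an expression agrees
    with its normal form at the point as well. *)
Lemma value_fun f k l : val f k -> val f l -> k = l.
Proof.
move=> [e -> ->] [e' ee ->].
have [XZ YXZ] := onC.
have [s _ hs] := normal_form (cm_m_gt0 cm) e.
have [s' _ hs'] := normal_form (cm_m_gt0 cm) e'.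
rewrite (hs _ idfun _ _ _ XZ YXZ) (hs' _ idfun _ _ _ XZ YXZ).
move: ee; rewrite (hs _ iota _ _ _ (cm_fermat cm) (cm_y cm)) (hs' _ iota _ _ _ (cm_fermat cm) (cm_y cm)).
move/(nf_inj cm) => h; apply: eq_bigr => w _; congr (_ * _).
by apply: eq_zrow => b lb; rewrite h.
Qed.

Lemma center_value v f k : center v c z0 y0 -> val f k -> vge v 1 (f - iota k).
Proof.
move=> [pv hx hz hy] [e -> ->] {f k}.
suff H e' : vge v 1 (ev iota x z y e' - iota (ev idfun c z0 y0 e')) /\ vge v 0 (ev iota x z y e').
  by case: (H e).
have B f k : vge v 1 (f - iota k) -> vge v 1 (f - iota k) /\ vge v 0 f.
  move=> h; split=> //; rewrite -(subrK (iota k) f); apply: (vgeD pv); last exact: vge_const.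
  exact: vge_le h.
elim: e' => [k||||e1 [h1 g1] e2 [h2 g2]|e1 [h1 g1] e2 [h2 g2]] /=; apply: B => //.
- by rewrite subrr; left.
- by rewrite rmorphD opprD addrACA; apply: (vgeD pv).
- set f1 := ev iota _ _ _ e1 in h1 g1 *; set f2 := ev iota _ _ _ e2 in h2 g2 *.
  have -> : f1 * f2 - iota (ev idfun c z0 y0 e1 * ev idfun c z0 y0 e2) =
    (f1 - iota (ev idfun c z0 y0 e1)) * f2 +
    iota (ev idfun c z0 y0 e1) * (f2 - iota (ev idfun c z0 y0 e2)).
    by rewrite rmorphM; ring.
  apply: (vgeD pv); first exact: (vgeMr pv).
  by apply: (vgeMl pv) => //; apply: vge_const.
Qed.

Section Chart.
Variables (t : F) (n0 : nat) (u0 w0 : F) (ku0 kw0 : K).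
Let divides f := exists u k g l, [/\ val u k, k != 0, val g l & u * f = t * g].
Hypothesis val_t : val t 0.
Hypothesis t0 : t != 0.
Hypotheses (dx : divides (x - iota c)) (dz : divides (z - iota z0)) (dy : divides (y - iota y0)).
Hypotheses (hu0 : val u0 ku0) (hw0 : val w0 kw0) (kw00 : kw0 != 0).
Hypothesis xt : u0 * (x - iota c) = t ^+ n0 * w0.

(** An expression minus its value is a combination of [x - c], [z - z0] and [y - y0], so it is
    enough that [t] divides these three. *)
Lemma chart_divides f : val f 0 -> divides f.
Proof.
have DD f1 f2 : divides f1 -> divides f2 -> divides (f1 + f2).
  move=> [u [k [g [l [hu k0 hg e]]]]] [u' [k' [g' [l' [hu' k'0 hg' e']]]]].
  exists (u * u'), (k * k'), (u' * g + u * g'), (k' * l + k * l'); split.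
  - exact: valueM.
  - by rewrite mulf_neq0.
  - by apply: valueD; apply: valueM.
  - have -> : u * u' * (f1 + f2) = u' * (u * f1) + u * (u' * f2) by ring.
    by rewrite e e'; ring.
have DM f1 f2 k2 : divides f1 -> val f2 k2 -> divides (f1 * f2).
  move=> [u [k [g [l [hu k0 hg e]]]]] h2; exists u, k, (g * f2), (l * k2).
  by split=> //; [exact: valueM|rewrite mulrA e mulrA].
case=> e -> e0; rewrite -[ev _ _ _ _ e]subr0 -(rmorph0 iota) e0 => {e0 f}.
elim: e => [k||||e1 h1 e2 h2|e1 h1 e2 h2] //=.
- exists 1, 1, 0, 0; split; [exact: value1|exact: oner_neq0|exact: value0|].
  by rewrite subrr mulr0 mulr0.
- by rewrite rmorphD opprD addrACA; apply: DD.
- set f1 := ev iota _ _ _ e1 in h1 *; set f2 := ev iota _ _ _ e2 in h2 *.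
  have -> : f1 * f2 - iota (ev idfun c z0 y0 e1 * ev idfun c z0 y0 e2) =
     (f1 - iota (ev idfun c z0 y0 e1)) * f2 +
     (f2 - iota (ev idfun c z0 y0 e2)) * iota (ev idfun c z0 y0 e1).
    by rewrite rmorphM; ring.
  by apply: DD; apply: DM; [exact: h1|exists e2|exact: h2|exact: value_const].
Qed.

(** [f] divides a polynomial in [x]. If [c] is a root of it of multiplicity [N], then, [x - c] being
    of order [n0] in [t], no power of [t] beyond [n0 * N] can divide [f]. *)
Lemma chart_bound f k : val f k -> f != 0 ->
  exists N, forall n u ku g kg, val u ku -> ku != 0 -> val g kg ->
    u * f = t ^+ n * g -> (n <= N)%N.
Proof.
move=> vf f0; have [g' [p [ag' p0 e]]] := affine_divides cm (affine_value vf) f0.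
have [kg' vg'] := value_affine ag'.
have [N [q qc pE]] := multiplicity_XsubC p c; rewrite p0 /= in qc.
exists (n0 * N)%N => n u ku g kg hu ku_0 hg e1; rewrite leqNgt; apply/negP => lt.
have pxE : px p = px q * (x - iota c) ^+ N.
  by rewrite pE rmorphM rmorphXn rmorphB /= map_polyX map_polyC hornerM horner_exp !hornerE.
have e2 : t ^+ (n - n0 * N) * (g * g' * u0 ^+ N) = u * w0 ^+ N * px q.
  apply: (mulfI (expf_neq0 (n0 * N) t0)); rewrite [LHS]mulrA -exprD subnKC ?(ltnW lt) //.
  have -> : t ^+ n * (g * g' * u0 ^+ N) = (t ^+ n * g) * (g' * u0 ^+ N) by ring.
  rewrite -e1 -mulrA [f * _]mulrA e pxE.
  have -> : u * (px q * (x - iota c) ^+ N * u0 ^+ N) = u * px q * (u0 * (x - iota c)) ^+ N.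
    by rewrite exprMn; ring.
  by rewrite xt exprMn exprM; ring.
have v1 := valueM (valueX (n - n0 * N) val_t) (valueM (valueM hg vg') (valueX N hu0)).
have v2 := valueM (valueM hu (valueX N hw0)) (value_poly q value_x).
rewrite e2 in v1; have /eqP := value_fun v1 v2.
rewrite expr0n subn_eq0 leqNgt lt mul0r eq_sym !(mulf_eq0, expf_eq0) (negPf ku_0) (negPf kw00).
by rewrite andbF /= -rootE (negPf qc).
Qed.

Lemma chart_place : exists v, [/\ center v c z0 y0, residual iota v,
   forall f, vge v 0 f -> exists u ku g, [/\ val u ku, ku != 0, affine g & u * f = g],
   v t = 1 & forall v', center v' c z0 y0 -> same_place v' v].
Proof.
have frac f : exists g h kg kh, [/\ val g kg, val h kh, h != 0 & f = g / h].
  have [g [h [ag ah h0 e]]] := cm_frac cm f.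
  by have [[k hk] [l hl]] := (value_affine ag, value_affine ah); exists g, h, k, l.
exists (local_order val t).
have pv := local_order_place value_const valueD valueM value_fun t0 val_t chart_divides chart_bound frac.
have v0 := local_order_val0 value_const valueD valueM value_fun t0 val_t chart_divides chart_bound frac.
have vB f k : val f k -> val (f - iota k) 0.
  by move=> h; rewrite -(subrr k); apply: valueB => //; apply: value_const.
split.
- by split=> //; apply/v0/vB; [exact: value_x|exact: value_z|exact: value_y].
- exact: (local_order_residual value_const valueD valueM value_fun t0 val_t chart_divides chart_bound frac).
- move=> f /(local_order_regular value_const valueM t0 val_t chart_divides chart_bound frac).
  case=> u [ku [g [kg [hu hk hg e]]]].
  by exists u, ku, g; split=> //; apply: affine_value hg.
- exact: (local_order_t value_const valueM value_fun t0 val_t chart_divides chart_bound frac).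
- move=> v' cv'; have [pv' _ _ _] := cv'.
  apply: (local_order_unique value_const valueD valueM value_fun t0 val_t chart_divides chart_bound frac) => //.
  by move=> f /(center_value cv'); rewrite rmorph0 subr0.
Qed.
End Chart.

(** The cofactor is a divided difference, so its value at the point is the derivative of the power.
    Where this is nonzero the cofactor is a local unit, which is how smoothness is expressed. *)
Lemma power_diff f k n : val f k ->
  exists2 g, val g (n%:R * k ^+ n.-1) & f ^+ n - iota k ^+ n = (f - iota k) * g.
Proof.
move=> h; exists (\sum_(i < n) f ^+ (n.-1 - i) * iota k ^+ i); last by rewrite subrXX.
have -> : n%:R * k ^+ n.-1 = \sum_(i < n) k ^+ (n.-1 - i) * k ^+ i.
  rewrite -[n in n%:R]card_ord -sumr_const mulr_suml; apply: eq_bigr => i _.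
  by rewrite mul1r -exprD subnK //; have := ltn_ord i; case: n i => // n' i; rewrite ltnS.
have H (r : seq 'I_n) : val (\sum_(i <- r) f ^+ (n.-1 - i) * iota k ^+ i)
                            (\sum_(i <- r) k ^+ (n.-1 - i) * k ^+ i).
  elim: r => [|i r IH]; first by rewrite !big_nil; apply: value0.
  rewrite !big_cons; apply: valueD => //; apply: valueM; apply: valueX => //.
  exact: value_const.
exact: H.
Qed.

(** If [y0 != 0], then [c] and [z0] are nonzero too and [x - c] is a uniformizer. If [y0 = 0], the
    uniformizer is [y]: either [c = 0] and [x] has order 3, or [z0 = 0] and [z] has order 3, which
    gives [x - c] order [3 * m]. *)
Lemma point_place : exists v, [/\ center v c z0 y0, residual iota v,
   forall f, vge v 0 f -> exists u ku g, [/\ val u ku, ku != 0, affine g & u * f = g],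
   y0 != 0 -> v (x - iota c) = 1 & forall v', center v' c z0 y0 -> same_place v' v].
Proof.
have [XZ YXZ] := onC; have m0 := cm_m_gt0 cm.
have [x0 zF0 yF0] := cm_neq0 cm.
have [Sx vSx ex] := power_diff m value_x.
have [Sz vSz ez] := power_diff m value_z.
have eSz : Sz * (z - iota z0) = - ((x - iota c) * Sx).
  rewrite mulrC -ez -ex -!rmorphXn.
  have -> : z0 ^+ m = - (c ^+ m + 1).
    by apply/eqP; rewrite -addr_eq0 addrA [z0 ^+ m + _]addrC XZ.
  rewrite (cm_zm cm).
  by rewrite rmorphN rmorphD rmorph1; ring.
have Sne (k : K) : k != 0 -> m%:R * k ^+ m.-1 != 0.
  by move=> k0; rewrite mulf_neq0 ?expf_neq0 // (cm_m cm).
have val_sub f k : val f k -> val (f - iota k) 0.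
  by move=> h; rewrite -(subrr k); apply: valueB => //; apply: value_const.
have v1 := value1; have n1 := oner_neq0 K.
have [y00|y00] := eqVneq y0 0; last first.
  have [c0 z00] : c != 0 /\ z0 != 0.
    by apply/andP; rewrite -negb_or -mulf_eq0 -YXZ expf_eq0.
  have [Sy vSy ey] := power_diff 3 value_y.
  pose dv f := exists u k g l, [/\ val u k, k != 0, val g l & u * f = (x - iota c) * g].
  have xc0 : x - iota c != 0.
    have /(cm_transc cm) := negbT (polyXsubC_eq0 c).
    by rewrite rmorphB /= map_polyX map_polyC !hornerE.
  have dx : dv (x - iota c) by exists 1, 1, 1, 1; rewrite mul1r mulr1.
  have dz : dv (z - iota z0).
    exists Sz, (m%:R * z0 ^+ m.-1), (- Sx), (- (m%:R * c ^+ m.-1)).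
    by split=> //; [exact: Sne|exact: valueN|rewrite eSz mulrN].
  have dy : dv (y - iota y0).
    exists (Sz * Sy), (m%:R * z0 ^+ m.-1 * (3%:R * y0 ^+ 2)), (Sz * z - iota c * Sx),
      (m%:R * z0 ^+ m.-1 * z0 - c * (m%:R * c ^+ m.-1)); split.
    + exact: valueM.
    + by rewrite mulf_neq0 ?Sne // mulf_neq0 ?(cm_3 cm) // expf_neq0.
    + apply: valueB; apply: valueM => //; [exact: value_z|exact: value_const].
    + have -> : Sz * Sy * (y - iota y0) = Sz * ((y - iota y0) * Sy) by ring.
      rewrite -ey (cm_y cm) -rmorphXn YXZ rmorphM.
      have -> : Sz * (x * z - iota c * iota z0) =
        (x - iota c) * (Sz * z) + iota c * (Sz * (z - iota z0)) by ring.
      by rewrite eSz; ring.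
  have xt : 1 * (x - iota c) = (x - iota c) ^+ 1 * 1 by rewrite mul1r mulr1.
  have [v [h1 h2 h3 h4 h5]] := chart_place (val_sub _ _ value_x) xc0 dx dz dy v1 v1 n1 xt.
  by exists v; split.
have dy : exists u k g l, [/\ val u k, k != 0, val g l & u * (y - iota y0) = y * g].
  by exists 1, 1, 1, 1; split=> //; rewrite y00 rmorph0 subr0 mul1r mulr1.
have vy : val y 0 by have := value_y; rewrite {2}y00.
have v2 : val (y ^+ 2) (0 ^+ 2) by apply: valueX.
have xz : x * z = y * y ^+ 2 by rewrite -(cm_y cm) exprS.
have : (c == 0) || (z0 == 0) by rewrite -mulf_eq0 -YXZ y00 expr0n.
case/orP => /eqP e0.
- have z00 : z0 != 0.
    apply/eqP => e1; move: XZ; rewrite e0 e1 !expr0n gtn_eqF //= !add0r => /eqP.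
    by rewrite oner_eq0.
  have dx : exists u k g l, [/\ val u k, k != 0, val g l & u * (x - iota c) = y * g].
    exists z, z0, (y ^+ 2), (0 ^+ 2); split=> //; first exact: value_z.
    by rewrite e0 rmorph0 subr0 mulrC.
  have dz : exists u k g l, [/\ val u k, k != 0, val g l & u * (z - iota z0) = y * g].
    exists (z * Sz), (z0 * (m%:R * z0 ^+ m.-1)), (- (y ^+ 2 * Sx)), (- (0 ^+ 2 * (m%:R * c ^+ m.-1))).
    split; [by apply: valueM => //; apply: value_z|by rewrite mulf_neq0 ?Sne| |].
      by apply: valueN; apply: valueM.
    by rewrite -mulrA eSz e0 rmorph0 subr0 mulrN mulrA [z * x]mulrC xz; ring.
  have xt : z * (x - iota c) = y ^+ 3 * 1 by rewrite (cm_y cm) e0 rmorph0 subr0 mulr1 mulrC.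
  have [v [h1 h2 h3 h4 h5]] := chart_place vy yF0 dx dz dy value_z v1 n1 xt.
  by exists v; split=> //; rewrite y00 eqxx.
- have c0 : c != 0.
    apply/eqP => e1; move: XZ; rewrite e0 e1 !expr0n gtn_eqF //= !add0r => /eqP.
    by rewrite oner_eq0.
  have dz : exists u k g l, [/\ val u k, k != 0, val g l & u * (z - iota z0) = y * g].
    exists x, c, (y ^+ 2), (0 ^+ 2); split=> //; first exact: value_x.
    by rewrite e0 rmorph0 subr0.
  have dx : exists u k g l, [/\ val u k, k != 0, val g l & u * (x - iota c) = y * g].
    exists (x * Sx), (c * (m%:R * c ^+ m.-1)), (- (y ^+ 2 * Sz)), (- (0 ^+ 2 * (m%:R * z0 ^+ m.-1))).
    split; [by apply: valueM => //; apply: value_x|by rewrite mulf_neq0 ?Sne| |].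
      by apply: valueN; apply: valueM.
    have -> : x * Sx * (x - iota c) = x * ((x - iota c) * Sx) by ring.
    have -> : (x - iota c) * Sx = - (Sz * (z - iota z0)) by rewrite eSz opprK.
    have -> : y * - (y ^+ 2 * Sz) = - (y * y ^+ 2) * Sz by ring.
    by rewrite -xz e0 rmorph0; ring.
  have xt : x ^+ m * Sx * (x - iota c) = y ^+ (3 * m) * - 1.
    rewrite exprM (cm_y cm) mulrN1 exprMn -mulrA -mulrN; congr (_ * _).
    rewrite mulrC; apply: oppr_inj; rewrite -eSz opprK e0 rmorph0 subr0 mulrC.
    by move: ez; rewrite e0 rmorph0 expr0n gtn_eqF // !subr0.
  have hu : val (x ^+ m * Sx) (c ^+ m * (m%:R * c ^+ m.-1)).
    by apply: valueM => //; apply/valueX/value_x.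
  have n2 : -1 != 0 :> K by rewrite oppr_eq0.
  have [v [h1 h2 h3 h4 h5]] := chart_place vy yF0 dx dz dy hu (valueN v1) n2 xt.
  by exists v; split=> //; rewrite y00 eqxx.
Qed.
End AtPoint.
End Points.

Lemma monic_split (K : closedFieldType) (p : {poly K}) : p \is monic ->
  exists2 L, p = \prod_(r <- L) ('X - r%:P) & forall r, r \in L -> p.[r] = 0.
Proof.
move=> mp; have [L pE] := closed_field_poly_normal p.
move: pE; rewrite (monicP mp) scale1r => pE; exists L => // r rL.
by apply/rootP; rewrite pE root_prod_XsubC.
Qed.

Lemma map_prod_XsubC_eval (K F : fieldType) (iota : {rmorphism K -> F}) (L : seq K) (f : F) :
  (map_poly iota (\prod_(r <- L) ('X - r%:P))).[f] = \prod_(r <- L) (f - iota r).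
Proof.
rewrite rmorph_prod horner_prod; apply: eq_bigr => r _.
by rewrite rmorphB /= map_polyX map_polyC !hornerE.
Qed.

Lemma power_split (K : closedFieldType) (F : fieldType) (iota : {rmorphism K -> F}) n (k : K) (f : F) :
  (0 < n)%N ->
  exists2 L : seq K, f ^+ n - iota k = \prod_(r <- L) (f - iota r) & forall r, r \in L -> r ^+ n = k.
Proof.
move=> n0; have mp : 'X^n - k%:P \is monic by apply: monicXnsubC.
have [L pE hL] := monic_split mp; exists L.
  rewrite -map_prod_XsubC_eval -pE rmorphB /= map_polyXn map_polyC hornerD hornerN.
  by rewrite hornerXn hornerC.
by move=> r /hL; rewrite hornerD hornerN hornerXn hornerC => /eqP; rewrite subr_eq0 => /eqP.
Qed.

(** * Functions regular on the affine part *)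

Section Regular.
Variables (K : closedFieldType) (F : fieldType) (iota : {rmorphism K -> F}).
Variables (m : nat) (x z y : F).
Hypothesis cm : curve_model iota m x z y.
Local Notation affine := (affine iota x z y).
Local Notation px p := (map_poly iota p).[x].
Local Notation on_curve := (on_curve m).
Local Notation center := (center iota x z y).
Local Notation val := (value_at iota x z y).

Lemma center_same v v' c z0 y0 :
  on_curve c z0 y0 -> center v c z0 y0 -> center v' c z0 y0 -> same_place v v'.
Proof.
move=> hQ hv hv'; have [w [_ _ _ _ h]] := point_place cm hQ.
by move=> f f0; rewrite (h _ hv) // (h _ hv').
Qed.

Lemma center_x_ge0 v c z0 y0 : center v c z0 y0 -> 0 <= v x.
Proof.
move=> [pv hx _ _]; have [x0 _ _] := cm_neq0 cm; apply: (vgeP x0).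
rewrite -(subrK (iota c) x); apply: (vgeD pv); last exact: vge_const.
exact: vge_le hx.
Qed.

Section FinitePlace.
Variable v : F -> int.
Hypothesis pv : is_place iota v.
Hypothesis vx : 0 <= v x.

Lemma finite_place_ge0 : [/\ vge v 0 x, vge v 0 z & vge v 0 y].
Proof.
have [x0 z0 y0] := cm_neq0 cm; have m0 := cm_m_gt0 cm.
have hx : vge v 0 x by right.
have hz : vge v 0 z.
  right; have : vge v 0 (z ^+ m).
    rewrite (cm_zm cm).
    by apply: (vgeN pv); apply: (vgeD pv); [apply: (vge0X pv)|apply: (vge1 pv)].
  move/(vgeP (expf_neq0 m z0)); rewrite (placeX pv) // -mulr_natl natz pmulr_rge0 //.
split=> //; right; have : vge v 0 (y ^+ 3) by rewrite (cm_y cm); apply: (vgeMl pv).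
by move/(vgeP (expf_neq0 3 y0)); rewrite (placeX pv) // -mulr_natl natz; lia.
Qed.

Lemma affine_regular f : affine f -> vge v 0 f.
Proof.
have [hx hz hy] := finite_place_ge0.
move=> [d [e _ ->]]; elim: e => //= [c|e1 h1 e2 h2|e1 h1 e2 h2].
- exact: vge_const.
- exact: (vgeD pv).
- exact: (vgeMl pv).
Qed.

(** The numerator of a function of positive order divides a polynomial in [x], and a linear factor
    of the latter with positive order gives [c]. The two equations of the curve then yield [z0] and
    [y0] in the same way. *)
Lemma place_center : exists c z0 y0, on_curve c z0 y0 /\ center v c z0 y0.
Proof.
have [hx hz hy] := finite_place_ge0; have m0 := cm_m_gt0 cm.
have [c hc] : exists c, vge v 1 (x - iota c).
  case: (pv) => _ _ _ [t [t0 vt]].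
  have [g [h [ag ah h0 e]]] := cm_frac cm t.
  have g0 : g != 0 by apply: contraNneq t0 => g0; rewrite e g0 mul0r.
  have vg : vge v 1 g.
    right; have := affine_regular ah => /(vgeP h0).
    have : v g = v t + v h by rewrite -(placeM pv) // e divfK.
    by rewrite vt => ->; lia.
  have [g' [p [ag' p0 e2]]] := affine_divides cm ag g0.
  have [L pE] := closed_field_poly_normal p.
  have := vgeMr pv vg (affine_regular ag'); rewrite e2 pE map_polyZ hornerZ.
  rewrite mulrC map_prod_XsubC_eval => /(vgeMr_unit pv).
  have lp : lead_coef p != 0 by rewrite lead_coef_eq0.
  rewrite fmorph_eq0 => /(_ lp (place_const pv lp)) /(vge_prod1 pv hx)[c _ hc].
  by exists c.
have [L zL hL] := power_split iota (- (c ^+ m + 1)) z m0.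
have [z0 z0L vz0] : exists2 z0, z0 \in L & vge v 1 (z - iota z0).
  apply: (vge_prod1 pv hz); rewrite -zL.
  have -> : z ^+ m - iota (- (c ^+ m + 1)) = - ((x - iota c) * \sum_(j < m) x ^+ (m.-1 - j) * iota c ^+ j).
    rewrite -subrXX rmorphN rmorphD rmorphXn rmorph1.
    rewrite (cm_zm cm).
    ring.
  apply: (vgeN pv); apply: (vgeMr pv) => //; apply: (vge_sum pv) => j _.
  by apply: (vgeMl pv); apply: (vge0X pv) => //; apply: vge_const.
have [L' yL hL'] := power_split iota (c * z0) y (isT : 0 < 3)%N.
have [y0 y0L vy0] : exists2 y0, y0 \in L' & vge v 1 (y - iota y0).
  apply: (vge_prod1 pv hy); rewrite -yL (cm_y cm) rmorphM.
  have -> : x * z - iota c * iota z0 = (x - iota c) * z + iota c * (z - iota z0) by ring.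
  by apply: (vgeD pv); [apply: (vgeMr pv)|apply: (vgeMl pv) => //; apply: vge_const].
exists c, z0, y0; split; last by split.
by split; [rewrite (hL _ z0L) opprD addrA subrr add0r addNr|apply: hL'].
Qed.
End FinitePlace.

(** Linear factors are cancelled one at a time; [w'] stands for the product of those still
    present. *)
Lemma ideal_peel (J : F -> Prop) (L : seq K) g w :
  affine g -> affine w -> J (w * \prod_(r <- L) (g - iota r)) ->
  (forall w' r, r \in L -> affine w' -> J (w * w' * (g - iota r)) -> J (w * w')) -> J w.
Proof.
move=> ag aw; elim: L => [|r L IH]; first by rewrite big_nil mulr1.
rewrite big_cons => h hJ; apply: IH => [|w' s sL]; last by apply: hJ; rewrite inE sL orbT.
apply: (hJ _ r); rewrite ?mem_head //; last by rewrite -mulrA [_ * (g - _)]mulrC.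
elim: (L) => [|s L' IH]; first by rewrite big_nil; apply: affine1.
by rewrite big_cons; affine_closed.
Qed.

(* [J] below is the ideal of denominators of [f]: it contains a polynomial in
   [x], and by regularity it has no zero on the curve, so peeling off the linear
   factors [x - c], [z - z0], [y - y0] one by one shows [1 \in J]. *)
Theorem affine_of_regular f :
  (forall v, is_place iota v -> 0 <= v x -> vge v 0 f) -> affine f.
Proof.
move=> reg; have m0 := cm_m_gt0 cm.
pose J u := affine u /\ affine (u * f).
have JM u w : J u -> affine w -> J (u * w).
  by move=> [h1 h2] h; split; [|rewrite mulrAC]; apply: affineM.
have JD u w : J u -> J w -> J (u + w).
  by move=> [h1 h2] [h3 h4]; split; [|rewrite mulrDl]; apply: affineD.
have JN u : J u -> J (- u) by rewrite -mulrN1 => h; apply: JM => //; apply: affineN; apply: affine1.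
(* Regularity at the point gives a denominator [u] with nonzero value [ku]. As [w * (u - ku)] lies
   in [J], so does [w * ku], hence [w]. *)
have point c z0 y0 w : on_curve c z0 y0 -> affine w ->
    J (w * (x - iota c)) -> J (w * (z - iota z0)) -> J (w * (y - iota y0)) -> J w.
  move=> hQ aw Jx Jz Jy.
  have [v [cv _ regv _ _]] := point_place cm hQ.
  have [pv _ _ _] := cv.
  have [u [ku [g [[e uE kE] ku0 ag e1]]]] := regv _ (reg _ pv (center_x_ge0 cv)).
  have Ju : J u by split; [exists (edeg e), e|rewrite e1].
  have H e' : J (w * (ev iota x z y e' - iota (ev idfun c z0 y0 e'))).
    elim: e' => [k||||e1' h1 e2' h2|e1' h1 e2' h2] //=.
    - by rewrite subrr mulr0; split; rewrite ?mul0r; apply: affine0.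
    - by rewrite rmorphD opprD addrACA mulrDr; apply: JD.
    - have a2 : affine (ev iota x z y e2') by exists (edeg e2'), e2'.
      set f1 := ev iota _ _ _ e1' in h1 *; set f2 := ev iota _ _ _ e2' in h2 a2 *.
      have -> : w * (f1 * f2 - iota (ev idfun c z0 y0 e1' * ev idfun c z0 y0 e2')) =
        w * (f1 - iota (ev idfun c z0 y0 e1')) * f2 +
        w * (f2 - iota (ev idfun c z0 y0 e2')) * iota (ev idfun c z0 y0 e1').
        by rewrite rmorphM; ring.
      by apply: JD; apply: JM => //; apply: affine_const.
  have := H e; rewrite -uE -kE => h.
  have : J (w * iota ku).
    have -> : w * iota ku = u * w - w * (u - iota ku) by ring.
    by apply: JD; [apply: JM|apply: JN].
  move/JM => /(_ (iota ku^-1) (affine_const _ _ _ _ _)).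
  by rewrite -mulrA -rmorphM divff // rmorph1 mulr1.
have level_y c z0 w : c ^+ m + z0 ^+ m + 1 = 0 -> affine w ->
    J (w * (x - iota c)) -> J (w * (z - iota z0)) -> J w.
  move=> hQ aw Jx Jz.
  have [L yL hL] := power_split iota (c * z0) y (isT : 0 < 3)%N.
  apply: (ideal_peel (g := y) (L := L)) => //; first exact: affine_y.
    rewrite -yL (cm_y cm) rmorphM.
    have -> : w * (x * z - iota c * iota z0) =
      w * (x - iota c) * z + w * (z - iota z0) * iota c by ring.
    by apply: JD; apply: JM => //; [apply: affine_z|apply: affine_const].
  move=> w' r rL aw' h; apply: (point c z0 r) => //; last by rewrite mulrAC; apply: JM.
  - by split=> //; apply: hL.
  - exact: affineM.
  - by rewrite mulrAC; apply: JM.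
have level_z c w : affine w -> J (w * (x - iota c)) -> J w.
  move=> aw Jx.
  have [L zL hL] := power_split iota (- (c ^+ m + 1)) z m0.
  apply: (ideal_peel (g := z) (L := L)) => //; first exact: affine_z.
    rewrite -zL.
    have -> : w * (z ^+ m - iota (- (c ^+ m + 1))) =
        w * (x - iota c) * - \sum_(j < m) x ^+ (m.-1 - j) * iota c ^+ j.
      rewrite -mulrA mulrN -subrXX rmorphN rmorphD rmorphXn rmorph1.
      rewrite (cm_zm cm).
      ring.
    apply: JM => //; apply: affineN; apply: affine_sum => j _; affine_closed.
  move=> w' r rL aw' h; apply: (level_y c r) => //; last by rewrite mulrAC; apply: JM.
  - by rewrite (hL _ rL) opprD addrA subrr add0r addNr.
  - exact: affineM.
have [g [h [ag ah h0 fE]]] := cm_frac cm f.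
have [h' [p [ah' p0 e]]] := affine_divides cm ah h0.
have Jp : J (px p).
  split; first by affine_closed.
  rewrite -e fE; have -> : h * h' * (g / h) = h' * g by field.
  by affine_closed.
have [L pE] := closed_field_poly_normal p.
suff [_] : J 1 by rewrite mul1r.
apply: (ideal_peel (g := x) (L := L)); [exact: affine_x|exact: affine1| |].
  move: Jp; rewrite pE map_polyZ hornerZ map_prod_XsubC_eval.
  move/JM => /(_ (iota (lead_coef p)^-1) (affine_const _ _ _ _ _)).
  by rewrite mulrAC -rmorphM divff ?lead_coef_eq0 // rmorph1.
by move=> w' r _ aw'; apply: level_z; apply: affineM => //; apply: affine1.
Qed.
End Regular.

(** * Forms of bounded degree *)

Section Infinity.
Variables (K : closedFieldType) (F : fieldType) (iota : {rmorphism K -> F}).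
Variables (m : nat) (x z y : F).
Hypothesis cm : curve_model iota m x z y.
Local Notation form := (dform iota x z y).
Local Notation affine' := (affine iota x^-1 (z / x) (y / x)).

Definition rev_poly n (p : {poly K}) : {poly K} := \poly_(i < n.+1) p`_(n - i).

Lemma rev_polyE n (p : {poly K}) : (size p <= n.+1)%N ->
  (map_poly iota (rev_poly n p)).[x] = x ^+ n * (map_poly iota p).[x^-1].
Proof.
move=> sp; have [x0 _ _] := cm_neq0 cm.
rewrite (horner_coef_wide _ (n := n.+1)); last by rewrite size_map_poly size_poly.
rewrite [in RHS](horner_coef_wide _ (n := n.+1)) ?size_map_poly // mulr_sumr.
rewrite (reindex_inj rev_ord_inj); apply: eq_bigr => i _ /=.
rewrite !coef_map coef_poly subSS ltnS leq_subr subKn; last by rewrite -ltnS.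
rewrite mulrCA exprVn; congr (_ * _).
have -> : x ^+ n = x ^+ (n - i) * x ^+ i by rewrite -exprD subnK // -ltnS.
by rewrite mulfK // expf_neq0.
Qed.

Lemma affine_infinity d f : form d f -> affine' (f / x ^+ d).
Proof.
have [x0 _ _] := cm_neq0 cm.
have aX n : affine' (x^-1 ^+ n) by apply: affineX; apply: affine_x.
suff H (e : expr K) : affine' (ev iota x z y e / x ^+ edeg e).
  move=> [e he ->]; rewrite -(subnK he) exprD invfM mulrA mulrAC.
  by apply: affineM => //; rewrite -exprVn.
elim: e => [c||||e1 h1 e2 h2|e1 h1 e2 h2] /=.
- by rewrite expr0 invr1 mulr1; apply: affine_const.
- by rewrite expr1 divff //; apply: affine1.
- by rewrite expr1; apply: affine_z.
- by rewrite expr1; apply: affine_y.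
- rewrite mulrDl; apply: affineD.
    rewrite -(subnK (leq_maxl (edeg e1) (edeg e2))) exprD invfM mulrA mulrAC.
    by apply: affineM => //; rewrite -exprVn.
  rewrite -(subnK (leq_maxr (edeg e1) (edeg e2))) exprD invfM mulrA mulrAC.
  by apply: affineM => //; rewrite -exprVn.
- by rewrite exprD invfM mulrACA; apply: affineM.
Qed.

Lemma infinity_model : curve_model iota m x^-1 (z / x) (y / x).
Proof.
have [x0 z0 y0] := cm_neq0 cm.
split; [exact: cm_m cm|exact: cm_3 cm| | | |].
- move=> P P0; have [n sP] : exists n, size P = n.+1.
    by exists (size P).-1; rewrite prednK // size_poly_gt0.
  have sP' : (size P <= n.+1)%N by rewrite sP.
  have := rev_polyE sP'; apply: contra_eq_neq => ->; rewrite mulr0.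
  apply: (cm_transc cm); apply/eqP => /(congr1 (fun p : {poly K} => p`_0)).
  rewrite coef_poly coef0 subn0 /= => /eqP; rewrite -[n]/(n.+1.-1) -sP.
  by rewrite -/(lead_coef P) lead_coef_eq0 (negPf P0).
- apply: (mulfI (expf_neq0 m x0)); rewrite mulr0 -(cm_fermat cm) !exprMn !exprVn.
  by rewrite !mulrDr divff ?expf_neq0 // mulr1 mulrCA divff ?expf_neq0 // mulr1; ring.
- by rewrite exprMn (cm_y cm); field.
- move=> f; have [g [h [[d ag] [d' ah] h0 fE]]] := cm_frac cm f.
  exists (g / x ^+ (maxn d d')), (h / x ^+ (maxn d d')); split.
  + by apply: affine_infinity; apply: dform_le ag; apply: leq_maxl.
  + by apply: affine_infinity; apply: dform_le ah; apply: leq_maxr.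
  + by rewrite mulf_neq0 // invr_neq0 // expf_neq0.
  + by rewrite fE invfM invrK mulrACA mulVf ?mulr1 // expf_neq0.
Qed.

(* [x^-1, z / x, y / x] satisfy the same equations as [x, z, y], so regularity
   at infinity is regularity in the finite part of that second model. *)
Theorem form_of_bounds k f :
  (forall v, is_place iota v -> 0 <= v x -> vge v 0 f) ->
  (forall v, is_place iota v -> v x < 0 -> vge v (k%:Z * v x) f) -> form k f.
Proof.
move=> hfin hinf; have [x0 z0 y0] := cm_neq0 cm.
have [d af] := affine_of_regular cm hfin.
have [d' af'] : affine' (f / x ^+ k).
  apply: (affine_of_regular infinity_model) => v pv; rewrite (placeV pv) // => vx.
  have vxk : v (x ^+ k) = k%:Z * v x by rewrite (placeX pv) // -mulr_natl natz.
  have [f0|f0] := eqVneq f 0; first by left; rewrite f0 mul0r.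
  have xk0 : x ^+ k != 0 by apply: expf_neq0.
  right; rewrite (placeM pv) ?invr_neq0 // (placeV pv) // vxk.
  have [lt|ge] := ltP (v x) 0; first by have := vgeP f0 (hinf v pv lt); lia.
  have -> : v x = 0 by lia.
  by have := vgeP f0 (hfin v pv ge); rewrite mulr0 subr0.
have [s hs fE] := affine_nf cm af.
have [t ht fE'] := affine_nf infinity_model af'.
have ts w b : (size (t w b) <= d'.+1)%N.
  have [->|t0] := eqVneq (t w b) 0; first by rewrite size_poly0.
  by have := ht w b t0; lia.
rewrite fE; apply: dform_nfv => w b lw lb s0.
(* [p] and [r] are two normal forms of [x ^+ (d' + m + 3) * f], one from each model. The power of
   ['X] in [p] absorbs the denominators of [(z / x) ^+ b * (y / x) ^+ w]; comparing sizes bounds the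
   degree of [s w b]. *)
pose p w b := 'X^(k + m + 3 - b - w) * rev_poly d' (t w b).
pose r w b := 'X^(d' + m + 3) * s w b.
have e : nfv m iota x z y r = nfv m iota x z y p.
  rewrite nfvZ map_polyXn hornerXn -fE.
  have -> : f = x ^+ k * nfv m iota x^-1 (z / x) (y / x) t.
    by rewrite -fE' mulrCA divff ?mulr1 // expf_neq0.
  rewrite mulrA -exprD mulr_sumr; apply: eq_bigr => w' _.
  rewrite /zrow mulr_suml mulr_sumr mulr_suml; apply: eq_bigr => b' _.
  rewrite /p rmorphM /= map_polyXn hornerM hornerXn rev_polyE //.
  have -> : (d' + m + 3 + k = (k + m + 3 - b' - w') + d' + b' + w')%N.
    by have := ltn_ord b'; have := ltn_ord w'; lia.
  rewrite !exprD !exprMn !exprVn; field.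
  by rewrite !expf_neq0.
have := congr1 (fun q : {poly K} => size q) (nf_inj cm e lw lb).
have rp0 : rev_poly d' (t w b) != 0.
  apply: contraNneq s0 => e0; have := nf_inj cm e lw lb; rewrite /r /p e0 mulr0 => /eqP.
  by rewrite mulf_eq0 (negPf (monic_neq0 (monicXn _ _))).
have X0 n : 'X^n != 0 :> {poly K} by apply/monic_neq0/monicXn.
rewrite /r /p !size_mul // !size_polyXn !addSn /= => e1.
have := size_poly d'.+1 (fun i => (t w b)`_(d' - i)); rewrite -/(rev_poly _ _).
by move: e1 lw lb; move: (size _) (size _) => n1 n2; lia.
Qed.
End Infinity.

(** * Counting monomials by degree *)

Section Dimension.
Variables (K : closedFieldType) (F : fieldType) (iota : {rmorphism K -> F}).
Variables (m : nat) (x z y : F).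
Hypothesis cm : curve_model iota m x z y.
Local Notation form := (dform iota x z y).

Definition monom (t : nat * nat * nat) : F := x ^+ t.2 * z ^+ t.1.2 * y ^+ t.1.1.

Definition exponents k : seq (nat * nat * nat) :=
  [seq (p, i) | p <- [seq (w, b) | w <- seq.iota 0 3, b <- seq.iota 0 m], i <- seq.iota 0 (k.+1 - (p.1 + p.2))%N].

Lemma exponents_uniq k : uniq (exponents k).
Proof.
apply: allpairs_uniq_dep => [|p _|]; last 2 first.
- exact: iota_uniq.
- by move=> [p i] [p' i'] _ _ /= [-> ->].
by apply: allpairs_uniq => [||[? ?] [? ?] _ _ /= [-> ->]]; rewrite ?iota_uniq.
Qed.

Lemma mem_exponents k t : t \in exponents k ->
  [/\ (t.1.1 < 3)%N, (t.1.2 < m)%N & (t.2 + t.1.2 + t.1.1 <= k)%N].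
Proof.
case/allpairsPdep => [p [i [/allpairsPdep[w [b [hw hb ->]]] hi ->]]] /=.
by move: hw hb hi; rewrite !mem_iota /= => hw hb hi; split; lia.
Qed.

Lemma form_monom k t : t \in exponents k -> form k (monom t).
Proof.
case/mem_exponents => _ _ le; apply: (dform_le (d := (1 * t.2 + 1 * t.1.2 + 1 * t.1.1)%N)).
  by rewrite !mul1n.
by apply: dformM; [apply: dformM|]; apply: dformX; [apply: dform_x|apply: dform_z|apply: dform_y].
Qed.

Lemma monom_nf t : (t.1.1 < 3)%N -> (t.1.2 < m)%N ->
  monom t = nfv m iota x z y (fun w b => if (w, b) == t.1 then 'X^(t.2) else 0).
Proof.
move: t => [[w b] i] /= lw lb; rewrite /nfv (bigD1 (Ordinal lw)) //= [X in _ + X]big1; last first.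
  move=> w' /negPf ne; rewrite /zrow big1 ?mul0r // => b' _.
  rewrite -val_eqE /= in ne; rewrite xpair_eqE ne /=.
  by rewrite rmorph0 horner0 mul0r.
rewrite addr0 /zrow (bigD1 (Ordinal lb)) //= [X in _ + X]big1; last first.
  move=> b' /negPf ne; rewrite -val_eqE /= in ne; rewrite xpair_eqE ne andbF.
  by rewrite rmorph0 horner0 mul0r.
by rewrite eqxx addr0 map_polyXn hornerXn.
Qed.

Lemma monom_span L f : {in L, forall t, (t.1.1 < 3)%N && (t.1.2 < m)%N} ->
  lspan iota (map monom L) f -> exists2 s, f = nfv m iota x z y s &
    forall w b i, (w, b, i) \notin L -> (s w b)`_i = 0.
Proof.
move=> hL; apply: (lspan_closed (W := fun f => exists2 s, f = nfv m iota x z y s &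
    forall w b i, (w, b, i) \notin L -> (s w b)`_i = 0)).
- exists (fun _ _ => 0) => [|w b i _]; last by rewrite coef0.
  apply/esym/big1 => w _; rewrite /zrow big1 ?mul0r // => b _.
  by rewrite rmorph0 horner0 mul0r.
- move=> f1 f2 [s1 -> h1] [s2 -> h2]; exists (fun w b => s1 w b + s2 w b); first by rewrite nfvD.
  by move=> w b i ni; rewrite coefD h1 // h2 // addr0.
- move=> c f1 [s1 -> h1]; exists (fun w b => c%:P * s1 w b).
    by rewrite nfvZ map_polyC hornerC.
  by move=> w b i ni; rewrite coefCM h1 // mulr0.
- move=> g /mapP[t tL ->]; have /andP[lw lb] := hL _ tL.
  exists (fun w b => if (w, b) == t.1 then 'X^(t.2) else 0); first exact: monom_nf.
  move=> w b i ni; case: eqP => [e|_]; last by rewrite coef0.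
  rewrite coefXn; case: eqP => [e2|//].
  by rewrite e e2 -surjective_pairing tL in ni.
Qed.

Lemma monom_indep L : uniq L -> {in L, forall t, (t.1.1 < 3)%N && (t.1.2 < m)%N} ->
  indep iota (map monom L).
Proof.
elim: L => //= t L IH /andP[tL uL] hL; split; last first.
  by apply: IH => // t' t'L; apply: hL; rewrite inE t'L orbT.
have /andP[lw lb] := hL _ (mem_head _ _).
case/monom_span => [t' t'L|s e hs]; first by apply: hL; rewrite inE t'L orbT.
rewrite (monom_nf lw lb) in e; have := nf_inj cm e lw lb.
move/(congr1 (fun p : {poly K} => p`_t.2)); rewrite -surjective_pairing eqxx coefXn eqxx hs.
  by move/eqP; rewrite oner_eq0.
by rewrite -!surjective_pairing.
Qed.

Lemma size_exponents k :
  size (exponents k) = (\sum_(0 <= w < 3) \sum_(0 <= b < m) (k.+1 - w - b))%N.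
Proof.
rewrite size_allpairs_dep sumnE big_map big_allpairs_dep /index_iota !subn0.
by apply: eq_bigr => w _; apply: eq_bigr => b _; rewrite size_iota subnDA.
Qed.

Lemma double_sum_sub n l : (l <= n.+1)%N ->
  (2 * (\sum_(0 <= b < l) (n - b)) + l * l.-1 = 2 * (n * l))%N.
Proof.
elim: l => [|l IH] le; first by rewrite big_geq //= !muln0.
rewrite big_nat_recr //= mulnDr; have := IH (ltnW le).
have [j ->] : exists j, n = (j + l)%N by exists (n - l)%N; rewrite subnK.
rewrite addnK; move: (\sum_(0 <= b < l) _)%N => S.
by case: l {le IH} => [|l] /=; lia.
Qed.

(** The Hilbert function [3mk + 1 - g] of a curve of degree [3m], where [2g = 3m(m - 1) + 2]. For
    [k >= m] no subtraction in [size_exponents] is truncated. *)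
Lemma size_exponents_ge k : (0 < m <= k)%N ->
  (2 * size (exponents k) + 3 * (m * m.-1) = 6 * (m * k))%N.
Proof.
move=> /andP[m0 le]; rewrite size_exponents big_nat_recr // big_nat_recr // big_nat1 /=.
have [j kE] : exists j, k = j.+1 by exists k.-1; lia.
rewrite kE !subSS !subn0.
have := @double_sum_sub j.+2 m; have := @double_sum_sub j.+1 m; have := @double_sum_sub j m.
move: (\sum_(0 <= b < m) _)%N (\sum_(0 <= b < m) _)%N (\sum_(0 <= b < m) _)%N (m * m.-1)%N => S0 S1 S2 M.
have l0 : (m <= j.+1)%N by rewrite -kE.
by move=> /(_ l0) h0 /(_ (leqW l0)) h1 /(_ (leqW (leqW l0))) h2; move: h0 h1 h2; lia.
Qed.

(** The count equals [g], one more than the polynomial formula of [size_exponents_ge] would give. *)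
Lemma size_exponents_pred : (1 < m)%N ->
  (2 * size (exponents m.-1) = 3 * (m * m.-1) + 2)%N.
Proof.
move=> m1; rewrite size_exponents big_nat_recr // big_nat_recr // big_nat1 /=.
have [j mE] : exists j, m = j.+2 by exists m.-2; lia.
rewrite mE /= !subSS !subn0.
(* The extra unit arises here: the last term should be [-1] and is truncated to [0]. *)
have -> : (\sum_(0 <= b < j.+2) (j - b) = \sum_(0 <= b < j.+1) (j - b))%N.
  rewrite big_nat_recr //= [X in (_ + X)%N](_ : _ = 0%N) ?addn0 //.
  by apply/eqP; rewrite subn_eq0.
have := @double_sum_sub j.+2 j.+2 (leqnSn _); have := @double_sum_sub j.+1 j.+2 (leqnn _).
have := @double_sum_sub j j.+1 (leqnn _).
move: (\sum_(0 <= b < _) _)%N (\sum_(0 <= b < _) _)%N (\sum_(0 <= b < _) _)%N => S0 S1 S2 /=.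
by lia.
Qed.
End Dimension.

(** * The tangent section at P *)

Section NodalParametrization.
Variables (R : fieldType) (x z w : R).
Hypothesis cubic : w ^+ 3 = x * z.
Let l := x + z + 1 - 3%:R * w.

(** The parameter [r = (x - w) / (1 - w)] is the projection from the node [x = z = w = 1]. Modulo
    [l] one has [x = r ^+ 3], [z = - (1 + r) ^+ 3] and [w = - r * (1 + r)]; this lemma and the next
    two are these congruences with denominators cleared and explicit cofactors of [l]. *)
Lemma nodal_x : x * (1 - w) ^+ 3 - (x - w) ^+ 3 = l * (x * (1 - x)).
Proof.
have -> : x * (1 - w) ^+ 3 - (x - w) ^+ 3 =
  x - 3%:R * x * w - x * w ^+ 3 - x ^+ 3 + 3%:R * x ^+ 2 * w + w ^+ 3 by ring.
by rewrite cubic /l; ring.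
Qed.

Lemma nodal_z : z * (1 - w) ^+ 3 + (1 + x - 2%:R * w) ^+ 3 =
  l * (l ^+ 2 + 3%:R * l * (w - z) + 3%:R * (w - z) ^+ 2 + z * (1 - z)).
Proof.
have -> : 1 + x - 2%:R * w = l + (w - z) by rewrite /l; ring.
have -> : z * (1 - w) ^+ 3 + (l + (w - z)) ^+ 3 =
  l * (l ^+ 2 + 3%:R * l * (w - z) + 3%:R * (w - z) ^+ 2) +
  (z - 3%:R * z * w - z * w ^+ 3 - z ^+ 3 + 3%:R * z ^+ 2 * w + w ^+ 3) by ring.
by rewrite cubic /l; ring.
Qed.

Lemma nodal_w : w * (1 - w) ^+ 2 + (x - w) * (1 + x - 2%:R * w) = l * x.
Proof.
have -> : w * (1 - w) ^+ 2 + (x - w) * (1 + x - 2%:R * w) = w ^+ 3 + x + x ^+ 2 - 3%:R * x * w.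
  by ring.
by rewrite cubic /l; ring.
Qed.

Hypothesis w1 : 1 - w != 0.
Let r := (x - w) / (1 - w).

Lemma nodal_rx : x - r ^+ 3 = l * (x * (1 - x) / (1 - w) ^+ 3).
Proof. by rewrite mulrA -nodal_x /r; field. Qed.

Lemma nodal_rz : z + (1 + r) ^+ 3 =
  l * ((l ^+ 2 + 3%:R * l * (w - z) + 3%:R * (w - z) ^+ 2 + z * (1 - z)) / (1 - w) ^+ 3).
Proof. by rewrite mulrA -nodal_z /r; field. Qed.

Lemma nodal_rw : w + r * (1 + r) = l * (x / (1 - w) ^+ 2).
Proof. by rewrite mulrA -nodal_w /r; field. Qed.
End NodalParametrization.

Lemma ev_rmorph (K R S : nzRingType) (j : K -> R) (phi : {rmorphism R -> S}) X Z Y (e : expr K) :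
  phi (ev j X Z Y e) = ev (phi \o j) (phi X) (phi Z) (phi Y) e.
Proof.
by elim: e => //= [e1 h1 e2 h2|e1 h1 e2 h2]; rewrite ?rmorphD ?rmorphM h1 h2.
Qed.

Lemma eq_ev (K R : nzRingType) (j j' : K -> R) X Z Y (e : expr K) :
  j =1 j' -> ev j X Z Y e = ev j' X Z Y e.
Proof. by move=> h; elim: e => //= e1 -> e2 ->. Qed.

(** * Polynomials in a uniformizer *)

Section Multiplicity.
Variables (K F : fieldType) (iota : {rmorphism K -> F}) (v : F -> int) (t : F) (r : K).
Hypotheses (pv : is_place iota v) (t0 : t - iota r != 0) (vt : v (t - iota r) = 1).

Lemma vge_uniformizer : vge v 0 t.
Proof.
rewrite -(subrK (iota r) t); apply: (vgeD pv); last exact: vge_const.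
by right; rewrite vt.
Qed.

Lemma place_not_root (f : {poly K}) : f.[r] != 0 ->
  (map_poly iota f).[t] != 0 /\ v (map_poly iota f).[t] = 0.
Proof.
move=> fr; apply: (place_unit pv fr).
have [g gE] : exists g, f - (f.[r])%:P = g * ('X - r%:P).
  by apply/factor_theorem; rewrite rootE !hornerE subrr.
have -> : (map_poly iota f).[t] - iota f.[r] = (map_poly iota (f - (f.[r])%:P)).[t].
  by rewrite rmorphB /= map_polyC hornerD hornerN hornerC.
rewrite gE rmorphM rmorphB /= map_polyX map_polyC hornerM hornerD hornerN hornerX hornerC.
apply: (vgeMl pv); last by right; rewrite vt.
exact/(vge_poly pv)/vge_uniformizer.
Qed.

Lemma vge_dvdp (f : {poly K}) (n : nat) :
  vge v n%:Z (map_poly iota f).[t] <-> ('X - r%:P) ^+ n %| f.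
Proof.
have e1 : (map_poly iota ('X - r%:P)).[t] = t - iota r.
  by rewrite rmorphB /= map_polyX map_polyC hornerD hornerN hornerX hornerC.
split; last first.
  move=> /dvdpP[g ->]; rewrite rmorphM rmorphXn /= hornerM horner_exp e1.
  apply: (vgeMl pv); first exact/(vge_poly pv)/vge_uniformizer.
  by right; rewrite (placeX pv) // vt natz.
have [->|f0] := eqVneq f 0; first by rewrite dvdp0.
have [k [g gr fE]] := multiplicity_XsubC f r; rewrite f0 /= in gr.
have [g0 vg] := place_not_root gr.
rewrite fE rmorphM rmorphXn /= hornerM horner_exp e1 => /(vgeP (mulf_neq0 g0 (expf_neq0 k t0))).
rewrite (placeM pv) ?expf_neq0 // vg add0r (placeX pv) // vt => le.
by apply: dvdp_mull; apply: dvdp_exp2l; move: le; rewrite natz.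
Qed.
End Multiplicity.

Fixpoint epow (K : nzRingType) (e : expr K) n := if n is n'.+1 then Emul e (epow e n') else Ec 1.

Lemma ev_epow (K R : nzRingType) (j : {rmorphism K -> R}) X Z Y e n :
  ev j X Z Y (epow e n) = ev j X Z Y e ^+ n.
Proof. by elim: n => [|n IH] /=; [rewrite rmorph1|rewrite IH exprS]. Qed.

Section Tangent.
Variables (K : closedFieldType) (F : fieldType) (iota : {rmorphism K -> F}).
Variables (q m : nat) (x z y : F) (zeta : K) (a c b : K).
Hypothesis cm : curve_model iota m x z y.
Hypothesis qm : q.+1 = (3 * m)%N.
Hypothesis q1 : (1 < q)%N.
Hypothesis frobK : forall u w : K, (u + w) ^+ q = u ^+ q + w ^+ q.
Hypothesis frobP : forall u w : {poly K}, (u + w) ^+ q = u ^+ q + w ^+ q.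
Hypothesis frobF : forall u w : F, (u + w) ^+ q = u ^+ q + w ^+ q.
Hypothesis zeta_eq : zeta ^+ 2 + zeta + 1 = 0.
Hypothesis onC : on_curve m a c b.
Hypothesis a0 : a != 0.
Hypothesis irrational : ~ (a ^+ (q ^ 2) = a /\ b ^+ (q ^ 2) = b).
Local Notation form := (dform iota x z y).

Variables (A B C r0 r1 : K) (l : F).
Hypotheses (AE : A = a ^+ q) (BE : B = b ^+ q) (CE : C = c ^+ q).
Hypotheses (r0E : r0 = a ^+ m) (r1E : r1 = r0 ^+ q).
Hypothesis lE : l = iota A * x + iota C * z + 1 - 3%:R * (iota B * y).

Lemma frobN (R : nzRingType) : (forall u w : R, (u + w) ^+ q = u ^+ q + w ^+ q) ->
  forall u : R, (- u) ^+ q = - u ^+ q.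
Proof.
move=> h u; apply/eqP; rewrite -addr_eq0 -h addNr expr0n.
by rewrite gtn_eqF // ltnW.
Qed.

(** Either [m] is even or the characteristic is 2; the sign rule for [q]-th powers covers both. *)
Lemma signm : (-1) ^+ m = 1 :> K.
Proof.
have : (-1) ^+ (3 * m) = 1 :> K by rewrite -qm exprS (frobN frobK) expr1n mulN1r opprK.
by rewrite mulnC exprM -[3%N]/(2 + 1)%N exprD expr1 sqrr_sign mul1r.
Qed.

Lemma cmE : c ^+ m = - (1 + r0).
Proof. by apply/eqP; rewrite r0E -addr_eq0 addrA addrAC [_ + a ^+ m]addrC onC.1. Qed.

(** [q + 1 = 3m] turns [a ^+ q.+1] into a cube of [r0 = a ^+ m]. With the next two lemmas, this
    makes P the point of parameter [r0] on the nodal cubic. *)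
Lemma Aa : A * a = r0 ^+ 3.
Proof. by rewrite AE r0E -exprSr qm mulnC exprM. Qed.

Lemma Cc : C * c = - (1 + r0) ^+ 3.
Proof. by rewrite CE -exprSr qm mulnC exprM cmE exprNn -signr_odd /= expr1 mulN1r. Qed.

Lemma Bb : B * b = - (r0 * (1 + r0)).
Proof. by rewrite BE -exprSr qm exprM onC.2 exprMn cmE r0E mulrN. Qed.

Lemma BAC : B ^+ 3 = A * C.
Proof. by rewrite AE BE CE -exprM mulnC exprM onC.2 exprMn. Qed.

Lemma r0_neq0 : r0 != 0. Proof. by rewrite r0E expf_neq0. Qed.

Lemma pow_q2 (u : K) : u ^+ q.+1 = 1 -> u ^+ (q ^ 2) = u.
Proof.
move=> e; have -> : (q ^ 2 = q.+1 * q.-1 + 1)%N.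
  by rewrite expnS expn1; case: (q) q1 => // k _ /=; lia.
by rewrite exprD exprM e expr1n mul1r.
Qed.

(** At the node, [a ^+ q.+1 = r0 ^+ 3 = 1] and likewise [b ^+ q.+1 = 1], so P would be rational. *)
Lemma r0_nodal : 1 + r0 + r0 ^+ 2 != 0.
Proof.
apply/eqP => e; apply: irrational.
have e3 : r0 ^+ 3 = 1.
  apply/eqP; rewrite -subr_eq0; have -> : r0 ^+ 3 - 1 = (r0 - 1) * (1 + r0 + r0 ^+ 2) by ring.
  by rewrite e mulr0.
split; apply: pow_q2; first by rewrite exprSr -AE Aa.
rewrite exprSr -BE Bb; apply/eqP; rewrite -subr_eq0.
have -> : - (r0 * (1 + r0)) - 1 = - (1 + r0 + r0 ^+ 2) by ring.
by rewrite e oppr0.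
Qed.

(** Otherwise [c = b = 0] and [a ^+ q.+1 = -1], and P would again be rational. *)
Lemma r0_neqN1 : 1 + r0 != 0.
Proof.
apply/eqP => e; apply: irrational.
have b0 : b = 0.
  have c0 : c = 0.
    by apply/eqP; move/eqP: cmE; rewrite e oppr0 expf_eq0 => /andP[].
  by have := onC.2; rewrite c0 mulr0 => /eqP; rewrite expf_eq0 => /andP[_ /eqP].
have q20 : (q ^ 2 == 0)%N = false by rewrite expn_eq0 gtn_eqF // ltnW.
split; last by rewrite b0 expr0n q20.
have e3 : a ^+ q.+1 = -1.
  rewrite exprSr -AE Aa; have -> : r0 = -1 by apply/eqP; rewrite -addr_eq0 addrC e.
  by rewrite exprNn expr1n -signr_odd /= expr1 mulr1.
have -> : (q ^ 2 = q.+1 * q.-1 + 1)%N.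
  by rewrite expnS expn1; case: (q) q1 => // k _ /=; lia.
rewrite exprD exprM e3 expr1.
have : (-1) ^+ q.+1 = 1 :> K by rewrite exprS (frobN frobK) expr1n mulN1r opprK.
have -> : q.+1 = (q.-1 + 2)%N by rewrite addn2 prednK // ltnW.
by rewrite exprD sqrrN expr1n mulr1 => ->; rewrite mul1r.
Qed.

Lemma c_neq0 : c != 0.
Proof.
apply: contraNneq r0_neqN1 => c0; move: cmE; rewrite c0 expr0n gtn_eqF ?(cm_m_gt0 cm) //=.
by move/esym/eqP; rewrite oppr_eq0.
Qed.

Lemma b_neq0 : b != 0.
Proof.
apply: contraNneq (mulf_neq0 a0 c_neq0) => b0.
by rewrite -onC.2 b0 expr0n.
Qed.

Lemma ABC_neq0 : [/\ A != 0, B != 0 & C != 0].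
Proof. by rewrite AE BE CE; split; apply: expf_neq0 => //; [exact: b_neq0|exact: c_neq0]. Qed.

(* [l = 0] cuts the cubic surface [w ^+ 3 = x * z] in a nodal cubic, which
   [(pX, pZ, pY)] parametrizes; the node is reached at [zeta] and [zeta ^+ 2]. *)
Let pX : {poly K} := (A^-1)%:P * 'X^3.
Let pZ : {poly K} := - (C^-1)%:P * ('X + 1%:P) ^+ 3.
Let pY : {poly K} := - (B^-1)%:P * ('X * ('X + 1%:P)).
Let evE (e : expr K) : {poly K} := ev polyC pX pZ pY e.

Lemma evE_horner e r : (evE e).[r] = ev idfun pX.[r] pZ.[r] pY.[r] e.
Proof.
rewrite -[_.[r]]/(horner_eval r (evE e)) /evE ev_rmorph; apply: eq_ev => k /=.
by rewrite /horner_eval hornerC.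
Qed.

Lemma evE_map e f : (map_poly iota (evE e)).[f] =
  ev iota (map_poly iota pX).[f] (map_poly iota pZ).[f] (map_poly iota pY).[f] e.
Proof.
rewrite -[_.[f]]/(horner_eval f (map_poly iota (evE e))) /evE !ev_rmorph; apply: eq_ev => k /=.
by rewrite map_polyC /horner_eval hornerC.
Qed.

Lemma pX_horner r : pX.[r] = r ^+ 3 / A.
Proof. by rewrite /pX hornerM hornerC hornerXn mulrC. Qed.
Lemma pZ_horner r : pZ.[r] = - (1 + r) ^+ 3 / C.
Proof. by rewrite /pZ hornerM hornerN hornerC horner_exp hornerD hornerX hornerC; ring. Qed.
Lemma pY_horner r : pY.[r] = - (r * (1 + r)) / B.
Proof. by rewrite /pY !hornerM hornerN hornerC hornerX hornerD hornerX hornerC; ring. Qed.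

Lemma pX_map f : (map_poly iota pX).[f] = f ^+ 3 / iota A.
Proof. by rewrite /pX rmorphM /= map_polyC map_polyXn hornerM hornerC hornerXn /= fmorphV mulrC. Qed.
Lemma pZ_map f : (map_poly iota pZ).[f] = - (1 + f) ^+ 3 / iota C.
Proof.
rewrite /pZ rmorphM rmorphN rmorphXn rmorphD /= !map_polyC map_polyX /= rmorph1.
by rewrite hornerM hornerN hornerC horner_exp hornerD hornerX hornerC /= fmorphV; ring.
Qed.
Lemma pY_map f : (map_poly iota pY).[f] = - (f * (1 + f)) / iota B.
Proof.
rewrite /pY rmorphM rmorphN rmorphM rmorphD /= !map_polyC map_polyX /= rmorph1.
by rewrite !hornerM hornerN hornerC hornerX hornerD hornerX hornerC /= fmorphV; ring.
Qed.

Lemma size_evE e : (size (evE e) <= (3 * edeg e).+1)%N.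
Proof.
have s1X : (size ('X + 1%:P : {poly K})%R <= 2)%N by rewrite size_XaddC.
have sM (p1 p2 : {poly K}) n1 n2 : (size p1 <= n1.+1)%N -> (size p2 <= n2.+1)%N ->
    (size (p1 * p2)%R <= (n1 + n2).+1)%N.
  move=> h1 h2; apply: leq_trans (size_polyMleq _ _) _.
  by move: h1 h2; move: (size p1) (size p2) => k1 k2; lia.
have sC (k : K) : (size k%:P <= 1)%N by apply: size_polyC_leq1.
elim: e => [k||||e1 h1 e2 h2|e1 h1 e2 h2] /=.
- exact: sC.
- by apply: (sM _ _ 0%N 3%N); rewrite ?sC // size_polyXn.
- rewrite /pZ mulNr size_polyN; apply: (sM _ _ 0%N 3%N) => //.
  by apply: (sM _ _ 1%N 2%N) => //; apply: (sM _ _ 1%N 1%N).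
- rewrite /pY mulNr size_polyN; apply: (sM _ _ 0%N 3%N) => //.
  by apply: leq_trans (sM _ _ 1%N 1%N _ s1X) _; rewrite ?size_polyX.
- apply: leq_trans (size_polyD _ _) _; rewrite geq_max.
  apply/andP; split; [apply: leq_trans h1 _|apply: leq_trans h2 _]; rewrite ltnS leq_mul2l.
    exact: leq_maxl.
  exact: leq_maxr.
- by rewrite mulnDr; apply: sM.
Qed.

Lemma zeta2 : zeta ^+ 2 = - (1 + zeta).
Proof. by apply/eqP; rewrite -addr_eq0 addrA addrAC zeta_eq. Qed.

Lemma zeta3 : zeta ^+ 3 = 1.
Proof. by rewrite exprS zeta2; have := zeta2; rewrite expr2 => e; rewrite mulrN mulrDr e; ring. Qed.

Lemma evE_node e : (evE e).[zeta] = (evE e).[zeta ^+ 2].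
Proof.
have e1 : 1 + zeta = - zeta ^+ 2 by rewrite zeta2 opprK.
have e2 : 1 + zeta ^+ 2 = - zeta by rewrite zeta2; ring.
have e3 : (zeta ^+ 2) ^+ 3 = 1 by rewrite -exprM mulnC exprM zeta3 expr1n.
rewrite !evE_horner !pX_horner !pZ_horner !pY_horner e1 e2 zeta3 e3.
have -> : (- zeta ^+ 2) ^+ 3 = (- zeta) ^+ 3.
  by rewrite [in LHS]exprNn [in RHS]exprNn e3 zeta3.
by have -> : zeta * - zeta ^+ 2 = zeta ^+ 2 * - zeta by ring.
Qed.

(** * Reduction modulo [l] to the nodal cubic *)

Section Congruence.
Variables (v : F -> int) (N : int).
Hypotheses (pv : is_place iota v) (vx : 0 <= v x) (N0 : 0 <= N).
Let w' := iota B * y.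
Hypotheses (w1 : 1 - w' != 0) (vw1 : v (1 - w') = 0) (vl : vge v N l).
Let rho := (iota A * x - w') / (1 - w').

Lemma cubicF : w' ^+ 3 = (iota A * x) * (iota C * z).
Proof.
by rewrite /w' exprMn (cm_y cm) -rmorphXn BAC rmorphM; ring.
Qed.

Lemma vge_rho : vge v 0 rho.
Proof.
have [hx hz hy] := finite_place_ge0 cm pv vx.
apply: (vgeMl pv); first by apply: (vgeB pv); apply: (vgeMl pv) => //; apply: vge_const.
by right; rewrite (placeV pv) // vw1.
Qed.

(** The cofactors of [l] in the nodal identities are regular at [v], because [1 - w'] is a unit
    there; this settles [x], [z] and [y], and induction on the expression does the rest. *)
Lemma congruence e : vge v N (ev iota x z y e - (map_poly iota (evE e)).[rho]).
Proof.
have [A0 B0 C0] := ABC_neq0.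
have [hx hz hy] := finite_place_ge0 cm pv vx.
have hc k : vge v 0 (iota k) by apply: vge_const.
have hn n : vge v 0 (n%:R : F) by rewrite -(rmorph_nat iota).
have hw : vge v 0 w' by apply: (vgeMl pv).
have hx' : vge v 0 (iota A * x) by apply: (vgeMl pv).
have hz' : vge v 0 (iota C * z) by apply: (vgeMl pv).
have hV n : vge v 0 ((1 - w') ^+ n)^-1.
  by rewrite -exprVn; apply: (vge0X pv); right; rewrite (placeV pv) // vw1.
have h1 : vge v 0 1 := vge1 pv.
have hl : vge v 0 l := vge_le N0 vl.
have gl g : vge v 0 g -> vge v N (l * g) by apply: (vgeMr pv).
have lE' : l = iota A * x + iota C * z + 1 - 3%:R * w' by [].
have ex : x - (map_poly iota pX).[rho] = l * ((iota A * x) * (1 - iota A * x) / (1 - w') ^+ 3) / iota A.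
  by rewrite lE' -(nodal_rx cubicF w1) -/rho pX_map; move: rho => t; field; rewrite fmorph_eq0.
have ez : z - (map_poly iota pZ).[rho] = l * ((l ^+ 2 + 3%:R * l * (w' - iota C * z) +
    3%:R * (w' - iota C * z) ^+ 2 + iota C * z * (1 - iota C * z)) / (1 - w') ^+ 3) / iota C.
  by rewrite lE' -(nodal_rz cubicF w1) -/rho pZ_map; move: rho => t; field; rewrite fmorph_eq0.
have ey : y - (map_poly iota pY).[rho] = l * (iota A * x / (1 - w') ^+ 2) / iota B.
  by rewrite lE' -(nodal_rw cubicF w1) -/rho pY_map /w'; move: rho => t; field; rewrite fmorph_eq0.
have cx : vge v N (x - (map_poly iota pX).[rho]).
  rewrite ex -fmorphV; apply: (vgeMr pv) => //; apply: gl; apply: (vgeMl pv) => //.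
  by apply: (vgeMl pv) => //; apply: (vgeB pv).
have cz : vge v N (z - (map_poly iota pZ).[rho]).
  rewrite ez -fmorphV; apply: (vgeMr pv) => //; apply: gl; apply: (vgeMl pv) => //.
  have hwz : vge v 0 (w' - iota C * z) by apply: (vgeB pv).
  apply: (vgeD pv); last by apply: (vgeMl pv) => //; apply: (vgeB pv).
  apply: (vgeD pv); last by apply: (vgeMl pv) => //; apply: (vge0X pv).
  apply: (vgeD pv); first exact: (vge0X pv).
  by apply: (vgeMl pv) => //; apply: (vgeMl pv).
have cy : vge v N (y - (map_poly iota pY).[rho]).
  rewrite ey -fmorphV; apply: (vgeMr pv) => //; apply: gl; exact: (vgeMl pv).
rewrite evE_map.
have hp p : vge v 0 (map_poly iota p).[rho] by apply: (vge_poly pv); apply: vge_rho.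
suff [_ //] : vge v 0 (ev iota x z y e) /\ vge v N (ev iota x z y e -
  ev iota (map_poly iota pX).[rho] (map_poly iota pZ).[rho] (map_poly iota pY).[rho] e).
elim: e => [k||||e1 [g1 h1'] e2 [g2 h2]|e1 [g1 h1'] e2 [g2 h2]] /=; split=> //.
- by rewrite subrr; left.
- exact: (vgeD pv).
- by rewrite opprD addrACA; apply: (vgeD pv).
- exact: (vgeMl pv).
- rewrite -!evE_map in h1' h2 *.
  set f1 := ev _ _ _ _ e1 in g1 h1' *; set f2 := ev _ _ _ _ e2 in g2 h2 *.
  have -> : f1 * f2 - (map_poly iota (evE e1)).[rho] * (map_poly iota (evE e2)).[rho] =
    (f1 - (map_poly iota (evE e1)).[rho]) * f2 +
    (map_poly iota (evE e1)).[rho] * (f2 - (map_poly iota (evE e2)).[rho]) by ring.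
  by apply: (vgeD pv); [apply: (vgeMr pv)|apply: (vgeMl pv)].
Qed.
End Congruence.

Let Phi : {poly K} := pX ^+ m + pZ ^+ m + 1.

Lemma r1D : 1 + r1 = (1 + r0) ^+ q.
Proof. by rewrite r1E frobK expr1n. Qed.

Lemma r1_neq0 : r1 != 0. Proof. by rewrite r1E expf_neq0 // r0_neq0. Qed.
Lemma r1_neqN1 : 1 + r1 != 0. Proof. by rewrite r1D expf_neq0 // r0_neqN1. Qed.

Lemma r1_nodal : 1 + r1 + r1 ^+ 2 != 0.
Proof.
have -> : 1 + r1 + r1 ^+ 2 = (1 + r0 + r0 ^+ 2) ^+ q.
  by rewrite 2!frobK expr1n r1E -!exprM mulnC.
by rewrite expf_neq0 // r0_nodal.
Qed.

Lemma not_node r : 1 + r + r ^+ 2 != 0 -> r != zeta /\ r != zeta ^+ 2.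
Proof.
move=> h; split; apply: contraNneq h => ->.
  have -> : 1 + zeta + zeta ^+ 2 = zeta ^+ 2 + zeta + 1 by ring.
  by rewrite zeta_eq.
have -> : 1 + zeta ^+ 2 + zeta ^+ 2 ^+ 2 = (zeta ^+ 2 + zeta + 1) * (zeta ^+ 2 - zeta + 1) by ring.
by rewrite zeta_eq mul0r.
Qed.

(** [Phi] is the equation of the curve along the nodal cubic. As [3m = q + 1], its terms are
    multiples of ['X ^+ q.+1], [('X + 1) ^+ q.+1] and [1], so additivity of the [q]-th power lets it
    factor; the exponents are the multiplicities in [q P + Fr(P)]. *)
Lemma Phi_factor : Phi = ((r1 * (1 + r1))^-1)%:P * (('X - r0%:P) ^+ q * ('X - r1%:P)).
Proof.
have Am : A ^+ m = r1 by rewrite AE r1E r0E -!exprM mulnC.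
have Cm : C ^+ m = - (1 + r1) by rewrite CE r1D -exprM mulnC exprM cmE (frobN frobK).
have h1 : pX ^+ m = (r1^-1)%:P * 'X ^+ q.+1.
  by rewrite /pX exprMn -rmorphXn /= exprVn Am -exprM -qm.
have h2 : pZ ^+ m = - ((1 + r1)^-1)%:P * (('X + 1%:P) * ('X ^+ q + 1)).
  rewrite /pZ exprMn -exprM -qm exprS frobP polyC1 expr1n -!rmorphN /= -rmorphXn /=.
  by rewrite exprNn signm mul1r exprVn Cm -invrN.
have h3 : ('X - r0%:P) ^+ q = 'X ^+ q - r1%:P.
  by rewrite frobP (frobN frobP) -rmorphXn /= r1E.
rewrite /Phi h1 h2 h3 exprS invfM rmorphM /=.
have uR : (r1^-1)%:P * r1%:P = 1 :> {poly K} by rewrite -rmorphM /= mulVf ?r1_neq0.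
have wR : ((1 + r1)^-1)%:P * (1 + r1%:P) = 1 :> {poly K}.
  by rewrite -polyC1 -rmorphD -rmorphM /= mulVf ?r1_neqN1.
rewrite polyC1.
move: (r1^-1)%:P (((1 + r1)^-1)%:P) (r1%:P) uR wR => u w R uR wR.
set Xq := 'X ^+ q.
have -> : u * w * ((Xq - R) * ('X - R)) =
  (w * (1 + R)) * (u * ('X * Xq)) - (u * R) * (w * (('X + 1) * (Xq + 1))) + (u * R) * (w * (1 + R)).
  by ring.
by rewrite uR wR; ring.
Qed.

Section PhiCongruence.
Variables (v : F -> int) (N : int).
Hypotheses (pv : is_place iota v) (vx : 0 <= v x) (N0 : 0 <= N).
Hypotheses (w1 : 1 - iota B * y != 0) (vw1 : v (1 - iota B * y) = 0) (vl : vge v N l).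

Lemma vge_Phi :
  vge v N (map_poly iota Phi).[(iota A * x - iota B * y) / (1 - iota B * y)].
Proof.
pose e := Eadd (Eadd (epow Ex m) (epow Ez m)) (Ec 1) : expr K.
have := congruence pv vx N0 w1 vw1 vl e.
have -> : ev iota x z y e = 0 by rewrite /= !ev_epow /= rmorph1 (cm_fermat cm).
have -> : evE e = Phi by rewrite /evE /e /= !ev_epow.
by rewrite sub0r => /(vgeN pv); rewrite opprK.
Qed.
End PhiCongruence.

(** * Points of the nodal cubic and the local parameter [rho] *)

Definition on_nodal (r u w t : K) := [/\ u = pX.[r], w = pZ.[r] & t = pY.[r]].

Lemma nodal_scaled r u w t : on_nodal r u w t ->
  [/\ A * u = r ^+ 3, C * w = - (1 + r) ^+ 3 & B * t = - (r * (1 + r))].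
Proof.
have [A0 B0 C0] := ABC_neq0.
move=> [-> -> ->]; rewrite pX_horner pZ_horner pY_horner.
by split; rewrite mulrC divfK.
Qed.

Lemma on_nodalP r u w t :
  A * u = r ^+ 3 -> C * w = - (1 + r) ^+ 3 -> B * t = - (r * (1 + r)) -> on_nodal r u w t.
Proof.
have [A0 B0 C0] := ABC_neq0.
move=> hu hw ht; rewrite /on_nodal pX_horner pZ_horner pY_horner -hu -hw -ht.
by split; rewrite mulrC mulKf.
Qed.

Lemma P_nodal : on_nodal r0 a c b.
Proof. by apply: on_nodalP; [exact: Aa|exact: Cc|exact: Bb]. Qed.

Let a1 := a ^+ (q ^ 2).
Let c1 := c ^+ (q ^ 2).
Let b1 := b ^+ (q ^ 2).

(** Coefficient times coordinate, [a ^+ q * a ^+ (q ^ 2)], is the [q]-th power of the product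
    [a ^+ q * a] met at P, so the parameter becomes [r0 ^+ q]. *)
Lemma FrP_nodal : on_nodal r1 a1 c1 b1.
Proof.
have q2 u : u ^+ q * u ^+ (q ^ 2) = (u ^+ q * u) ^+ q :> K.
  by rewrite exprMn expnS expn1 exprM mulrC.
apply: on_nodalP.
- by rewrite AE q2 -AE Aa r1E -!exprM mulnC.
- by rewrite CE q2 -CE Cc (frobN frobK) r1D -!exprM mulnC.
- by rewrite BE q2 -BE Bb (frobN frobK) exprMn -r1D r1E.
Qed.

Lemma FrP_on_curve : on_curve m a1 c1 b1.
Proof.
have H (u w t : K) : on_curve m u w t -> on_curve m (u ^+ q) (w ^+ q) (t ^+ q).
  move=> [h1 h2]; split; last by rewrite -exprMn -h2 -!exprM mulnC.
  have := congr1 (fun k : K => k ^+ q) h1; rewrite 2!frobK expr1n expr0n gtn_eqF ?(ltnW q1) //=.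
  by move=> e; rewrite -!exprM ![(q * m)%N]mulnC !exprM e.
by have := H _ _ _ (H _ _ _ onC); rewrite -!exprM.
Qed.

Lemma b1_neq0 : b1 != 0. Proof. by rewrite expf_neq0 // b_neq0. Qed.

(** The parameter determines the point, so equality would give Fr(P) = P. *)
Lemma r01_neq : r0 != r1.
Proof.
apply/eqP => e; apply: irrational.
have [ha _ hb] := P_nodal; have [ha1 _ hb1] := FrP_nodal.
by rewrite -/a1 -/b1 ha1 hb1 -e; split; rewrite -?ha -?hb.
Qed.

Section Local.
Variables (v : F -> int) (r u w t : K).
Hypotheses (hQ : on_curve m u w t) (hv : center iota x z y v u w t) (hr : on_nodal r u w t).
Hypotheses (nr : 1 + r + r ^+ 2 != 0).
Let w' := iota B * y.
Let rho := (iota A * x - w') / (1 - w').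

Lemma local_w : 1 - w' != 0 /\ v (1 - w') = 0.
Proof.
have [pv _ _ hy] := hv; apply: (place_unit pv nr).
have [_ _ ht] := nodal_scaled hr.
have -> : 1 - w' - iota (1 + r + r ^+ 2) = - (iota B * (y - iota t)).
  have -> : 1 + r + r ^+ 2 = 1 - B * t by rewrite ht; ring.
  by rewrite rmorphB rmorphM rmorph1 /w'; ring.
by apply: (vgeN pv); apply: (vgeMl pv) => //; apply: vge_const.
Qed.

Lemma local_l : vge v 1 l.
Proof.
have [pv hx hz hy] := hv; have [hu hw ht] := nodal_scaled hr.
have -> : l = iota A * (x - iota u) + iota C * (z - iota w) - 3%:R * (iota B * (y - iota t))
   + iota (A * u + C * w + 1 - 3%:R * (B * t)).
  by rewrite lE rmorphB !rmorphD !rmorphM rmorph1 rmorph_nat; ring.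
have -> : A * u + C * w + 1 - 3%:R * (B * t) = 0 by rewrite hu hw ht; ring.
rewrite rmorph0 addr0 -(rmorph_nat iota).
have hc k g : vge v 1 g -> vge v 1 (iota k * g) by apply: (vgeMl pv); apply: vge_const.
by apply: (vgeB pv); [apply: (vgeD pv); apply: hc|do 2!apply: (hc _ _)].
Qed.

Lemma local_rho1 : vge v 1 (rho - iota r).
Proof.
have [pv hx hz hy] := hv; have [hu hw ht] := nodal_scaled hr.
have [w0 vw0] := local_w.
have e : (rho - iota r) * (1 - w') = iota A * (x - iota u) - (1 - iota r) * (iota B * (y - iota t))
   + iota (A * u - B * t - r * (1 - B * t)).
  rewrite mulrBl /rho divfK // !rmorphB rmorphM rmorphM rmorphM rmorphB rmorph1 rmorphM /w'; ring.
apply: (vgeMr_unit pv w0 vw0); rewrite e.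
have -> : A * u - B * t - r * (1 - B * t) = 0 by rewrite hu ht; ring.
have hc k g : vge v 1 g -> vge v 1 (iota k * g) by apply: (vgeMl pv); apply: vge_const.
rewrite rmorph0 addr0 -(rmorph1 iota) -rmorphB.
by apply: (vgeB pv); [apply: hc|do 2!apply: (hc _ _)].
Qed.

(** Modulo [l] the function [x] is a polynomial in [rho]. Were [rho - r] of order at least two, so
    would be [x - u], which is a uniformizer since [t != 0]. *)
Lemma local_rho : t != 0 -> vge v 2 l -> rho - iota r != 0 /\ v (rho - iota r) = 1.
Proof.
move=> t0 vl; have [pv hx hz hy] := hv.
have [A0 B0 C0] := ABC_neq0; have [w0 vw0] := local_w.
have [vv [cv _ _ h4 _]] := point_place cm hQ.
have xu0 : x - iota u != 0.
  have /(cm_transc cm) := negbT (polyXsubC_eq0 u).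
  by rewrite rmorphB /= map_polyX map_polyC !hornerE.
have vxu : v (x - iota u) = 1 by rewrite (center_same cm hQ hv cv) // h4.
have vx := center_x_ge0 cm hv.
have nle2 : ~ vge v 2 (rho - iota r).
  move=> h2; have : vge v 2 (x - iota u).
    have -> : x - iota u = (x - (map_poly iota pX).[rho]) +
       (rho - iota r) * ((rho ^+ 2 + rho * iota r + iota r ^+ 2) / iota A).
      have [-> _ _] := hr; rewrite pX_map pX_horner fmorph_div rmorphXn.
      by move: (rho) => tt; field; rewrite fmorph_eq0.
    have hrho := vge_rho pv vx w0 vw0.
    apply: (vgeD pv); first exact: (congruence pv vx _ w0 vw0 vl Ex).
    apply: (vgeMr pv) => //; rewrite -fmorphV; apply: (vgeMr pv); last exact: vge_const.
    have hc k : vge v 0 (iota k) by apply: vge_const.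
    apply: (vgeD pv); last exact: (vge0X pv).
    by apply: (vgeD pv); [apply: (vge0X pv)|apply: (vgeMl pv)].
  by move/(vgeP xu0); rewrite vxu.
have n0 : rho - iota r != 0 by apply/eqP => e; apply: nle2; left.
split=> //; have := vgeP n0 local_rho1.
rewrite le_eqVlt => /orP[/eqP //|lt]; case: nle2; right; lia.
Qed.
End Local.

(** * The divisor of [l] *)

Lemma affine_l : form 1 l.
Proof.
rewrite lE; apply: dformB; last first.
  by rewrite -(rmorph_nat iota); do 2!apply: dformZ; apply: dform_y.
apply: dformD; last exact: dform1.
by apply: dformD; apply: dformZ; [apply: dform_x|apply: dform_z].
Qed.

Lemma Phi_root r : Phi.[r] = 0 -> r = r0 \/ r = r1.
Proof.
rewrite Phi_factor hornerM hornerC => /eqP; rewrite mulf_eq0 invr_eq0 mulf_eq0.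
rewrite (negPf r1_neq0) (negPf r1_neqN1) /= hornerM horner_exp !hornerXsubC.
rewrite mulf_eq0 expf_eq0 !subr_eq0 => /orP[/andP[_ /eqP]|/eqP]; by [left|right].
Qed.

Section AtP.
Variable v : F -> int.
Hypothesis hv : center iota x z y v a c b.

(* Up to [q]-th powers of uniformizers [l] is [X ^+ 3 + Z ^+ 3 + 1 - 3 X Z] with
   [X = x ^+ m] and [Z = z ^+ m], and this is divisible by [X + Z + 1 = 0]. *)
Lemma vge_l_P : vge v q l.
Proof.
have [pv hx hz hy] := hv; have vx := center_x_ge0 cm hv.
have [gx gz gy] := finite_place_ge0 cm pv vx.
have fr (k : K) (g : F) : iota (k ^+ q) = g ^+ q - (g - iota k) ^+ q.
  by rewrite frobF (frobN frobF) rmorphXn; ring.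
have e0 : x ^+ q.+1 + z ^+ q.+1 + 1 - 3%:R * y ^+ q.+1 = 0.
  rewrite !qm [in y ^+ _]exprM (cm_y cm) exprMn mulnC !exprM.
  rewrite (cm_zm cm).
  ring.
have -> : l = 3%:R * ((y - iota b) ^+ q * y) - ((x - iota a) ^+ q * x + (z - iota c) ^+ q * z)
   + (x ^+ q.+1 + z ^+ q.+1 + 1 - 3%:R * y ^+ q.+1).
  by rewrite lE AE BE CE (fr a x) (fr b y) (fr c z) !exprSr; ring.
rewrite e0 addr0 -(rmorph_nat iota).
have hq g : vge v 1 g -> vge v q (g ^+ q).
  by move/(@vgeX _ _ _ _ pv _ _ q); rewrite -mulr_natl mulr1 natz.
apply: (vgeB pv).
  by apply: (vgeMl pv); [apply: vge_const|apply: (vgeMr pv) => //; apply: hq].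
by apply: (vgeD pv); apply: (vgeMr pv) => //; apply: hq.
Qed.

(** [vge_l_P] gives one inequality. A larger order would make [('X - r0%:P) ^+ q.+1] divide [Phi],
    whose multiplicity at [r0] is exactly [q] since [r0 != r1]. *)
Lemma l_at_P : l != 0 /\ v l = q.
Proof.
have [pv _ _ _] := hv; have vx := center_x_ge0 cm hv.
have nle : ~ vge v q.+1 l.
  move=> h; have h2 : vge v 2 l by apply: vge_le h; lia.
  have [w0 vw0] := local_w hv P_nodal r0_nodal.
  have [rn vr] := local_rho onC hv P_nodal r0_nodal b_neq0 h2.
  have := vge_Phi pv vx (isT : 0 <= q.+1%:Z) w0 vw0 h.
  move/(vge_dvdp pv rn vr); rewrite Phi_factor mulrCA exprSr.
  rewrite dvdp_mul2l ?expf_neq0 ?polyXsubC_eq0 // dvdp_XsubCl rootE hornerM hornerC hornerXsubC.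
  by rewrite mulf_eq0 invr_eq0 mulf_eq0 (negPf r1_neq0) (negPf r1_neqN1) subr_eq0 (negPf r01_neq).
have l0 : l != 0 by apply/eqP => e; apply: nle; left.
split=> //; have := vgeP l0 vge_l_P.
rewrite le_eqVlt => /orP[/eqP //|lt]; case: nle; right; lia.
Qed.
End AtP.

(** [r1] is a simple root of [Phi], which excludes order two. *)
Lemma l_at_FrP v : center iota x z y v a1 c1 b1 -> v l = 1.
Proof.
move=> hv; have [pv _ _ _] := hv; have vx := center_x_ge0 cm hv.
have [w [cw _ _ _ _]] := point_place cm onC; have [l0 _] := l_at_P cw.
have nle : ~ vge v 2 l.
  move=> h; have [w0 vw0] := local_w hv FrP_nodal r1_nodal.
  have [rn vr] := local_rho FrP_on_curve hv FrP_nodal r1_nodal b1_neq0 h.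
  have := vge_Phi pv vx (isT : 0 <= 2%:Z) w0 vw0 h.
  move/(vge_dvdp pv rn vr); rewrite Phi_factor mulrA exprSr.
  rewrite dvdp_mul2r ?polyXsubC_eq0 // dvdp_XsubCl rootE hornerM hornerC horner_exp hornerXsubC.
  rewrite mulf_eq0 invr_eq0 mulf_eq0 (negPf r1_neq0) (negPf r1_neqN1) /= expf_eq0 subr_eq0.
  by rewrite eq_sym (negPf r01_neq) andbF.
have := vgeP l0 (local_l hv FrP_nodal).
rewrite le_eqVlt => /orP[/eqP //|lt]; case: nle; right; lia.
Qed.

(** The center of [v] lies on the curve and on the nodal cubic, so its parameter is a root of
    [Phi]. *)
Lemma l_zeros v : is_place iota v -> 0 <= v x -> vge v 1 l ->
  center iota x z y v a c b \/ center iota x z y v a1 c1 b1.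
Proof.
move=> pv vx vl; have [u [w [t [hQ hv]]]] := place_center cm pv vx.
have [_ hx hz hy] := hv.
have lQ : A * u + C * w + 1 - 3%:R * (B * t) = 0.
  apply: (vge1_constP pv).
  have -> : iota (A * u + C * w + 1 - 3%:R * (B * t)) =
    l - (iota A * (x - iota u) + iota C * (z - iota w) - 3%:R * (iota B * (y - iota t))).
    by rewrite lE rmorphB !rmorphD !rmorphM rmorph1 rmorph_nat; ring.
  apply: (vgeB pv) => //; rewrite -(rmorph_nat iota).
  have hc k g : vge v 1 g -> vge v 1 (iota k * g) by apply: (vgeMl pv); apply: vge_const.
  by apply: (vgeB pv); [apply: (vgeD pv); apply: hc|do 2!apply: (hc _ _)].
have cub : (B * t) ^+ 3 = (A * u) * (C * w) by rewrite exprMn BAC hQ.2; ring.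
have PhiQ r : on_nodal r u w t -> r = r0 \/ r = r1.
  move=> [hu hw _]; apply: Phi_root.
  by rewrite /Phi !hornerD -[1]/(1%:P) hornerC !horner_exp -hu -hw hQ.1.
have [e1|n1] := eqVneq (1 - B * t) 0; last first.
  pose r := (A * u - B * t) / (1 - B * t).
  have hr : on_nodal r u w t.
    apply: on_nodalP; apply/eqP; rewrite -subr_eq0 ?opprK; apply/eqP.
    - by rewrite (nodal_rx cub n1) lQ mul0r.
    - by rewrite (nodal_rz cub n1) lQ mul0r.
    - by rewrite (nodal_rw cub n1) lQ mul0r.
  have [e|e] := PhiQ _ hr; rewrite e in hr; [left|right].
    by move: hv hr => h [eu ew et]; have [-> -> ->] := P_nodal; rewrite -eu -ew -et.
  by move: hv hr => h [eu ew et]; have [-> -> ->] := FrP_nodal; rewrite -eu -ew -et.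
(* The node: [B * t = 1] forces [A * u = C * w = 1], the point of parameter [zeta], and [zeta] would
   be a root of [Phi]. *)
have Bt : B * t = 1 by apply/eqP; rewrite eq_sym -subr_eq0 e1.
have eC : C * w = 2%:R - A * u.
  by apply/eqP; rewrite -subr_eq0 -[X in _ == X]lQ Bt; apply/eqP; ring.
have Au : A * u = 1.
  apply/eqP; rewrite -subr_eq0 -sqrf_eq0; apply/eqP.
  have -> : (A * u - 1) ^+ 2 = 1 - A * u * (2%:R - A * u) by ring.
  by rewrite -eC -cub Bt expr1n subrr.
have e2 : 1 + zeta = - zeta ^+ 2 by rewrite zeta2 opprK.
have hz3 : on_nodal zeta u w t.
  apply: on_nodalP; rewrite ?e2.
  - by rewrite Au zeta3.
  - rewrite eC Au; have -> : - (- zeta ^+ 2) ^+ 3 = (zeta ^+ 3) ^+ 2 by ring.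
    by rewrite zeta3; ring.
  - rewrite Bt; have -> : - (zeta * - zeta ^+ 2) = zeta ^+ 3 by ring.
    by rewrite zeta3.
have [e|e] := PhiQ _ hz3.
  by have [] := not_node r0_nodal; rewrite -e eqxx.
by have [] := not_node r1_nodal; rewrite -e eqxx.
Qed.

Section AtInfinity.
Variable v : F -> int.
Hypotheses (pv : is_place iota v) (vx : v x < 0).

Lemma infinity_zy : v z = v x /\ 3%:Z * v y = 2%:Z * v x.
Proof.
have [x0 z0 y0] := cm_neq0 cm; have m0 := cm_m_gt0 cm.
have vX n f : f != 0 -> v (f ^+ n) = n%:Z * v f.
  by move=> f0; rewrite (placeX pv) // -mulr_natl natz.
have xm0 : x ^+ m != 0 by rewrite expf_neq0.
have vz : v z = v x.
  have [|_] := placeD_lt pv (g := 1) xm0.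
    right; rewrite (place1 pv) vX //.
    by move: vx m0; move: (m) (v x) => k d; nia.
  have -> : x ^+ m + 1 = - z ^+ m.
    by apply/eqP; rewrite -addr_eq0 addrAC (cm_fermat cm).
  rewrite (placeN pv) !vX // => e.
  by apply: (mulfI (x := m%:Z)) e; rewrite gt_eqF.
split=> //; rewrite -vX // (cm_y cm) (placeM pv) // vz; lia.
Qed.

Lemma form_infinity d f : form d f -> vge v (d%:Z * v x) f.
Proof.
have [vz vy] := infinity_zy.
suff H (e : expr K) : vge v ((edeg e)%:Z * v x) (ev iota x z y e).
  by move=> [e he ->]; apply: vge_le (H e); move: vx he; move: (edeg e) (v x) => k t; nia.
elim: e => [k||||e1 h1 e2 h2|e1 h1 e2 h2] /=.
- by rewrite mul0r; apply: vge_const.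
- by right; rewrite mul1r.
- by right; rewrite mul1r vz.
- by right; rewrite mul1r; lia.
- have le k n : (k <= n)%N -> n%:Z * v x <= k%:Z * v x.
    by move: vx; move: (v x) => t; nia.
  apply: (vgeD pv); [apply: vge_le h1|apply: vge_le h2]; apply: le.
    exact: leq_maxl.
  exact: leq_maxr.
- by rewrite PoszD mulrDl; apply: (vgeM pv).
Qed.

(** At infinity [y / x] vanishes and [(z / x) ^+ m = -1]. If the leading terms [A * x + C * z]
    cancelled, then [(C * z / x) ^+ m = A ^+ m] there, that is, [1 + r1 = r1]. *)
Lemma l_infinity : v l = v x.
Proof.
have [vz vy] := infinity_zy; have [x0 z0 y0] := cm_neq0 cm; have m0 := cm_m_gt0 cm.
have [w [cw _ _ _ _]] := point_place cm onC; have [l0 _] := l_at_P cw.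
have ge := form_infinity affine_l; rewrite mul1r in ge.
have nle : ~ vge v (v x + 1) l.
  move=> h.
  have hc k n g : vge v n g -> vge v n (iota k * g) by apply: (vgeMl pv); apply: vge_const.
  have h1 : vge v (v x + 1) (iota A * x + iota C * z).
    have -> : iota A * x + iota C * z = l - 1 + iota 3%:R * (iota B * y).
      by rewrite rmorph_nat lE; ring.
    apply: (vgeD pv); last by do 2!apply: (hc _ _ _); right; lia.
    by apply: (vgeB pv) => //; right; rewrite (place1 pv); lia.
  pose om := z / x.
  have vom : vge v 0 om by right; rewrite (placeM pv) ?invr_neq0 // (placeV pv) // vz subrr.
  have h2 : vge v 1 (iota A + iota C * om).
    have -> : iota A + iota C * om = (iota A * x + iota C * z) * x^-1 by rewrite /om; field.
    have -> : 1 = (v x + 1) + - v x by ring.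
    by apply: (vgeM pv) => //; right; rewrite (placeV pv).
  have h3 : vge v 1 ((iota C * om) ^+ m - (- iota A) ^+ m).
    rewrite subrXX; apply: (vgeMr pv); first by rewrite opprK addrC.
    apply: (vge_sum pv) => j _; apply: (vgeMl pv); apply: (vge0X pv).
      exact: hc.
    by rewrite -rmorphN; apply: vge_const.
  have Am : A ^+ m = r1 by rewrite AE r1E r0E -!exprM mulnC.
  have Cm : C ^+ m = - (1 + r1) by rewrite CE r1D -exprM mulnC exprM cmE (frobN frobK).
  have : vge v 1 (iota 1).
    have -> : iota 1 = (iota C * om) ^+ m - (- iota A) ^+ m + iota (C ^+ m) * (x^-1) ^+ m.
      rewrite exprMn -rmorphXn -rmorphN -(rmorphXn iota) exprNn signm mul1r Am Cm.
      rewrite /om exprMn exprVn.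
      rewrite (cm_zm cm).
      by rewrite rmorphN rmorphD rmorph1; field; rewrite expf_neq0.
    apply: (vgeD pv) => //; apply: hc; right.
    rewrite (placeX pv) ?invr_neq0 // (placeV pv) // -mulr_natl natz.
    by move: vx m0; move: (m) (v x) => k t; nia.
  by move/(vge1_constP pv)/eqP; rewrite oner_eq0.
have := vgeP l0 ge; rewrite le_eqVlt => /orP[/eqP //|lt]; case: nle; right; lia.
Qed.
End AtInfinity.

Variables vP vF : F -> int.
Hypotheses (cP : center iota x z y vP a c b) (cF : center iota x z y vF a1 c1 b1).

Lemma l_neq0 : l != 0. Proof. by have [] := l_at_P cP. Qed.
Lemma vP_l : vP l = q. Proof. by have [] := l_at_P cP. Qed.
Lemma vF_l : vF l = 1. Proof. exact: l_at_FrP. Qed.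

Lemma P_neq_FrP : ~ same_place vF vP.
Proof. by move/(_ l l_neq0); rewrite vP_l vF_l; move: q1; lia. Qed.

Lemma place_l v : is_place iota v -> 0 <= v x ->
  [\/ same_place v vP, same_place v vF | v l = 0].
Proof.
move=> pv vx; have := vgeP l_neq0 (affine_regular cm pv vx (affine_form affine_l)).
rewrite le_eqVlt => /orP[/eqP <-|lt]; first by constructor 3.
have vl : vge v 1 l by right; lia.
have [h|h] := l_zeros pv vx vl.
  by constructor 1; exact: (center_same cm onC h cP).
by constructor 2; exact: (center_same cm FrP_on_curve h cF).
Qed.

(** [l] has order [q] at P, so up to order [q] a form may be replaced by its restriction to the
    nodal cubic, and there [rho] is a uniformizer. *)
Lemma dvdp_evE e n : (n <= q)%N ->
  vge vP n (ev iota x z y e) <-> ('X - r0%:P) ^+ n %| evE e.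
Proof.
move=> nq; have [pv _ _ _] := cP; have vx := center_x_ge0 cm cP.
have [w0 vw0] := local_w cP P_nodal r0_nodal.
have vl : vge vP q l by apply: vge_l_P.
have h2 : vge vP 2 l by apply: vge_le vl; move: q1; lia.
have [rn vr] := local_rho onC cP P_nodal r0_nodal b_neq0 h2.
have cg : vge vP n (ev iota x z y e - (map_poly iota (evE e)).[(iota A * x - iota B * y) / (1 - iota B * y)]).
  by apply: vge_le (congruence pv vx _ w0 vw0 vl e); lia.
split=> h.
  apply/(vge_dvdp pv rn vr); rewrite -[X in vge _ _ X](subKr (ev iota x z y e)).
  exact: (vgeB pv).
rewrite -(subrK (map_poly iota (evE e)).[(iota A * x - iota B * y) / (1 - iota B * y)] (ev _ _ _ _ e)).
by apply: (vgeD pv) => //; apply/(vge_dvdp pv rn vr).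
Qed.

Lemma evE_FrP e : vge vF 1 (ev iota x z y e) <-> (evE e).[r1] = 0.
Proof.
have [pv _ _ _] := cF; have [hu hw ht] := FrP_nodal.
have val : value_at iota x z y a1 c1 b1 (ev iota x z y e) (evE e).[r1].
  by exists e; rewrite // evE_horner -hu -hw -ht.
have h := center_value cF val; split=> h1.
  apply: (vge1_constP pv); rewrite -[X in vge _ _ X](subKr (ev iota x z y e)).
  exact: (vgeB pv).
by move: h; rewrite h1 rmorph0 subr0.
Qed.

(* [k / ('X - r0)] takes the same value at the two branches of the node, but a
   nonconstant function of degree one is injective. *)
Lemma node_cancel (u k : {poly K}) : (size k <= 2)%N -> u.[zeta] != 0 ->
  (u * k).[zeta] = (u * k).[zeta ^+ 2] ->
  (u * ('X - r0%:P)).[zeta] = (u * ('X - r0%:P)).[zeta ^+ 2] -> k.[r0] = 0.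
Proof.
move=> sk u0; rewrite !hornerM !hornerXsubC => e1 e2.
have [nz _] := not_node r0_nodal.
have zr0 : zeta - r0 != 0 by rewrite subr_eq0 eq_sym.
have u20 : u.[zeta ^+ 2] != 0.
  apply: contraNneq (mulf_neq0 u0 zr0) => e; by rewrite e2 e mul0r.
have kE s : k.[s] = k`_0 + k`_1 * s.
  by rewrite (horner_coef_wide _ sk) !big_ord_recl big_ord0 /= addr0 expr0 mulr1 expr1.
have : (u.[zeta] * u.[zeta ^+ 2]) * (k.[zeta] * (zeta ^+ 2 - r0) - k.[zeta ^+ 2] * (zeta - r0)) = 0.
  have -> : (u.[zeta] * u.[zeta ^+ 2]) * (k.[zeta] * (zeta ^+ 2 - r0) - k.[zeta ^+ 2] * (zeta - r0)) =
    (u.[zeta] * k.[zeta]) * (u.[zeta ^+ 2] * (zeta ^+ 2 - r0)) -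
    (u.[zeta ^+ 2] * k.[zeta ^+ 2]) * (u.[zeta] * (zeta - r0)) by ring.
  by rewrite e1 e2 subrr.
move/eqP; rewrite !mulf_eq0 (negPf u0) (negPf u20) /= => /eqP.
(* As [k] has degree at most one, this determinant is a multiple of [k.[r0]]. *)
have -> : k.[zeta] * (zeta ^+ 2 - r0) - k.[zeta ^+ 2] * (zeta - r0) =
  (zeta ^+ 2 - zeta) * k.[r0] by rewrite !kE; ring.
move/eqP; rewrite mulf_eq0 => /orP[/eqP e|/eqP //].
have zE : zeta = 1.
  have : zeta * (zeta - 1) = 0 by rewrite -e; ring.
  move/eqP; rewrite mulf_eq0 subr_eq0 => /orP[/eqP z0|/eqP //].
  by move: zeta3; rewrite z0 expr0n => /esym/eqP; rewrite oner_eq0.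
have /eqP := zeta_eq; rewrite zE expr1n.
by have /negPf := cm_3 cm; rewrite (_ : 3%:R = 1 + 1 + 1) => [->|]; last by ring.
Qed.

(* This plays the role of the residue theorem: restricted to the nodal cubic,
   [h] and [x ^+ m + z ^+ m + 1] differ by a factor [k / ('X - r0)]. *)
Lemma no_pole_one h : form m h -> h != 0 -> vP h = q%:Z - 1 -> vge vF 1 h -> False.
Proof.
move=> [e he ->] h0 vh /evE_FrP e1; set f := evE e in e1.
have q0 := ltnW q1.
have d1 : ('X - r0%:P) ^+ q.-1 %| f.
  by apply/dvdp_evE; [exact: leq_pred|right; rewrite vh; lia].
have d2 : ~ ('X - r0%:P) ^+ q %| f by move/(dvdp_evE _ (leqnn q))/(vgeP h0); rewrite vh; lia.
have [g fE] := dvdpP _ _ d1.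
have [k gE] : exists k, g = k * ('X - r1%:P).
  apply/factor_theorem; move: e1; rewrite fE hornerM horner_exp hornerXsubC => /eqP.
  rewrite mulf_eq0 expf_eq0 subr_eq0 [r1 == r0]eq_sym (negPf r01_neq) andbF orbF.
  by move/eqP/rootP.
have k0 : k != 0 by apply: contra_not_neq d2 => k0; rewrite fE gE k0 !mul0r dvdp0.
have Xn0 r n : ('X - r%:P) ^+ n != 0 :> {poly K} by rewrite expf_neq0 // polyXsubC_eq0.
(* The degree is at most [3m = q + 1], and [q] linear factors have been extracted. *)
have sk : (size k <= 2)%N.
  have := size_evE e; rewrite -/f fE gE !size_mul ?Xn0 ?mulf_neq0 ?polyXsubC_eq0 //.
  rewrite size_exp_XsubC size_XsubC.
  by move: he qm q0; move: (size k) (edeg e) => n d; lia.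
pose u := ('X - r0%:P) ^+ q.-1 * ('X - r1%:P).
have fu : f = u * k by rewrite fE gE /u; ring.
have [nz _] := not_node r0_nodal; have [nz1 _] := not_node r1_nodal.
have u0 : u.[zeta] != 0.
  rewrite hornerM horner_exp !hornerXsubC mulf_neq0 ?expf_neq0 // subr_eq0 eq_sym //.
have PhiN : Phi.[zeta] = Phi.[zeta ^+ 2].
  have := evE_node (Eadd (Eadd (epow Ex m) (epow Ez m)) (Ec 1)).
  by rewrite /evE /= !ev_epow.
have PhiE : Phi = ((r1 * (1 + r1))^-1)%:P * (u * ('X - r0%:P)).
  rewrite Phi_factor; congr (_ * _); rewrite /u mulrAC -exprSr prednK //.
have cN : (u * ('X - r0%:P)).[zeta] = (u * ('X - r0%:P)).[zeta ^+ 2].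
  move: PhiN; rewrite PhiE !(hornerM _%:P) !hornerC; apply: mulfI.
  by rewrite invr_eq0 mulf_neq0 ?r1_neq0 ?r1_neqN1.
(* [u * k] takes equal values at the two branches as the restriction of a form, [u * ('X - r0%:P)]
   as a constant multiple of [Phi]. *)
have kr : k.[r0] = 0 by apply: (node_cancel sk u0) cN; rewrite -fu; apply: evE_node.
have [k' kE] := factor_theorem _ _ (introT rootP kr).
by apply: d2; rewrite fE gE kE -(prednK q0) exprS prednK //; apply/dvdpP; exists (k' * ('X - r1%:P)); ring.
Qed.

Lemma form0_const f : form 0 f -> exists k, f = iota k.
Proof.
move=> [e]; rewrite leqn0 => /eqP; elim: e f => //= [k|e1 h1 e2 h2|e1 h1 e2 h2] f d ->.
- by exists k.
- have [d1 d2] : edeg e1 = 0%N /\ edeg e2 = 0%N by lia.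
  have [[k ->] [k' ->]] := (h1 _ d1 erefl, h2 _ d2 erefl).
  by exists (k + k'); rewrite rmorphD.
- have [d1 d2] : edeg e1 = 0%N /\ edeg e2 = 0%N by lia.
  have [[k ->] [k' ->]] := (h1 _ d1 erefl, h2 _ d2 erefl).
  by exists (k * k'); rewrite rmorphM.
Qed.

(** * Orders of forms, gaps and non-gaps *)

Variable N : nat.
Hypothesis N_order : forall d, (zeta - r0) ^+ (3 * d) = (zeta ^+ 2 - r0) ^+ (3 * d) <-> (N %| d)%N.

(* The orders at [P] of the forms of degree at most [D]; those of order at least
   [q] are divisible by [l], and [3 * d] replaces [3 * d - 1] exactly when
   [('X - r0) ^+ (3 * d)] takes the same value at both branches of the node. *)
Definition form_order (D n : nat) : Prop := exists d k, [/\ (d <= D)%N, n = ((D - d) * q + k)%N &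
  ((k < 3 * d)%N /\ ~ ((N %| d)%N /\ k.+1 = (3 * d)%N)) \/ (k = (3 * d)%N /\ (N %| d)%N)].

(** An order below [q] is the multiplicity at [r0] of the restriction to the nodal cubic. From [q]
    on, the restriction has too many roots for its degree, which is at most [3 * D < q], and is
    zero; then the form also vanishes at Fr(P), and its quotient by [l] is a form of degree one
    less. *)
Lemma order_of_form D h : (D < m)%N -> form D h -> h != 0 ->
  exists2 n : nat, vP h = n & form_order D n.
Proof.
have [pP _ _ _] := cP; have vxP := center_x_ge0 cm cP.
elim: D h => [|D IH] h Dm fh h0.
all: have [n vh] : exists n : nat, vP h = n
  by have := vgeP h0 (affine_regular cm pP vxP (affine_form fh)); exists `|vP h|%N; lia.
  exists n => //; have [k hE] := form0_const fh.
  have k0 : k != 0 by apply: contraNneq h0 => k0; rewrite hE k0 rmorph0.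
  exists 0%N, 0%N; split=> //; last by right.
  by apply/eqP; rewrite -eqz_nat -vh hE (place_const pP k0).
exists n => //; have [e he hE] := fh; set f := evE e.
have Xn0 r k : ('X - r%:P) ^+ k != 0 :> {poly K} by rewrite expf_neq0 // polyXsubC_eq0.
have sf : (size f <= (3 * D.+1).+1)%N.
  by apply: leq_trans (size_evE e) _; rewrite ltnS leq_mul2l.
have [lt|ge] := ltnP n q.
  have d1 : ('X - r0%:P) ^+ n %| f by apply/(dvdp_evE _ (ltnW lt)); rewrite -hE; right; rewrite vh.
  have d2 : ~ ('X - r0%:P) ^+ n.+1 %| f.
    by move/(dvdp_evE _ lt); rewrite -hE => /(vgeP h0); rewrite vh; lia.
  have [g fE] := dvdpP _ _ d1.
  have g0 : g != 0 by apply: contra_not_neq d2 => g0; rewrite fE g0 mul0r dvdp0.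
  have gr : g.[r0] != 0.
    apply: contra_not_neq d2 => gr; have [g' gE] := factor_theorem _ _ (introT rootP gr).
    by rewrite fE gE -mulrA -exprS dvdp_mulIr.
  have sg : (size g + n <= (3 * D.+1).+1)%N.
    by move: sf; rewrite fE size_mul ?Xn0 // size_exp_XsubC addnS.
  have sg0 : (0 < size g)%N by rewrite size_poly_gt0.
  have [nz nz2] := not_node r0_nodal.
  have u0 k : ('X - r0%:P) ^+ k != 0 /\ (('X - r0%:P) ^+ k).[zeta] != 0.
    by split=> //; rewrite horner_exp hornerXsubC expf_neq0 // subr_eq0 eq_sym.
  exists D.+1, n; split=> //; first by rewrite subnn mul0n.
  have [n3|n3] := eqVneq n (3 * D.+1)%N.
    right; split=> //; apply/N_order.
    have gC : g = (g`_0)%:P by apply: size1_polyC; move: sg n3; lia.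
    have := evE_node e; rewrite -/f fE gC !hornerM !hornerC !horner_exp !hornerXsubC n3.
    by apply: mulfI; apply: contraNneq gr => e0; rewrite gC hornerC e0.
  left; split; first by move: sg sg0 n3; lia.
  (* Order [3d - 1] leaves a cofactor of degree at most one; when [N] divides [d], [node_cancel]
     makes it vanish at [r0], which is excluded. *)
  move=> [Nd nE]; move/eqP: gr; apply.
  apply: (node_cancel (u := ('X - r0%:P) ^+ n) (k := g) _ (u0 n).2); first by move: sg nE; clear; move: (size g) => s1; lia.
    by rewrite mulrC -fE; apply: evE_node.
  by rewrite -exprSr nE !horner_exp !hornerXsubC; apply/N_order.
have d1 : ('X - r0%:P) ^+ q %| f by apply/(dvdp_evE _ (leqnn q)); rewrite -hE; right; rewrite vh; lia.
have f0 : f = 0.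
  apply/eqP; apply: contraTT d1 => f0; apply/negP => d1.
  have := dvdp_leq f0 d1; rewrite size_exp_XsubC.
  by move: sf Dm qm; clear; move: (size f) => s1; lia.
have hF : vge vF 1 h by rewrite hE; apply/evE_FrP; rewrite -/f f0 horner0.
have [pF _ _ _] := cF.
have l0 := l_neq0.
have hl : form D (h / l).
  apply: (form_of_bounds cm) => v pv vx; right; rewrite (placeM pv) ?invr_neq0 // (placeV pv) //.
    have [e1|e1|e1] := place_l pv vx.
    - by rewrite !e1 // vP_l vh; lia.
    - by rewrite !e1 // vF_l; have := vgeP h0 hF; lia.
    - by rewrite e1 subr0; apply: (vgeP h0); apply: (affine_regular cm pv vx (affine_form fh)).
  have := vgeP h0 (form_infinity pv vx fh); rewrite (l_infinity pv vx).
  by move: vx; move: (v h) (v x) => s t; nia.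
have [|n' vn [d [k [dD nE kE]]]] := IH _ (ltnW Dm) hl; first by rewrite mulf_neq0 ?invr_neq0.
exists d, k; split=> //; first exact: leqW.
move: vn; rewrite (placeM pP) ?invr_neq0 // (placeV pP) // vP_l vh nE => e1.
by have -> : (n = (D - d) * q + k + q)%N; [lia|rewrite subSn // mulSn; lia].
Qed.

(** [f * h * l] has order [- n.+1 + n + q = q - 1] at P, its poles at infinity are at most those of
    [h * l], a form of degree [m], and it vanishes at Fr(P); [no_pole_one] forbids this. *)
Lemma not_gap_and_form n f h : f != 0 -> h != 0 -> vP f = - n.+1%:Z ->
  (forall Q, is_place iota Q -> ~ same_place Q vP -> regular_at Q f) ->
  form m.-1 h -> vP h = n -> False.
Proof.
move=> f0 h0 vf reg fh vh; have l0 := l_neq0.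
have [pP _ _ _] := cP; have [pF _ _ _] := cF.
have vxP := center_x_ge0 cm cP.
have m0 := cm_m_gt0 cm.
have fhl0 : f * h * l != 0 by rewrite !mulf_neq0.
have vE v : is_place iota v -> v (f * h * l) = v f + v h + v l.
  by move=> pv; rewrite !(placeM pv) ?mulf_neq0.
have vPE : vP (f * h * l) = q%:Z - 1 by rewrite vE // vf vh vP_l; lia.
have fm : form m (f * h * l).
  apply: (form_of_bounds cm) => v pv vx; right.
    have [e|ne] := classic (same_place v vP).
      by rewrite e // vPE; move: q1; lia.
    rewrite vE //; have := vgeP f0 (reg v pv ne).
    have := vgeP h0 (affine_regular cm pv vx (affine_form fh)).
    by have := vgeP l0 (affine_regular cm pv vx (affine_form affine_l)); lia.
  have ne : ~ same_place v vP.
    have [x0 _ _] := cm_neq0 cm; move=> /(_ x x0) e; move: vx; rewrite e; lia.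
  rewrite vE //; have := vgeP f0 (reg v pv ne).
  have := vgeP h0 (form_infinity pv vx fh); rewrite (l_infinity pv vx).
  by move: m0 vx; move: (v f) (v h) (v x) (m) => s1 s2 t k; case: k => //= k; nia.
apply: (no_pole_one fm fhl0 vPE); right; rewrite vE // vF_l.
have := vgeP f0 (reg vF pF P_neq_FrP).
by have := vgeP h0 (affine_regular cm pF (center_x_ge0 cm cF) (affine_form fh)); lia.
Qed.

(** The function is [g / l ^+ k]: the zeros of [g] cancel the pole at Fr(P), the poles of [l ^+ k]
    balance those of [g] at infinity, and the pole order at P is [k * q - n]. *)
Lemma nongap_of_form k g : form k g -> g != 0 -> vge vF k g ->
  exists n : nat, [/\ vP g = n, (n <= k * q)%N & in_weierstrass iota vP (k * q - n)].
Proof.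
move=> fg g0 vg; have l0 := l_neq0.
have [pP _ _ _] := cP; have vxP := center_x_ge0 cm cP.
have lk0 : l ^+ k != 0 by rewrite expf_neq0.
have f0 : g / l ^+ k != 0 by rewrite mulf_neq0 ?invr_neq0.
have vE v : is_place iota v -> v (g / l ^+ k) = v g - k%:Z * v l.
  by move=> pv; rewrite (placeM pv) ?invr_neq0 // (placeV pv) // (placeX pv) // -[_ *+ k]mulr_natl natz.
have [n vn] : exists n : nat, vP g = n.
  by have := vgeP g0 (affine_regular cm pP vxP (affine_form fg)); exists `|vP g|%N; lia.
have fin v : is_place iota v -> 0 <= v x -> ~ same_place v vP -> 0 <= v (g / l ^+ k).
  move=> pv vx ne; rewrite vE //; have [//|e|e] := place_l pv vx.
    by rewrite !e // vF_l; have := vgeP g0 vg; lia.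
  by rewrite e mulr0 subr0; apply: (vgeP g0); apply: (affine_regular cm pv vx (affine_form fg)).
have inf v : is_place iota v -> v x < 0 -> 0 <= v (g / l ^+ k).
  move=> pv vx; rewrite vE // (l_infinity pv vx).
  by have := vgeP g0 (form_infinity pv vx fg); lia.
have vPE : vP (g / l ^+ k) = n%:Z - (k * q)%N%:Z by rewrite vE // vn vP_l; lia.
have le : (n <= k * q)%N.
  (* Otherwise the quotient would have no pole at all and be a nonzero constant, yet vanish at P. *)
  rewrite leqNgt; apply/negP => lt.
  have [|u uE] := @form0_const (g / l ^+ k).
    apply: (form_of_bounds cm) => v pv vx; right; last by rewrite mul0r inf.
    have [e|ne] := classic (same_place v vP); last exact: fin.
    by rewrite e // vPE; lia.
  have u0 : u != 0 by apply: contraNneq f0 => u0; rewrite uE u0 rmorph0.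
  by move: vPE; rewrite uE (place_const pP u0); lia.
exists n; split=> //; exists (g / l ^+ k); split=> //; split.
  by rewrite vPE; move: le; move: (k * q)%N => t; lia.
move=> v pv ne; right; have [vx|vx] := ltP (v x) 0; [exact: inf|exact: fin].
Qed.

Lemma residual_same v w : same_place v w -> residual iota w -> residual iota v.
Proof.
move=> e rw f g f0 g0 vfg; have wfg : w f = w g by rewrite -!e.
have [k hk] := rw _ _ f0 g0 wfg; exists k.
case: hk => [->|h]; first by left.
by have [->|d0] := eqVneq (f - iota k * g) 0; [left|right; rewrite !e].
Qed.

Lemma center_residual v u w t : on_curve m u w t -> center iota x z y v u w t -> residual iota v.
Proof.
move=> hQ hv; have [v' [_ rv' _ _ h]] := point_place cm hQ.
exact: residual_same (h _ hv) rv'.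
Qed.

Lemma lspan_form k s f : (forall g, g \in s -> form k g) -> lspan iota s f -> form k f.
Proof.
by move=> hs; apply: lspan_closed => //; [exact: dform0|exact: dformD|move=> *; apply: dformZ].
Qed.

Lemma echelon_forms k v u w t : on_curve m u w t -> center iota x z y v u w t ->
  exists s, [/\ size s = size (exponents m k), forall f, f \in s -> f != 0 /\ form k f
    & uniq (map v s)].
Proof.
move=> hQ hv; have [pv _ _ _] := hv.
have ind : indep iota (map (monom x z y) (exponents m k)).
  apply: (monom_indep cm); first exact: exponents_uniq.
  by move=> e /mem_exponents[-> -> _].
have [s [sz s0 us ss]] := echelon (center_residual hQ hv) ind.
exists s; split=> //; first by rewrite sz size_map.
move=> f fs; split; first exact: (allP s0 _ fs).
apply: lspan_form (ss _ fs) => g /mapP[e eL ->].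
exact: form_monom eL.
Qed.

(** A list containing every [form_order m.-1]. Whether or not [N] divides [d], a degree [d > 0]
    contributes [3d] entries, so the length does not depend on [N]. *)
Definition order_list : seq nat := flatten [seq [seq ((m.-1 - d) * q + k)%N |
  k <- if (d == 0)%N then [:: 0%N] else
       if (N %| d)%N then rcons (seq.iota 0 (3 * d).-1) (3 * d)%N else seq.iota 0 (3 * d)] | d <- seq.iota 0 m].

Lemma mem_order_list n : form_order m.-1 n -> n \in order_list.
Proof.
have m0 := cm_m_gt0 cm.
move=> [d [k [dm -> kE]]]; apply/flatten_mapP; exists d; first by rewrite mem_iota; lia.
apply/map_f; case: eqP => [d0|d0].
  by move: kE; rewrite d0 inE; case=> -[] //= ->.
case: kE => [[lt no]|[-> Nd]]; last by rewrite Nd mem_rcons mem_head.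
case: ifP => Nd; last by rewrite mem_iota.
by rewrite mem_rcons inE mem_iota; apply/orP; right; move: no; rewrite Nd => no; lia.
Qed.

Lemma size_order_list : (2 * size order_list = 3 * (m * m.-1) + 2)%N.
Proof.
have m0 := cm_m_gt0 cm.
have sE : size order_list = (\sum_(0 <= d < m) (if d == 0 then 1 else 3 * d))%N.
  rewrite /order_list size_flatten /shape -map_comp sumnE big_map /index_iota subn0.
  apply: eq_bigr => d _ /=; rewrite size_map; case: eqP => // d0.
  by case: ifP; rewrite ?size_rcons size_iota //; lia.
rewrite sE; elim: (m) m0 => // -[|j] IH _; first by rewrite big_nat1.
by rewrite big_nat_recr //=; have := IH isT; rewrite mulnDr => /= ->; lia.
Qed.

Lemma uniq_absz (S : seq int) : uniq S -> {in S, forall j, 0 <= j} -> uniq (map absz S).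
Proof.
move=> uS S0; rewrite map_inj_in_uniq // => j k jS kS e.
by rewrite -[j]gez0_abs ?S0 // -[k]gez0_abs ?S0 // e.
Qed.

(* The gaps coming from forms of degree [m - 1] and the non-gaps [k q - ord_P g],
   for [g] of degree [k] vanishing to order [k] at the Frobenius image of [P],
   already exhaust [0 .. k q]. *)
Theorem weierstrass_dichotomy (m1 : (1 < m)%N) n :
  in_weierstrass iota vP n <-> ~ ((0 < n)%N /\ form_order m.-1 n.-1).
Proof.
have m0 := cm_m_gt0 cm.
have [pP _ _ _] := cP; have vxP := center_x_ge0 cm cP.
have [pF _ _ _] := cF; have vxF := center_x_ge0 cm cF.
have [s [ss sf us]] := echelon_forms m.-1 onC cP.
have so f : f \in s -> exists2 k : nat, vP f = k & form_order m.-1 k.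
  by move=> /sf[f0 ff]; apply: order_of_form => //; rewrite prednK.
pose O := map absz (map vP s).
have uO : uniq O.
  by apply: uniq_absz => // j /mapP[f /so[k -> _] ->].
have O_order k : k \in O -> exists2 f, f \in s & vP f = k.
  by move=> /mapP[j /mapP[f fs ->] ->]; exists f => //; have [k' -> _] := so f fs.
have sO : size O = size (exponents m m.-1) by rewrite !size_map.
(* With [2g = 3m(m - 1) + 2], the [g] distinct orders in [O] occur in [order_list], which has [g]
   entries; hence no entry is missed. *)
have OE k : form_order m.-1 k -> k \in O.
  have sub : {subset O <= order_list}.
    by move=> j /O_order[f /so[j' -> h] [<-]]; apply: mem_order_list.
  have le : (size order_list <= size O)%N.
    rewrite sO; have := size_exponents_pred m1; have := size_order_list.
    by move: (size order_list) (size (exponents _ _)) (m * m.-1)%N => ? ? ?; lia.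
  by have [_ ->] := uniq_min_size uO sub le; apply: mem_order_list.
have gap k : k \in O -> ~ in_weierstrass iota vP k.+1.
  move=> /O_order[h hs vh] [f [f0 [vf reg]]]; have [h0 fh] := sf h hs.
  exact: not_gap_and_form f0 h0 vf reg fh vh.
split=> [hn [n0 /OE/gap]|no]; first by rewrite prednK.
(* [k >= m] is the range of [size_exponents_ge], and [k * q >= n] makes the interval below contain
   [n]. *)
pose k := (m + n)%N.
have [s1 [ss1 sf1 us1]] := echelon_forms k FrP_on_curve cF.
pose s2 := [seq f <- s1 | k%:Z <= vF f].
have nat1 : {in map vF s1, forall j, 0 <= j}.
  move=> j /mapP[f /sf1[f0 ff] ->].
  exact: (vgeP f0 (affine_regular cm pF vxF (affine_form ff))).
(* Vanishing to order [k] at Fr(P) costs at most [k] dimensions: the discarded elements have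
   distinct orders in [0 .. k - 1]. *)
have ss2 : (size (exponents m k) <= size s2 + k)%N.
  pose ge f := k%:Z <= vF f.
  have -> : size (exponents m k) = (size s2 + count (predC ge) s1)%N.
    by rewrite /s2 size_filter count_predC.
  rewrite leq_add2l -size_filter.
  rewrite -[X in (_ <= X)%N](size_iota 0) -(size_map (fun f => `|vF f|%N)).
  apply: uniq_leq_size => [|j /mapP[f]].
    rewrite map_comp; apply: uniq_absz.
      by apply: (subseq_uniq _ us1); apply: map_subseq; apply: filter_subseq.
    move=> j /mapP[f]; rewrite mem_filter => /andP[_ fs1] ->.
    by apply: nat1; apply: map_f.
  rewrite mem_filter => /andP[/= lt fs1] ->; rewrite mem_iota /=.
  by have := nat1 _ (map_f vF fs1); move: lt; rewrite /ge -ltNge; move: (vF f) => t; lia.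
have ind2 : indep iota s2.
  apply: (indep_vals pF).
    by apply/allP => f; rewrite mem_filter => /andP[_ /sf1[]].
  by apply: (subseq_uniq _ us1); apply: map_subseq; apply: filter_subseq.
have [s3 [ss3 s30 us3 sp3]] := echelon (center_residual onC cP) ind2.
have s3P f : f \in s3 -> exists j : nat,
    [/\ vP f = j, (j <= k * q)%N & in_weierstrass iota vP (k * q - j)].
  move=> fs; apply: nongap_of_form.
  - apply: lspan_form (sp3 _ fs) => g; rewrite mem_filter => /andP[_ /sf1[_ //]].
  - exact: (allP s30 _ fs).
  - apply: (lspan_closed (W := vge vF k)) (sp3 _ fs).
    + by left.
    + by move=> f1 f2; apply: (vgeD pF).
    + by move=> c' f1; apply: (vgeMl pF); apply: vge_const.
    + by move=> g; rewrite mem_filter => /andP[h _]; right.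
pose NG := [seq (k * q - j)%N | j <- map absz (map vP s3)].
have s3le j : j \in map absz (map vP s3) -> (j <= k * q)%N /\ in_weierstrass iota vP (k * q - j).
  by move=> /mapP[j1 /mapP[f /s3P[j2 [-> h1 h2]] ->] ->].
have uNG : uniq NG.
  rewrite map_inj_in_uniq; first by apply: uniq_absz => // j /mapP[f /s3P[j2 [-> _ _]] ->].
  by move=> j1 j2 /s3le[h1 _] /s3le[h2 _]; lia.
have NGw j : j \in NG -> (j <= k * q)%N /\ in_weierstrass iota vP j.
  by move=> /mapP[j1 /s3le[h1 h2] ->]; split=> //; apply: leq_subr.
have O_le j : j \in O -> (j.+1 <= k * q)%N.
  move=> /O_order[f /so[j' -> [d [t [dm -> h]]] [<-]]].
  have ht : (t <= 3 * d)%N by case: h => -[]; lia.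
  have : ((m.-1 - d) * q + t <= m.-1 * q)%N.
    rewrite -[X in (_ <= X * q)%N](subnK dm) mulnDl leq_add2l.
    by apply: leq_trans ht _; rewrite mulnC leq_mul2l; move: dm qm; lia.
  move=> h1; apply: leq_ltn_trans h1 _; rewrite ltn_mul2r /k; move: q1 m0; lia.
have disj : ~~ has (mem NG) (map succn O).
  by apply/hasPn => j /mapP[j' /gap h ->]; apply/negP => /NGw[_ /h].
have uall : uniq (map succn O ++ NG).
  rewrite cat_uniq uNG andbT map_inj_uniq ?uO //=; last by move=> ? ? [].
  by apply: contra disj => /hasP[j jN jO]; apply/hasP; exists j.
have sub : {subset map succn O ++ NG <= seq.iota 0 (k * q).+1}.
  move=> j; rewrite mem_cat mem_iota /= add0n ltnS => /orP[/mapP[j' /O_le h ->] //|/NGw[]//].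
(* [g] gaps and at least [k q + 1 - g] non-gaps fill [0 .. k q]. *)
have le : (size (seq.iota 0 (k * q).+1) <= size (map succn O ++ NG))%N.
  rewrite size_iota size_cat !size_map ss3 -(size_map vP s) -(size_map absz) sO.
  have mk : (0 < m <= k)%N by rewrite m0 leq_addr.
  have h1 := size_exponents_ge mk; have h2 := size_exponents_pred m1.
  have h3 : (k * q + k = 3 * (m * k))%N by rewrite addnC -mulnS qm mulnCA [(k * m)%N]mulnC.
  move: h1 h2 h3 ss2; move: (size (exponents m k)) (size (exponents m m.-1)) (size s2) (m * k)%N.
  by move: (m * m.-1)%N (k * q)%N; clear; lia.
have [_ hE] := uniq_min_size uall sub le.
have : n \in map succn O ++ NG.
  rewrite hE mem_iota /= add0n ltnS; apply: (@leq_trans k); first exact: leq_addl.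
  by rewrite leq_pmulr // ltnW.
rewrite mem_cat => /orP[/mapP[j jO nE]|/NGw[] //].
case: no; rewrite nE; split=> //=.
by have [f /so[j' -> h] [<-]] := O_order _ jO.
Qed.

(** Up to cube roots of unity and the common factor [1 / (1 + r0)], [alpha + zeta] and
    [alpha + zeta ^+ 2] are [zeta ^+ 2 - r0] and [zeta - r0]. So [calP] of index [j] vanishes
    exactly when [rho ^+ j = 1], and the P-order [i] says that [rho] has multiplicative order
    [i.+1]. *)
Lemma order_nodal i : P_order zeta (alphaP m a) i ->
  forall d, (zeta - r0) ^+ (3 * d) = (zeta ^+ 2 - r0) ^+ (3 * d) <-> (i.+1 %| d)%N.
Proof.
move=> [i0 Pi Pj] d.
have r00 := r0_neq0; have r0N := r0_neqN1; have [nz nz2] := not_node r0_nodal.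
have al : alphaP m a = r0 / (1 + r0) by rewrite /alphaP r0E.
have zz : zeta - zeta ^+ 2 != 0.
  apply/eqP => e; have : zeta ^+ 2 = 1.
    have : zeta ^+ 2 * (zeta - zeta ^+ 2) = 0 by rewrite e mulr0.
    have -> : zeta ^+ 2 * (zeta - zeta ^+ 2) = zeta ^+ 3 - zeta ^+ 3 * zeta by ring.
    rewrite zeta3 mul1r => /eqP; rewrite subr_eq0 => /eqP <-; exact: expr1n.
  move=> z2; have z1 : zeta = 1 by apply/eqP; rewrite -subr_eq0 -z2 e.
  have /eqP := zeta_eq; rewrite z1 expr1n.
  by have /negPf := cm_3 cm; rewrite (_ : 3%:R = 1 + 1 + 1) => [->|]; last by ring.
have e1 : (alphaP m a + zeta) ^+ 3 = (zeta ^+ 2 - r0) ^+ 3 / (1 + r0) ^+ 3.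
  have -> : alphaP m a + zeta = zeta ^+ 2 * (zeta ^+ 2 - r0) / (1 + r0).
    have -> : zeta ^+ 2 * (zeta ^+ 2 - r0) = zeta ^+ 3 * zeta - zeta ^+ 2 * r0 by ring.
    by rewrite zeta3 zeta2 al; field.
  by rewrite exprMn exprVn exprMn -!exprM mulnC exprM zeta3 expr1n mul1r.
have e2 : (alphaP m a + zeta ^+ 2) ^+ 3 = (zeta - r0) ^+ 3 / (1 + r0) ^+ 3.
  have -> : alphaP m a + zeta ^+ 2 = zeta * (zeta - r0) / (1 + r0).
    have -> : zeta * (zeta - r0) = zeta ^+ 2 - zeta * r0 by ring.
    by rewrite zeta2 al; field.
  by rewrite exprMn exprVn exprMn zeta3 mul1r.
pose E j := (zeta - r0) ^+ (3 * j) == (zeta ^+ 2 - r0) ^+ (3 * j).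
have EP j : (calP zeta j (alphaP m a) == 0) = E j.
  have al0 : alphaP m a != 0 by rewrite al mulf_neq0 ?invr_neq0.
  have al1 : alphaP m a - 1 != 0.
    have -> : alphaP m a - 1 = - (1 + r0)^-1 by rewrite al; field.
    by rewrite oppr_eq0 invr_eq0.
  rewrite /calP mulf_eq0 invr_eq0 [X in _ || X]negbTE; last first.
    by do 3?apply: mulf_neq0 => //; exact: (cm_3 cm).
  rewrite !orbF !exprM e1 e2 subr_eq0 !expr_div_n /E !exprM.
  rewrite (inj_eq (mulIf _)) ?invr_eq0 ?expf_neq0 //; exact: eq_sym.
pose rho := ((zeta - r0) / (zeta ^+ 2 - r0)) ^+ 3.
have z2r : zeta ^+ 2 - r0 != 0 by rewrite subr_eq0 eq_sym.
have Erho j : E j = (rho ^+ j == 1).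
  rewrite /E /rho -exprM expr_div_n.
  by rewrite -(inj_eq (mulIf (expf_neq0 (3 * j) z2r)) (_ / _)) divfK ?expf_neq0 // mul1r.
(* [P_order] tests the exponents from 2 on, so exponent 1 is excluded separately. *)
have E1 : rho != 1.
  rewrite -[rho]expr1 -Erho /E !muln1 -subr_eq0.
  have -> : (zeta - r0) ^+ 3 - (zeta ^+ 2 - r0) ^+ 3 =
    zeta ^+ 3 - zeta ^+ 3 ^+ 2 + 3%:R * r0 * (zeta * r0 - zeta ^+ 2 * r0 + zeta ^+ 3 * zeta - zeta ^+ 2) by ring.
  rewrite zeta3 expr1n subrr add0r mul1r.
  have -> : zeta * r0 - zeta ^+ 2 * r0 + zeta - zeta ^+ 2 = (zeta - zeta ^+ 2) * (1 + r0) by ring.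
  by rewrite !mulf_neq0 // (cm_3 cm).
have rN : rho ^+ i.+1 = 1 by apply/eqP; rewrite -Erho -EP Pi.
apply: (@iff_trans _ (E d)); first by split=> /eqP.
rewrite Erho {1}(divn_eq d i.+1).
split; last first.
  by rewrite -divn_eq => /dvdnP[t ->]; rewrite mulnC exprM rN expr1n.
rewrite exprD mulnC exprM rN expr1n mul1r /dvdn => h.
have := ltn_pmod d (ltn0Sn i); case: (d %% i.+1)%N h => [|[|t]] // h lt.
  by rewrite expr1 (negPf E1) in h.
by have := Pj t.+1 lt; rewrite EP Erho h.
Qed.
End Tangent.

(** * The gap set *)

Section GapArithmetic.
Variables (q m i : nat).
Hypotheses (qm : q.+1 = (3 * m)%N) (im : (i <= m - 2)%N) (i0 : (0 < i)%N).

Lemma mod_unique c c' k k' : (k < q)%N -> (k' < q)%N ->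
  (c * q + k = c' * q + k')%N -> c = c' /\ k = k'.
Proof.
move=> lk lk' e; have := congr1 (modn^~ q) e; rewrite !modnMDl !modn_small // => ek.
split=> //; move: e; rewrite ek => /eqP; rewrite eqn_add2r eqn_mul2r.
by case/orP => /eqP // q0; rewrite q0 in lk.
Qed.

(** [d = (l + 1) * (i + 1)] runs over the positive multiples of [i + 1] up to [m - 1], the degrees
    in which order [3d] occurs. *)
Lemma SsetP n : Sset q m i n <->
  exists2 d, (0 < d <= m.-1)%N /\ (i.+1 %| d)%N & n = ((m.-1 - d) * q + 3 * d)%N.
Proof.
split.
  move=> [l [hl ->]]; exists (l.+1 * i.+1)%N; last first.
    by rewrite !addn1; congr (_ * _ + _)%N; [lia|rewrite mulnSr; lia].
  split; last exact: dvdn_mull.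
  move: hl; rewrite addn1 leq_divRL // => hl; rewrite muln_gt0 /=.
  by rewrite mulSn; lia.
move=> [d [/andP[d0 dm] /dvdnP[l dE]] ->]; case: l dE => [|l] dE; first by rewrite dE in d0.
have hd : d = (i.+1 + l * i.+1)%N by rewrite dE mulSn.
exists l; rewrite !addn1 leq_divRL //; split; first by lia.
have -> : (l.+1 * (3 * i + 3) = 3 * d)%N by rewrite dE addnC -mulnS mulnCA.
by congr (_ * _ + _)%N; lia.
Qed.

(** With [d = m - 1 - j] one has [q - 3j - 2 = 3d]: these are the orders [0 .. 3d - 1] shifted by
    [j q] and raised by one. The isolated gap [(m - 1) q + 1] is [d = 0]. *)
Lemma GgenP n : Ggen q m n <-> exists d k,
  [/\ (d <= m.-1)%N, n = ((m.-1 - d) * q + k).+1 & (k < 3 * d)%N \/ (d = 0%N /\ k = 0%N)].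
Proof.
split.
  move=> [[j [k [jm kq ->]]]|->].
    exists (m.-1 - j)%N, k.-1; split; [by lia| |by left; lia].
    have -> : (m.-1 - (m.-1 - j) = j)%N by lia.
    by rewrite -addnS prednK //; lia.
  by exists 0%N, 0%N; split=> //; [rewrite subn0 addn0 addn1 subn1|right].
move=> [d [k [dm -> [lt|[-> ->]]]]]; [left|right].
  by exists (m.-1 - d)%N, k.+1; split; [lia|lia|rewrite addnS].
by rewrite subn0 addn0 addn1 subn1.
Qed.

(** In the block [j q + 1 .. (j + 1) q] the gaps are the first [q - 3j - 2] integers, and
    [(j + 1)(q - 3) + 2 = j q + (q - 3j - 1)] starts the remaining [3j + 2]. *)
Lemma HgenP n : Hgen q m n <-> ~ Ggen q m n.
Proof.
have q0 : (0 < q)%N by lia.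
have mul_sub3 j : ((j + 1) * (q - 3) = j * q + q - 3 * j - 3)%N.
  have [t ->] : exists t, q = (t + 3)%N by exists (q - 3)%N; lia.
  by rewrite addnK; lia.
split.
  move=> H G; move: G H => /GgenP[d [k [dm nE hk]]].
  case=> [n0|[[j [k' [jm kj nE']]]|le]]; first by rewrite n0 in nE.
    have e : ((m.-1 - d) * q + k = j * q + (q - 3 * j - 2 + k'))%N.
      apply: succn_inj; rewrite -nE nE'.
      rewrite mul_sub3.
      have : (3 * j + 3 <= q)%N by lia.
      by move: (j * q)%N => t; lia.
    have [e1 e2] := mod_unique (c := (m.-1 - d)%N) (c' := j) (k := k) (k' := (q - 3 * j - 2 + k')%N)
      ltac:(lia) ltac:(lia) e.
    by move: e1 e2 hk; lia.
  have : ((m.-1 - d) * q + 3 * d <= m.-1 * q)%N.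
    rewrite -[X in (_ <= X * q)%N](subnK dm) mulnDl leq_add2l.
    by rewrite mulnC leq_mul2l; apply/orP; right; lia.
  have : ((m - 1) * q = m.-1 * q)%N by rewrite subn1.
  by move: le hk nE; move: ((m.-1 - d) * q)%N ((m - 1) * q)%N (m.-1 * q)%N => t1 t2 t3; lia.
move=> G; case: n G => [|n] G; first by left.
right; case: (leqP ((m - 1) * q + 2) n.+1) => [h|lt]; [by right|left].
(* [n] is now the predecessor of the integer under study, so division by [q] yields the blocks
   [j q + 1 .. (j + 1) q]. *)
pose j := (n %/ q)%N; pose k := (n %% q)%N.
have nE : n = (j * q + k)%N by apply: divn_eq.
have kq : (k < q)%N by rewrite ltn_mod.
have jm : (j <= m - 2)%N.
  rewrite leqNgt; apply/negP => jm; apply: G; right.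
  have h1 : ((m - 1) * q <= j * q)%N by rewrite leq_mul2r; apply/orP; right; lia.
  by move: lt nE h1; move: (j * q)%N ((m - 1) * q)%N => t1 t2; lia.
have kge : (q - 3 * j - 2 <= k)%N.
  rewrite leqNgt; apply/negP => h; apply: G; left; exists j, k.+1; split=> //; lia.
exists j, (k - (q - 3 * j - 2))%N; split=> //; first by lia.
by rewrite mul_sub3 nE; move: kge jm; move: (j * q)%N => t; lia.
Qed.

(** A gap is an order raised by one: the missing order [3d - 1] removes an element of [S], and its
    replacement [3d] adds the successor of that element. *)
Lemma gap_setE n : ((0 < n)%N /\ form_order q i.+1 m.-1 n.-1) <->
  (Ggen q m n /\ ~ Sset q m i n) \/ (Sset q m i n.-1 /\ (0 < n)%N).
Proof.
split.
  case: n => [[]//|n] [_ /= [d [k [dm nE hk]]]].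
  case: hk => [[lt no]|[kE Nd]].
    left; split; first by apply/GgenP; exists d, k; split=> //; [rewrite nE|left].
    move/SsetP => [d' [/andP[d'0 d'm] Nd'] nE'].
    have e : ((m.-1 - d) * q + k.+1 = (m.-1 - d') * q + 3 * d')%N by rewrite -nE' nE addnS.
    have [e1 e2] := mod_unique (k := k.+1) (k' := (3 * d')%N) ltac:(lia) ltac:(lia) e.
    by apply: no; have -> : d = d' by lia.
  (* For [d = 0] the order [3d] is the generic gap [(m - 1) q + 1], not an element of [S + 1]. *)
  have [d0|d0] := eqVneq d 0%N.
    left; split; first by apply/GgenP; exists 0%N, 0%N; split=> //; [rewrite nE kE d0|right].
    move/SsetP => [d' [/andP[d'0 d'm] Nd'] nE'].
    have e : ((m.-1 - d) * q + 1 = (m.-1 - d') * q + 3 * d')%N by rewrite -nE' nE kE d0 muln0 addn0 addn1.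
    by have [e1 e2] := mod_unique (k := 1%N) (k' := (3 * d')%N) ltac:(lia) ltac:(lia) e; lia.
  right; split=> //; apply/SsetP; exists d; last by rewrite nE kE.
  by rewrite lt0n d0 dm.
case=> [[/GgenP[d [k [dm -> hk]]] nS]|[/SsetP[d [/andP[d0 dm] Nd] nE] n0]].
  split=> //=; exists d, k; split=> //; case: hk => [lt|[d0 k0]]; last first.
    by right; rewrite k0 d0 dvdn0.
  left; split=> // -[Nd kE]; apply: nS; apply/SsetP; exists d; last by rewrite -kE addnS.
  by split=> //; lia.
by split=> //; exists d, (3 * d)%N; split=> //; right.
Qed.

(** Disjointness of [S] and [S + 1]: without it an element of [S] could return as a gap. *)
Lemma Sset_succ n : Sset q m i n -> ~ (Sset q m i n.-1 /\ (0 < n)%N).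
Proof.
move/SsetP => [d [/andP[d0 dm] Nd] nE] [/SsetP[d' [/andP[d'0 d'm] Nd'] nE'] n0].
have e : ((m.-1 - d) * q + 3 * d = (m.-1 - d') * q + (3 * d').+1)%N.
  by rewrite -nE addnS -nE' prednK.
by have [e1 e2] := mod_unique (k := (3 * d)%N) (k' := (3 * d').+1) ltac:(lia) ltac:(lia) e; lia.
Qed.
End GapArithmetic.

(** * From the plane equation to the curve model *)

Lemma fermat_of_curve (R : fieldType) (m : nat) (x y : R) : x != 0 ->
  y ^+ (3 * m) + x ^+ (2 * m) + x ^+ m = 0 -> x ^+ m + (y ^+ 3 / x) ^+ m + 1 = 0.
Proof.
move=> x0; rewrite !exprM => e; have xm0 : x ^+ m != 0 by rewrite expf_neq0.
apply: (mulfI xm0); rewrite mulr0 -e exprMn exprVn [(x ^+ 2) ^+ m]exprAC.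
by field.
Qed.

Theorem theorem5p2 (p e q m : nat) (K : closedFieldType) (F : fieldType)
  (iota : {rmorphism K -> F}) (x y : F) (zeta : K)
  (vP : F -> int) (a b : K) (i : nat) :
  prime p -> (0 < e)%N -> q = (p ^ e)%N -> (q %% 3 = 2)%N -> m = ((q + 1) %/ 3)%N ->
  (* K is an algebraic closure of F_p (hence of F_{q^2}) *)
  p \in [pchar K] -> (forall c : K, exists k, (0 < k)%N /\ c ^+ (p ^ k) = c) ->
  (* F = K(x,y) is the function field of y^(q+1) + x^(2m) + x^m = 0 *)
  (forall P : {poly K}, P != 0 -> (map_poly iota P).[x] != 0) ->
  (forall f : F, exists P Q : {poly {poly K}},
      eval2 iota Q x y != 0 /\ f = eval2 iota P x y / eval2 iota Q x y) ->
  y ^+ (q + 1) + x ^+ (2 * m) + x ^+ m = 0 ->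
  3.-primitive_root zeta ->
  (* P = P_(a,b), a <> 0, not F_{q^2}-rational *)
  is_place iota vP -> a != 0 ->
  (0 < vP (x - iota a))%R -> (0 < vP (y - iota b))%R ->
  ~ (a ^+ (q ^ 2) = a /\ b ^+ (q ^ 2) = b) ->
  P_order zeta (alphaP m a) i -> (i <= m - 2)%N ->
  forall n : nat,
    (is_gap iota vP n <-> (Ggen q m n /\ ~ Sset q m i n) \/ Sset q m i n.-1 /\ (0 < n)%N)
    /\
    (in_weierstrass iota vP n <->
       (Hgen q m n /\ ~ (Sset q m i n.-1 /\ (0 < n)%N)) \/ Sset q m i n).
Proof.
move=> pp e0 qE q3 mE chK _ transc gen curve prim pv a0 va vb irr Po im n.
have qm : q.+1 = (3 * m)%N by rewrite mE; lia.
have i0 : (0 < i)%N by case: Po.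
have q1 : (1 < q)%N by lia.
have frob (R : comNzRingType) : p \in [pchar R] ->
    forall u w : R, (u + w) ^+ q = u ^+ q + w ^+ q.
  by move=> chR u w; apply: exprDn_pchar; rewrite qE pnatX pnatE // chR.
have frobK := frob K chK.
have frobF := frob F (rmorph_pchar iota chK).
have frobP : forall u w : {poly K}, (u + w) ^+ q = u ^+ q + w ^+ q.
  by apply: frob; rewrite pchar_poly.
(* [3m = q + 1], and [q] vanishes in [K], so [3] and [m] are both invertible. *)
have m3K : 3%:R * m%:R = 1 :> K.
  rewrite -natrM -qm -natr1 qE natrX (pcharf0 chK) expr0n gtn_eqF //=.
  by rewrite add0r.
have [K3 Km] : 3%:R != 0 :> K /\ m%:R != 0 :> K.
  by apply/andP; rewrite -negb_or -mulf_eq0 m3K oner_eq0.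
have x0 : x != 0.
  by have := transc _ (negbT (polyX_eq0 K)); rewrite map_polyX hornerX.
pose z := y ^+ 3 / x.
have affine_eval2 P : affine iota x z y (eval2 iota P x y).
  by apply: affine_sum => j _; affine_closed.
have cm : curve_model iota m x z y.
  split=> //.
  - by apply: fermat_of_curve => //; rewrite -qm -addn1.
  - by rewrite /z mulrC divfK.
  - move=> f; have [P [Q [Q0 fE]]] := gen f.
    by exists (eval2 iota P x y), (eval2 iota Q x y).
have zeta3 := prim_expr_order prim.
have zeta1 : zeta != 1.
  by have := prim_order_dvd prim 1; rewrite expr1 => /esym/negbT.
have zeta_eq : zeta ^+ 2 + zeta + 1 = 0.
  apply: (mulfI (x := zeta - 1)); first by rewrite subr_eq0.
  have -> : (zeta - 1) * (zeta ^+ 2 + zeta + 1) = zeta ^+ 3 - 1 by ring.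
  by rewrite zeta3 subrr mulr0.
have hx : vge vP 1 (x - iota a) by right; lia.
have hy : vge vP 1 (y - iota b) by right; lia.
have vge0_of u k : vge vP 1 (u - iota k) -> vge vP 0 u.
  move=> h; rewrite -(subrK (iota k) u); apply: (vgeD pv); last exact: vge_const.
  exact: vge_le h.
have powB u k j : vge vP 1 (u - iota k) -> vge vP 1 (u ^+ j - iota (k ^+ j)).
  move=> h; rewrite rmorphXn subrXX; apply: (vgeMr pv) => //; apply: (vge_sum pv) => t _.
  by apply: (vgeMl pv); apply: (vge0X pv); [exact: vge0_of h|exact: vge_const].
(* The left-hand side is a constant of positive order at P, because the equation holds in [F]. *)
have curve_ab : b ^+ (3 * m) + a ^+ (2 * m) + a ^+ m = 0.
  apply: (vge1_constP pv); rewrite -qm -addn1.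
  have -> : iota (b ^+ (q + 1) + a ^+ (2 * m) + a ^+ m) =
      (y ^+ (q + 1) + x ^+ (2 * m) + x ^+ m) - ((y ^+ (q + 1) - iota (b ^+ (q + 1))) +
      (x ^+ (2 * m) - iota (a ^+ (2 * m))) + (x ^+ m - iota (a ^+ m))).
    by rewrite !rmorphD; ring.
  rewrite curve sub0r; apply: (vgeN pv).
  by apply: (vgeD pv); [apply: (vgeD pv)|]; apply: powB.
pose c := b ^+ 3 / a.
have onC : on_curve m a c b.
  by split; [exact: fermat_of_curve|rewrite /c mulrC divfK].
have [_ vx] := place_unit pv a0 hx.
have hz : vge vP 1 (z - iota c).
  have -> : z - iota c = ((y ^+ 3 - iota (b ^+ 3)) - iota c * (x - iota a)) / x.
    by rewrite /z /c fmorph_div; field; rewrite x0 fmorph_eq0.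
  apply: (vgeMr pv); last by right; rewrite (placeV pv) // vx.
  apply: (vgeB pv); first exact: powB.
  by apply: (vgeMl pv) => //; apply: vge_const.
have cP : center iota x z y vP a c b by [].
(* Only a place over P is given; the one over Fr(P) is constructed here. *)
have [vF [cF _ _ _ _]] := point_place cm (FrP_on_curve q1 frobK onC).
have N_order := order_nodal cm qm q1 frobK zeta_eq onC a0 irr erefl erefl erefl Po.
have m1 : (1 < m)%N by lia.
have W : in_weierstrass iota vP n <->
    ~ ((Ggen q m n /\ ~ Sset q m i n) \/ Sset q m i n.-1 /\ (0 < n)%N).
  rewrite -(gap_setE qm im i0).
  exact: (weierstrass_dichotomy cm qm q1 frobK frobP frobF zeta_eq onC a0 irr
    erefl erefl erefl erefl erefl erefl cP cF N_order m1).
have hH := HgenP qm im i0 n; have hS := @Sset_succ q m i qm im i0 n.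
have hG : (Ggen q m n /\ ~ Sset q m i n) \/ Sset q m i n.-1 /\ (0 < n)%N -> (0 < n)%N.
  by move/(gap_setE qm im i0) => -[].
split.
  split=> [[n0 nw]|h]; first by apply: NNPP => h; apply/nw/W.
  by split; [exact: hG|move/W; apply].
split=> [/W h|h]; last by apply/W; tauto.
have [|] := classic (Sset q m i n); [tauto|].
have [|] := classic (Ggen q m n); tauto.
Qed.
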